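(* Assume that the system $g(p,x)\in C$ enjoys Robinson stability at $(\bar p,\bar x)$ and that $S$ is isolatedly calm at $(\bar p,\bar x)$. Suppose moreover that $P=P_1\times P_2$, that $g((p_1,p_2),x)=g((p_1,\bar p_2),x)$ for all $((p_1,p_2),x)\in P\times X$, and that $\nabla_{p_2}f(\bar p,\bar x)$ is surjective. Then condition (C1) holds. If in addition, for all $u\in{\cal K}_{\Gamma(\bar p)}(\bar x,-f(\bar z))$, $$\nabla h(g(\bar z))\nabla^2_xg(\bar z)(u,u)+\nabla^2h(g(\bar z))\big(\nabla_xg(\bar z)u,\nabla_xg(\bar z)u\big)\in\operatorname{rge}\big(\nabla h(g(\bar z))\circ\nabla g(\bar z)\big)+\operatorname{lin}T_C(g(\bar z)),$$ then condition (C2) also holds.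
   Context: Notation: $X=\mathbb R^n$, $P=\mathbb R^m$, $Y=\mathbb R^l$, $Z:=P\times X$, and $E$ is finite-dimensional. Dual spaces are distinguished from primal ones, and $A^*$ is the adjoint of a linear map $A$, and $\operatorname{rge}A$ its range. For a closed convex cone $A$, $\operatorname{lin}A:=A\cap(-A)$. For a closed set $\Omega$ and $\bar z\in\Omega$: the tangent cone is $T_\Omega(\bar z):=\{w:\exists\, t_k\downarrow0,\ w_k\to w \text{ with } \bar z+t_kw_k\in\Omega\}$; the regular normal cone is $N_\Omega(\bar z):=\{z^*:\limsup_{z\to\bar z,\,z\in\Omega}\langle z^*,z-\bar z\rangle/\|z-\bar z\|\le0\}$; and the critical cone is ${\cal K}_\Omega(\bar z,z^* ):=T_\Omega(\bar z)\cap\{z^*\}^\perp$. ${\cal B}_X$ is the closed unit ball. Setting: $g\colon P\times X\to Y$ is $C^2$ around $\bar z=(\bar p,\bar x)$. The set $C\subset Y$ is closed and $C^2$-cone reducible at $g(\bar z)$ to a closed convex cone $K\subset E$: there exist a neighborhood $V$ of $g(\bar z)$ and a $C^2$ map $h\colon V\to E$ with $h(g(\bar z))=0$, $\nabla h(g(\bar z))$ surjective, and $C\cap V=\{y\in V:h(y)\in K\}$. Set $\Gamma(p):=\{x:g(p,x)\in C\}$. The map $f\colon P\times X\to X^*$ is $C^1$ around $\bar z$, and $S(p):=\{x:0\in f(p,x)+N_{\Gamma(p)}(x)\}$ with $\bar x\in S(\bar p)$. Robinson stability of $g(p,x)\in C$ at $(\bar p,\bar x)$: there are $\kappa\ge0$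 and neighborhoods $W$ of $\bar p$ and $U$ of $\bar x$ with ${\rm dist}(x;\Gamma(p))\le\kappa\,{\rm dist}(g(p,x);C)$ on $W\times U$. $S$ is isolatedly calm at $(\bar p,\bar x)$ if there exist $\ell>0$ and neighborhoods $Q$ of $\bar p$ and $U$ of $\bar x$ such that $S(p)\cap U\subset\{\bar x\}+\ell\|p-\bar p\|{\cal B}_X$ for all $p\in Q$. Multipliers: for $\lambda\in N_C(g(\bar z))$, $(\nabla h(g(\bar z))^* )^{-1}\lambda$ denotes the unique $\mu\in E^*$ with $\nabla h(g(\bar z))^*\mu=\lambda$. For $z^*\in Z^*$, set $\Lambda(\bar z,z^* ):=\{\lambda\in N_C(g(\bar z)):\nabla g(\bar z)^*\lambda=z^*\}$, and for $v\in Z$, $$\Lambda(\bar z,z^*;v):=\arg\max_{\lambda\in\Lambda(\bar z,z^* )}\Big(\langle\lambda,\nabla^2g(\bar z)(v,v)\rangle+\nabla^2\langle(\nabla h(g(\bar z))^* )^{-1}\lambda,h(\cdot)\rangle(g(\bar z))\big(\nabla g(\bar z)v,\nabla g(\bar z)v\big)\Big).$$ Further, $\bar\Lambda:=\{\lambda\in N_C(g(\bar z)):f(\bar z)+\nabla_xg(\bar z)^*\lambda=0\}$. For $\lambda\in N_C(g(\bar z))$, define ${\cal H}^x_\lambda u:=\nabla_xg(\bar z)^*\nabla^2\langle(\nabla h(g(\bar z))^* )^{-1}\lambda,h(\cdot)\rangle(g(\bar z))\nabla_xg(\bar z)u$ and ${\cal F}_\lambda u:=\nabla_xf(\bar z)u+\nabla^2_x\langle\lambda,g(\cdot)\rangle(\bar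 z)u+{\cal H}^x_\lambda u$ for $u\in X$. Condition (C1): for every $0\ne u\in{\cal K}_{\Gamma(\bar p)}(\bar x,-f(\bar z))$, every $\lambda\in\bar\Lambda$, and every $\hat\lambda\in\Lambda(\bar z,\nabla g(\bar z)^*\lambda;(0,u))$, either $\langle{\cal F}_{\hat\lambda}u,u\rangle>0$ or $\langle{\cal F}_{\hat\lambda}u,\widetilde u\rangle<0$ for some $\widetilde u\in{\cal K}_{\Gamma(\bar p)}(\bar x,-f(\bar z))$. Condition (C2): for all $0\ne u\in{\cal K}_{\Gamma(\bar p)}(\bar x,-f(\bar z))$ and all $\lambda\in\bar\Lambda$, either $\langle{\cal F}_\lambda u,u\rangle>0$ or $\langle{\cal F}_\lambda u,\widetilde u\rangle<0$ for some $\widetilde u\in{\cal K}_{\Gamma(\bar p)}(\bar x,-f(\bar z))$.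
   Formalization: In the additional condition, lin T_C(g(z̄)) lies in Y while the rest lies in E, so the sum is ill-typed; it is read as rge(∇h(g(z̄))∘∇g(z̄)) + ∇h(g(z̄))(lin T_C(g(z̄))). *)

(* Defs.v *)
From Stdlib Require Import Reals ClassicalEpsilon.
From Stdlib Require Vectors.Fin.
Open Scope R_scope.

Definition vec (n : nat) := Fin.t n -> R.

Fixpoint sumF (n : nat) : (Fin.t n -> R) -> R :=
  match n return (Fin.t n -> R) -> R with
  | O => fun _ => 0
  | S m => fun f => f Fin.F1 + sumF m (fun i => f (Fin.FS i))
  end.

Class Euc (V : Type) := {
  vzero : V;
  vadd : V -> V -> V;
  vscal : R -> V -> V;
  inner : V -> V -> R }.

#[export] Instance Euc_vec (n : nat) : Euc (vec n) := {
  vzero := fun _ => 0;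
  vadd := fun x y i => x i + y i;
  vscal := fun t x i => t * x i;
  inner := fun x y => sumF n (fun i => x i * y i) }.

#[export] Instance Euc_prod (V W : Type) (EV : Euc V) (EW : Euc W) : Euc (V * W) := {
  vzero := (vzero, vzero);
  vadd := fun a b => (vadd (fst a) (fst b), vadd (snd a) (snd b));
  vscal := fun t a => (vscal t (fst a), vscal t (snd a));
  inner := fun a b => inner (fst a) (fst b) + inner (snd a) (snd b) }.

Definition vsub {V : Type} {EV : Euc V} (a b : V) : V := vadd a (vscal (-1) b).
Definition norm {V : Type} {EV : Euc V} (a : V) : R := sqrt (inner a a).

Section Generic.
Context {V W : Type} {EV : Euc V} {EW : Euc W}.

Definition ball (c : V) (r : R) (z : V) : Prop := norm (vsub z c) < r.
Definition is_open (U : V -> Prop) : Prop :=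
  forall z, U z -> exists r, r > 0 /\ forall w, ball z r w -> U w.
Definition is_nbhd (N : V -> Prop) (a : V) : Prop :=
  exists r, r > 0 /\ forall b, ball a r b -> N b.

Definition seq_cv (s : nat -> V) (l : V) : Prop :=
  forall eps, eps > 0 -> exists N, forall k, (k >= N)%nat -> norm (vsub (s k) l) < eps.
Definition is_closed (A : V -> Prop) : Prop :=
  forall s l, (forall k, A (s k)) -> seq_cv s l -> A l.

Definition is_linear (L : V -> W) : Prop :=
  forall a b x y, L (vadd (vscal a x) (vscal b y)) = vadd (vscal a (L x)) (vscal b (L y)).
Definition surjective (L : V -> W) : Prop := forall w, exists v, L v = w.

Definition frechet (f : V -> W) (L : V -> W) (x : V) : Prop :=
  is_linear L /\
  forall eps, eps > 0 -> exists del, del > 0 /\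
    forall hh, norm hh < del ->
      norm (vsub (vsub (f (vadd x hh)) (f x)) (L hh)) <= eps * norm hh.

(* B (a bilinear map, i.e. element of L(V,L(V,W))) is the Frechet derivative at x
   of F : V -> L(V,W), w.r.t. the operator norm *)
Definition frechet2 (F : V -> V -> W) (B : V -> V -> W) (x : V) : Prop :=
  (forall u, is_linear (B u)) /\
  (forall a b u1 u2 w,
      B (vadd (vscal a u1) (vscal b u2)) w = vadd (vscal a (B u1 w)) (vscal b (B u2 w))) /\
  forall eps, eps > 0 -> exists del, del > 0 /\
    forall hh, norm hh < del -> forall w,
      norm (vsub (vsub (F (vadd x hh) w) (F x w)) (B hh w)) <= eps * norm hh * norm w.

Definition op_cont1 (A : V -> V -> W) (x : V) : Prop :=
  forall eps, eps > 0 -> exists del, del > 0 /\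
    forall x', norm (vsub x' x) < del -> forall u,
      norm (vsub (A x' u) (A x u)) <= eps * norm u.
Definition op_cont2 (B : V -> V -> V -> W) (x : V) : Prop :=
  forall eps, eps > 0 -> exists del, del > 0 /\
    forall x', norm (vsub x' x) < del -> forall u w,
      norm (vsub (B x' u w) (B x u w)) <= eps * norm u * norm w.

Definition C1_on (U : V -> Prop) (f : V -> W) (Df : V -> V -> W) : Prop :=
  forall z, U z -> frechet f (Df z) z /\ op_cont1 Df z.
Definition C2_on (U : V -> Prop) (g : V -> W) (Dg : V -> V -> W) (D2g : V -> V -> V -> W)
  : Prop :=
  forall z, U z -> frechet g (Dg z) z /\ frechet2 Dg (D2g z) z /\ op_cont2 D2g z.
Definition C1_around f Df (z : V) : Prop := exists r, r > 0 /\ C1_on (ball z r) f Df.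
Definition C2_around g Dg D2g (z : V) : Prop := exists r, r > 0 /\ C2_on (ball z r) g Dg D2g.

Definition tangent_cone (A : V -> Prop) (a : V) (w : V) : Prop :=
  exists (t : nat -> R) (ws : nat -> V),
    (forall k, 0 < t k) /\ Un_cv t 0 /\ seq_cv ws w /\
    forall k, A (vadd a (vscal (t k) (ws k))).
Definition lin_cone (T : V -> Prop) (w : V) : Prop := T w /\ T (vscal (-1) w).
(* regular normal cone (empty if a ∉ A); dual identified with V via inner *)
Definition normal_cone (A : V -> Prop) (a : V) (v : V) : Prop :=
  A a /\
  forall eps, eps > 0 -> exists del, del > 0 /\
    forall z, A z -> norm (vsub z a) < del -> inner v (vsub z a) <= eps * norm (vsub z a).
Definition critical_cone (A : V -> Prop) (a : V) (v : V) (w : V) : Prop :=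
  tangent_cone A a w /\ inner v w = 0.

(* dist(x; A) <= d  (dist(x; ∅) = +∞) *)
Definition dist_le (A : V -> Prop) (x : V) (d : R) : Prop :=
  forall eps, eps > 0 -> exists a, A a /\ norm (vsub x a) < d + eps.

Definition closed_convex_cone (K : V -> Prop) : Prop :=
  is_closed K /\ K vzero /\
  (forall t a, 0 <= t -> K a -> K (vscal t a)) /\
  (forall a b, K a -> K b -> K (vadd a b)).
End Generic.

Definition unitv {n : nat} (i : Fin.t n) : vec n :=
  fun j => if Fin.eq_dec i j then 1 else 0.
Definition riesz {n : nat} (phi : vec n -> R) : vec n := fun i => phi (unitv i).
Definition adjv {n : nat} {W : Type} {EW : Euc W} (A : vec n -> W) (w : W) : vec n :=
  riesz (fun x => inner w (A x)).

(* (A^* )^{-1} lam : the (unique, when it exists) mu with A^* mu = lam *)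
Definition inv_adj {l k : nat} (A : vec l -> vec k) (lam : vec l) : vec k :=
  epsilon (inhabits vzero) (fun mu => forall y, inner mu (A y) = inner lam y).

Section Problem.
Context {m1 m2 n l k : nat}.
Notation P := (vec m1 * vec m2)%type.
Notation X := (vec n).
Notation Z := (P * X)%type.
Notation Y := (vec l).
Notation E := (vec k).

Definition Gamma (g : Z -> Y) (C : Y -> Prop) (p : P) (x : X) : Prop := C (g (p, x)).
Definition Ssol (g : Z -> Y) (C : Y -> Prop) (f : Z -> X) (p : P) (x : X) : Prop :=
  normal_cone (Gamma g C p) x (vscal (-1) (f (p, x))).

Definition robinson_stable (g : Z -> Y) (C : Y -> Prop) (pb : P) (xb : X) : Prop :=
  exists kappa (W : P -> Prop) (U : X -> Prop),
    0 <= kappa /\ is_nbhd W pb /\ is_nbhd U xb /\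
    forall p x, W p -> U x ->
      (* dist(x;Γ(p)) <= kappa * dist(g(p,x);C) *)
      forall c, C c -> dist_le (Gamma g C p) x (kappa * norm (vsub (g (p, x)) c)).

Definition isolatedly_calm (S : P -> X -> Prop) (pb : P) (xb : X) : Prop :=
  exists ell (Q : P -> Prop) (U : X -> Prop),
    ell > 0 /\ is_nbhd Q pb /\ is_nbhd U xb /\
    forall p x, Q p -> S p x -> U x -> norm (vsub x xb) <= ell * norm (vsub p pb).

Definition cone_reducible (C : Y -> Prop) (yb : Y) (K : E -> Prop)
  (h : Y -> E) (Dh : Y -> Y -> E) (D2h : Y -> Y -> Y -> E) : Prop :=
  closed_convex_cone K /\
  exists V : Y -> Prop,
    is_open V /\ V yb /\ C2_on V h Dh D2h /\ h yb = vzero /\ surjective (Dh yb) /\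
    forall y, V y -> (C y <-> K (h y)).

Definition Dx {W : Type} {EW : Euc W} (DG : Z -> Z -> W) (zb : Z) (u : X) : W :=
  DG zb (vzero, u).

(* ∇²⟨mu,h(·)⟩(yb) y  (as element of Y* ≅ Y), D2h0 = ∇²h(yb) *)
Definition hess_mu_h (D2h0 : Y -> Y -> E) (mu : E) (y : Y) : Y :=
  riesz (fun y' => inner mu (D2h0 y y')).

Definition Hx (Dg : Z -> Z -> Y) (zb : Z) (Dh0 : Y -> E) (D2h0 : Y -> Y -> E)
  (lam : Y) (u : X) : X :=
  adjv (Dx Dg zb) (hess_mu_h D2h0 (inv_adj Dh0 lam) (Dx Dg zb u)).

Definition Fop (Df : Z -> Z -> X) (Dg : Z -> Z -> Y) (D2g : Z -> Z -> Z -> Y) (zb : Z)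
  (Dh0 : Y -> E) (D2h0 : Y -> Y -> E) (lam : Y) (u : X) : X :=
  vadd (vadd (Dx Df zb u)
             (riesz (fun w => inner lam (D2g zb (vzero, u) (vzero, w)))))
       (Hx Dg zb Dh0 D2h0 lam u).

(* Λ(zb, zs) with zs ∈ Z* given as a linear functional *)
Definition LamSet (C : Y -> Prop) (yb : Y) (Dg0 : Z -> Y) (zs : Z -> R) (lam : Y) : Prop :=
  normal_cone C yb lam /\ forall v, inner lam (Dg0 v) = zs v.

Definition lam_obj (Dg0 : Z -> Y) (D2g0 : Z -> Z -> Y) (Dh0 : Y -> E) (D2h0 : Y -> Y -> E)
  (lam : Y) (v : Z) : R :=
  inner lam (D2g0 v v) + inner (hess_mu_h D2h0 (inv_adj Dh0 lam) (Dg0 v)) (Dg0 v).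

Definition LamArg (C : Y -> Prop) (yb : Y) (Dg0 : Z -> Y) (D2g0 : Z -> Z -> Y)
  (Dh0 : Y -> E) (D2h0 : Y -> Y -> E) (zs : Z -> R) (v : Z) (lam : Y) : Prop :=
  LamSet C yb Dg0 zs lam /\
  forall lam', LamSet C yb Dg0 zs lam' ->
    lam_obj Dg0 D2g0 Dh0 D2h0 lam' v <= lam_obj Dg0 D2g0 Dh0 D2h0 lam v.

Definition LamBar (C : Y -> Prop) (f : Z -> X) (g : Z -> Y) (Dg : Z -> Z -> Y) (zb : Z)
  (lam : Y) : Prop :=
  normal_cone C (g zb) lam /\ vadd (f zb) (adjv (Dx Dg zb) lam) = vzero.

Definition Kcrit (g : Z -> Y) (C : Y -> Prop) (f : Z -> X) (pb : P) (xb : X) (u : X) : Prop :=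
  critical_cone (Gamma g C pb) xb (vscal (-1) (f (pb, xb))) u.

Definition cond_C1 (g : Z -> Y) (C : Y -> Prop) (f : Z -> X) (Df : Z -> Z -> X)
  (Dg : Z -> Z -> Y) (D2g : Z -> Z -> Z -> Y)
  (Dh : Y -> Y -> E) (D2h : Y -> Y -> Y -> E) (pb : P) (xb : X) : Prop :=
  let zb := (pb, xb) in
  forall u : X, u <> vzero -> Kcrit g C f pb xb u ->
  forall lam, LamBar C f g Dg zb lam ->
  forall lamh, LamArg C (g zb) (Dg zb) (D2g zb) (Dh (g zb)) (D2h (g zb))
                 (fun v => inner lam (Dg zb v)) (vzero, u) lamh ->
    inner (Fop Df Dg D2g zb (Dh (g zb)) (D2h (g zb)) lamh u) u > 0 \/
    exists ut, Kcrit g C f pb xb ut /\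
      inner (Fop Df Dg D2g zb (Dh (g zb)) (D2h (g zb)) lamh u) ut < 0.

Definition cond_C2 (g : Z -> Y) (C : Y -> Prop) (f : Z -> X) (Df : Z -> Z -> X)
  (Dg : Z -> Z -> Y) (D2g : Z -> Z -> Z -> Y)
  (Dh : Y -> Y -> E) (D2h : Y -> Y -> Y -> E) (pb : P) (xb : X) : Prop :=
  let zb := (pb, xb) in
  forall u : X, u <> vzero -> Kcrit g C f pb xb u ->
  forall lam, LamBar C f g Dg zb lam ->
    inner (Fop Df Dg D2g zb (Dh (g zb)) (D2h (g zb)) lam u) u > 0 \/
    exists ut, Kcrit g C f pb xb ut /\
      inner (Fop Df Dg D2g zb (Dh (g zb)) (D2h (g zb)) lam u) ut < 0.

Definition extra_cond (g : Z -> Y) (C : Y -> Prop) (f : Z -> X)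
  (Dg : Z -> Z -> Y) (D2g : Z -> Z -> Z -> Y) (Dh : Y -> Y -> E) (D2h : Y -> Y -> Y -> E)
  (pb : P) (xb : X) : Prop :=
  let zb := (pb, xb) in
  let yb := g zb in
  forall u : X, Kcrit g C f pb xb u ->
    exists (v : Z) (w : Y), lin_cone (tangent_cone C yb) w /\
      vadd (Dh yb (D2g zb (vzero, u) (vzero, u))) (D2h yb (Dx Dg zb u) (Dx Dg zb u))
      = vadd (Dh yb (Dg zb v)) (Dh yb w).
End Problem.

(* Main.v *)
Require Import Defs.
From Stdlib Require Import Reals Lra Lia List FunctionalExtensionality ClassicalEpsilon Classical.
Open Scope R_scope.

(** Write G = h o g, so that near the reference point x lies in Gamma(p) iff G(p,x) lies in K, and
    let mu in the polar of K represent the given multiplier.  If (C1) fails at u, then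
    <F u, d> >= 0 for every critical direction d and <F u, u> = 0.
    Maximality of mu among the multipliers with the same value of grad G^* mu gives, by separation
    in E x R and with no constraint qualification, for each eps > 0 a vector v and k in K with
    |G''(u,u) + grad G v - k| <= eps and <mu, k> >= -eps.  The p-component of v perturbs the parameter
    by O(t^2).  On the feasible set of that parameter one minimizes
    <f(zb) + t grad_x f u, x - xb> + (M/2)|x - xb - t u|^2: Robinson stability supplies a competitor
    near xb + t u, the Lagrangian with multiplier mu a lower bound, and the minimizer x satisfies
    |x - xb - t u| <= sigma t with sigma as small as desired.  The gradient at x is minus a normal, and
    since grad_(p2) f is onto and g ignores p2, moving p2 by O(sigma t) makes f(p,x) equal to it.
    So x solves the problem at a parameter within O(sigma t) of pb while |x - xb| is about t|u|,
    against isolated calmness.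
    The extra condition makes the maximized objective constant, which reduces (C2) to (C1). *)

(** * Euclidean spaces *)

(** Without a constraint qualification the sum of K and the range of grad G need not be closed, so
    optimality of the multiplier yields only an approximate certificate. Its data v and k may blow
    up as eps tends to 0; they are fixed once eps is, and only then is t made small. The order of
    the other constants is just as rigid: the cost of moving p2 is sigma t times a factor that grows
    with M, so M must not depend on sigma, which is chosen last to beat the calmness modulus. With v
    = x - xb - t u, the penalty M |v|^2 / 2 outweighs the indefinite curvature of the Lagrangian,
    and t <F u, v> is what remains between the two bounds. Limits of (x - xb) / t are critical
    directions, so failure of (C1) keeps <F u, x - xb> above -o(t), and <F u, u> <= 0 disposes of
    the part t u. Since x is feasible for the perturbed parameter and tangents refer to Gamma(pb), x
    is moved into Gamma(pb) for this test, at distance O(t^2). *)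

Definition lincomb {V : Type} {EV : Euc V} (x : V) (l : list V) : V :=
  fold_right (fun e s => vadd (vscal (inner x e) e) s) vzero l.

Lemma lincomb_cons {V : Type} {EV : Euc V} (x e : V) l :
  lincomb x (e :: l) = vadd (vscal (inner x e) e) (lincomb x l).
Proof. reflexivity. Qed.

Lemma lincomb_nil {V : Type} {EV : Euc V} (x : V) : lincomb x nil = vzero.
Proof. reflexivity. Qed.

(* [Euc] carries operations without laws; the spanning list with x = sum <x,e> e plays the
   role of an orthonormal basis. *)
Class EucSpace (V : Type) {EV : Euc V} : Prop := {
  inner_sym : forall a b : V, inner a b = inner b a;
  inner_addl : forall a b c : V, inner (vadd a b) c = inner a c + inner b c;
  inner_scall : forall t (a c : V), inner (vscal t a) c = t * inner a c;
  inner_zerol : forall c : V, inner vzero c = 0;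
  inner_pos : forall a : V, 0 <= inner a a;
  inner_ext : forall a b : V, (forall c, inner a c = inner b c) -> a = b;
  fin_basis : exists l : list V, forall x, x = lincomb x l }.

Lemma sumF_ext n (f f' : Fin.t n -> R) : (forall i, f i = f' i) -> sumF n f = sumF n f'.
Proof. intros H; f_equal; extensionality i; apply H. Qed.

Lemma sumF_add n (f f' : Fin.t n -> R) :
  sumF n (fun i => f i + f' i) = sumF n f + sumF n f'.
Proof. induction n as [|n IH]; simpl; [ring|]. rewrite (IH (fun i => f (Fin.FS i))). ring. Qed.

Lemma sumF_scal n t (f : Fin.t n -> R) : sumF n (fun i => t * f i) = t * sumF n f.
Proof. induction n as [|n IH]; simpl; [ring|]. rewrite (IH (fun i => f (Fin.FS i))). ring. Qed.

Lemma sumF_0 n : sumF n (fun _ => 0) = 0.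
Proof. induction n as [|n IH]; simpl; [reflexivity|]. rewrite IH. ring. Qed.

Lemma sumF_pos n (f : Fin.t n -> R) : (forall i, 0 <= f i) -> 0 <= sumF n f.
Proof.
  induction n as [|n IH]; simpl; intros H; [lra|].
  pose proof (H Fin.F1). pose proof (IH (fun i => f (Fin.FS i)) (fun i => H (Fin.FS i))). lra.
Qed.

Definition consF {n} (a : R) (y : vec n) : vec (S n) := fun i => Fin.caseS' i (fun _ => R) a y.

Lemma consF_eta n (x : vec (S n)) : x = consF (x Fin.F1) (fun i => x (Fin.FS i)).
Proof. extensionality i. pattern i. apply (Fin.caseS' i); reflexivity. Qed.

Lemma unitv_F1 n : @unitv (S n) Fin.F1 = consF 1 vzero.
Proof.
  extensionality i. unfold unitv. pattern i. apply (Fin.caseS' i).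
  - destruct (Fin.eq_dec Fin.F1 Fin.F1); [reflexivity|congruence].
  - intros j. destruct (Fin.eq_dec Fin.F1 (Fin.FS j)); [discriminate|reflexivity].
Qed.

Lemma unitv_FS n (j : Fin.t n) : unitv (Fin.FS j) = consF 0 (unitv j).
Proof.
  extensionality i. unfold unitv. pattern i. apply (Fin.caseS' i).
  - destruct (Fin.eq_dec (Fin.FS j) Fin.F1); [discriminate|reflexivity].
  - intros i'. cbn.
    destruct (Fin.eq_dec (Fin.FS j) (Fin.FS i')), (Fin.eq_dec j i'); try reflexivity.
    + exfalso. apply n0. now apply Fin.FS_inj.
    + exfalso. apply n0. now f_equal.
Qed.

(** Induction on the dimension: y is its first coordinate times the first unit vector plus a vector
    with zero head, and the induction hypothesis applies to phi composed with [consF 0]. *)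
Lemma riesz_inner n (phi : vec n -> R) (y : vec n) :
  (forall a b x y, phi (vadd (vscal a x) (vscal b y)) = a * phi x + b * phi y) ->
  inner (riesz phi) y = phi y.
Proof.
  induction n as [|n IH]; intros Hl; cbn.
  - pose proof (Hl 0 0 y y) as H.
    replace y with (vadd (vscal 0 y) (vscal 0 y)); [lra|].
    extensionality i. inversion i.
  - assert (H : phi y = y Fin.F1 * phi (unitv Fin.F1)
                       + 1 * phi (consF 0 (fun i => y (Fin.FS i)))).
    { rewrite <- Hl. f_equal. extensionality i. rewrite unitv_F1. cbn.
      pattern i. apply (Fin.caseS' i); intros; cbn; ring. }
    rewrite H. specialize (IH (fun z => phi (consF 0 z)) (fun i => y (Fin.FS i))).
    cbn in IH. rewrite <- IH.
    + unfold riesz. rewrite Rmult_1_l, Rmult_comm. f_equal.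
      apply sumF_ext. intros i. now rewrite unitv_FS.
    + intros a b u v. rewrite <- Hl. f_equal. extensionality i. cbn.
      pattern i. apply (Fin.caseS' i); intros; cbn; ring.
Qed.

Lemma vec_fin_basis n : exists l : list (vec n), forall x, x = lincomb x l.
Proof.
  induction n as [|n [l IH]].
  - exists nil. intros x. extensionality i. inversion i.
  - exists (consF 1 vzero :: map (consF 0) l). intros x.
    assert (H : lincomb x (map (consF 0) l) = consF 0 (lincomb (fun i => x (Fin.FS i)) l)).
    { clear IH. induction l as [|e l IHl]; cbn [map]; rewrite ?lincomb_nil, ?lincomb_cons.
      - extensionality i. pattern i. apply (Fin.caseS' i); reflexivity.
      - rewrite IHl. extensionality i.
        pattern i. apply (Fin.caseS' i); intros; cbn; ring. }
    rewrite lincomb_cons, H, <- IH.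
    rewrite (consF_eta n x) at 1. extensionality i. cbn.
    replace (sumF n (fun i0 => x (Fin.FS i0) * 0)) with 0
      by (symmetry; erewrite sumF_ext; [apply sumF_0 | intros; cbn; ring]).
    pattern i. apply (Fin.caseS' i); intros; cbn; lra.
Qed.

#[export] Instance EucSpace_vec n : EucSpace (vec n).
Proof.
  split; cbn.
  - intros; apply sumF_ext; intros; ring.
  - intros; rewrite <- sumF_add; apply sumF_ext; intros; ring.
  - intros; rewrite <- sumF_scal; apply sumF_ext; intros; ring.
  - intros; erewrite sumF_ext; [apply sumF_0 | intros; cbn; ring].
  - intros; apply sumF_pos; intros; nra.
  - intros a b H. extensionality i.
    assert (He : forall x : vec n, inner (unitv i) x = x i).
    { intros x. pose proof (riesz_inner n (fun x => x i) x (fun a b x y => eq_refl)) as Hr.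
      cbn in Hr |- *. rewrite <- Hr. apply sumF_ext. intros j. unfold riesz, unitv.
      destruct (Fin.eq_dec i j), (Fin.eq_dec j i); congruence. }
    rewrite <- (He a), <- (He b). cbn.
    transitivity (sumF n (fun j => a j * unitv i j)); [apply sumF_ext; intros; ring|].
    rewrite H. apply sumF_ext; intros; ring.
  - apply vec_fin_basis.
Qed.

(** The real line is needed as second factor of E x R, where multipliers are separated. *)
#[export] Instance Euc_R : Euc R :=
  { vzero := 0; vadd := Rplus; vscal := Rmult; inner := Rmult }.

#[export] Instance EucSpace_R : EucSpace R.
Proof.
  split; cbn; try (intros; ring).
  - intros; nra.
  - intros a b H. specialize (H 1). lra.
  - exists (1 :: nil). intros x. cbn. ring.
Qed.

#[export] Instance EucSpace_prod V W (EV : Euc V) (EW : Euc W) (HV : EucSpace V) (HW : EucSpace W) :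
  EucSpace (V * W).
Proof.
  split; cbn.
  - intros [] []; cbn; rewrite (inner_sym v), (inner_sym w); ring.
  - intros [] [] []; cbn; rewrite !inner_addl; ring.
  - intros t [] []; cbn; rewrite !inner_scall; ring.
  - intros []; cbn; rewrite !inner_zerol; ring.
  - intros []; cbn. pose proof (inner_pos v). pose proof (inner_pos w). lra.
  - intros [a1 a2] [b1 b2] H; cbn in H. f_equal; apply inner_ext; intros c.
    + specialize (H (c, vzero)). cbn in H.
      rewrite (inner_sym a2), (inner_sym b2), !inner_zerol in H. lra.
    + specialize (H (vzero, c)). cbn in H.
      rewrite (inner_sym a1), (inner_sym b1), !inner_zerol in H. lra.
  - destruct (fin_basis (V := V)) as [l1 H1], (fin_basis (V := W)) as [l2 H2].
    exists (map (fun v => (v, vzero)) l1 ++ map (fun w => (vzero, w)) l2).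
    intros [x y].
    assert (Hz : forall U (EU : Euc U) (HU : EucSpace U) (a : U), inner a vzero = 0)
      by (intros; rewrite inner_sym; apply inner_zerol).
    assert (E2 : lincomb (x, y) (map (fun w : W => (@vzero V _, w)) l2) = (vzero, lincomb y l2)).
    { clear H1 H2. induction l2 as [|e l IH]; cbn [map]; rewrite ?lincomb_nil, ?lincomb_cons;
      [reflexivity|].
      rewrite IH. cbn. f_equal; apply inner_ext; intros c;
      rewrite ?inner_addl, ?inner_scall, ?inner_zerol, ?Hz by exact _; ring. }
    rewrite (H1 x), (H2 y) at 1. clear H1 H2.
    induction l1 as [|e l IH]; cbn [map app]; rewrite ?lincomb_nil, ?lincomb_cons.
    + symmetry. exact E2.
    + rewrite <- IH. cbn.
      f_equal; apply inner_ext; intros c;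
      rewrite ?inner_addl, ?inner_scall, ?inner_zerol, ?Hz by exact _; ring.
Qed.

Lemma Rabs_le_inv a b : Rabs a <= b -> - b <= a <= b.
Proof. unfold Rabs. destruct (Rcase_abs a); lra. Qed.

Section InnerAlgebra.
Context {V : Type} {EV : Euc V} {HV : EucSpace V}.

Lemma inner_addr (a b c : V) : inner c (vadd a b) = inner c a + inner c b.
Proof. now rewrite inner_sym, inner_addl, !(inner_sym c). Qed.
Lemma inner_scalr t (a c : V) : inner c (vscal t a) = t * inner c a.
Proof. now rewrite inner_sym, inner_scall, (inner_sym c). Qed.
Lemma inner_zeror (c : V) : inner c vzero = 0.
Proof. rewrite inner_sym; apply inner_zerol. Qed.
End InnerAlgebra.

Ltac inn := unfold vsub;
  repeat rewrite ?inner_addl, ?inner_scall, ?inner_zerol, ?inner_addr, ?inner_scalr, ?inner_zeror.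
(** Vector identities are checked by pairing with an arbitrary vector, which turns them into
    identities of real numbers. *)
Ltac veq := apply inner_ext; intro; unfold vsub;
  repeat rewrite ?inner_addl, ?inner_scall, ?inner_zerol; try field.

(** * Norms, sequences, compactness *)

Section Norm.
Context {V : Type} {EV : Euc V} {HV : EucSpace V}.

Lemma norm_ge0 (a : V) : 0 <= norm a.
Proof. apply sqrt_pos. Qed.

Lemma norm_sq (a : V) : norm a * norm a = inner a a.
Proof. apply sqrt_sqrt, inner_pos. Qed.

Lemma norm_le_sq (a : V) r : 0 <= r -> inner a a <= r * r -> norm a <= r.
Proof. intros Hr H. rewrite <- norm_sq in H. pose proof (norm_ge0 a). nra. Qed.

(** Definiteness follows from extensionality: t -> <a + t c, a + t c> is nonnegative without
    constant term, hence without linear term, so <a, c> = 0 for every c. *)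
Lemma inner_def (a : V) : inner a a = 0 -> a = vzero.
Proof.
  intros H0. apply inner_ext. intros c. rewrite inner_zerol.
  set (s := inner a c).
  assert (H : forall t, 0 <= 2 * t * s + t * t * inner c c).
  { intros t. pose proof (inner_pos (vadd a (vscal t c))) as H. revert H. inn.
    rewrite (inner_sym c a), H0. fold s. intros; lra. }
  pose proof (inner_pos c) as Hc.
  destruct (Req_dec s 0) as [|Hs]; [assumption|exfalso].
  pose proof (H (- s / (1 + inner c c))) as H1.
  assert (H2 : 2 * (- s / (1 + inner c c)) * s
     + - s / (1 + inner c c) * (- s / (1 + inner c c)) * inner c c
     = - (s * s) * ((2 + inner c c) / ((1 + inner c c) * (1 + inner c c)))) by (field; lra).
  rewrite H2 in H1.
  assert (0 < (2 + inner c c) / ((1 + inner c c) * (1 + inner c c)))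
    by (apply Rdiv_lt_0_compat; nra).
  assert (0 < s * s) by nra. nra.
Qed.

Lemma norm_eq0 (a : V) : norm a = 0 -> a = vzero.
Proof. intros H. apply inner_def. rewrite <- norm_sq, H. ring. Qed.

Lemma cauchy_schwarz (a b : V) : inner a b <= norm a * norm b.
Proof.
  destruct (Req_dec (norm a) 0) as [Ha|Ha].
  { rewrite Ha, (norm_eq0 a Ha), inner_zerol. lra. }
  destruct (Req_dec (norm b) 0) as [Hb|Hb].
  { rewrite Hb, (norm_eq0 b Hb), inner_zeror. lra. }
  pose proof (norm_ge0 a). pose proof (norm_ge0 b).
  assert (0 < norm a * norm b) by (apply Rmult_lt_0_compat; lra).
  pose proof (inner_pos (vsub (vscal (norm b) a) (vscal (norm a) b))) as H2. revert H2. inn.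
  rewrite <- !norm_sq, (inner_sym b a). intros. nra.
Qed.

Lemma norm_scal t (a : V) : norm (vscal t a) = Rabs t * norm a.
Proof.
  unfold norm. inn. rewrite <- Rmult_assoc, sqrt_mult, <- sqrt_Rsqr_abs;
  [reflexivity|nra|apply inner_pos].
Qed.

Lemma norm_opp (a : V) : norm (vscal (-1) a) = norm a.
Proof. rewrite norm_scal, Rabs_left by lra. ring. Qed.

Lemma norm_zero : norm (vzero : V) = 0.
Proof. unfold norm. rewrite inner_zerol. apply sqrt_0. Qed.

Lemma cauchy_schwarz_abs (a b : V) : Rabs (inner a b) <= norm a * norm b.
Proof.
  apply Rabs_le. split; [|apply cauchy_schwarz].
  pose proof (cauchy_schwarz (vscal (-1) a) b) as H. rewrite norm_opp in H. revert H. inn. lra.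
Qed.

Lemma norm_add (a b : V) : norm (vadd a b) <= norm a + norm b.
Proof.
  pose proof (norm_ge0 a). pose proof (norm_ge0 b). apply norm_le_sq; [lra|]. inn.
  rewrite <- !norm_sq, (inner_sym b a). pose proof (cauchy_schwarz a b). nra.
Qed.

Lemma norm_sub (a b : V) : norm (vsub a b) <= norm a + norm b.
Proof. unfold vsub. rewrite <- (norm_opp b). apply norm_add. Qed.

Lemma norm_subC (a b : V) : norm (vsub a b) = norm (vsub b a).
Proof. rewrite <- norm_opp. f_equal. veq. Qed.

Lemma norm_tri (b a c : V) : norm (vsub a c) <= norm (vsub a b) + norm (vsub b c).
Proof. replace (vsub a c) with (vadd (vsub a b) (vsub b c)) by veq. apply norm_add. Qed.

Lemma norm_sub_lower (a b : V) : norm a <= norm b + norm (vsub a b).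
Proof. replace a with (vadd b (vsub a b)) at 1 by veq. apply norm_add. Qed.

Lemma vsub_self (a : V) : vsub a a = vzero.
Proof. veq. Qed.

Lemma norm_small_eq0 (a : V) : (forall eps, eps > 0 -> norm a <= eps) -> a = vzero.
Proof.
  intros H. apply norm_eq0. pose proof (norm_ge0 a).
  destruct (Rle_lt_dec (norm a) 0); [lra|]. specialize (H (norm a / 2)). lra.
Qed.

End Norm.

Section ProdNorm.
Context {V W : Type} {EV : Euc V} {EW : Euc W} {HV : EucSpace V} {HW : EucSpace W}.

Lemma norm_fst (a : V) (b : W) : norm a <= norm (a, b).
Proof.
  apply norm_le_sq; [apply norm_ge0|]. rewrite norm_sq. cbn. pose proof (inner_pos b). lra.
Qed.
Lemma norm_snd (a : V) (b : W) : norm b <= norm (a, b).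
Proof.
  apply norm_le_sq; [apply norm_ge0|]. rewrite norm_sq. cbn. pose proof (inner_pos a). lra.
Qed.
Lemma norm_pair (a : V) (b : W) : norm (a, b) <= norm a + norm b.
Proof.
  pose proof (norm_ge0 a). pose proof (norm_ge0 b).
  apply norm_le_sq; [lra|]. cbn. rewrite <- !norm_sq. nra.
Qed.
End ProdNorm.

(** * Convergence of sequences *)

Section Sequences.
Context {V : Type} {EV : Euc V} {HV : EucSpace V}.

Lemma seq_cv_inner (s : nat -> V) l c : seq_cv s l -> Un_cv (fun j => inner (s j) c) (inner l c).
Proof.
  intros H eps He. pose proof (norm_ge0 c).
  destruct (H (eps / (1 + norm c))) as [N HN]; [apply Rdiv_lt_0_compat; lra|].
  exists N. intros j Hj. unfold Rdist.
  replace (inner (s j) c - inner l c) with (inner (vsub (s j) l) c) by (inn; ring).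
  eapply Rle_lt_trans; [apply cauchy_schwarz_abs|].
  specialize (HN j Hj). pose proof (norm_ge0 (vsub (s j) l)).
  replace eps with (eps / (1 + norm c) * (1 + norm c)) by (field; lra). nra.
Qed.

Lemma seq_cv_sub (s : nat -> V) l phi :
  (forall j, (phi j >= j)%nat) -> seq_cv s l -> seq_cv (fun j => s (phi j)) l.
Proof.
  intros Hp H eps He. destruct (H eps He) as [N HN]. exists N. intros j Hj. apply HN.
  specialize (Hp j). lia.
Qed.

Lemma Un_cv_sub (s : nat -> R) l phi :
  (forall j, (phi j >= j)%nat) -> Un_cv s l -> Un_cv (fun j => s (phi j)) l.
Proof.
  intros Hp H eps He. destruct (H eps He) as [N HN]. exists N. intros j Hj. apply HN.
  specialize (Hp j). lia.
Qed.

Lemma seq_cv_add (s s' : nat -> V) l l' :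
  seq_cv s l -> seq_cv s' l' -> seq_cv (fun j => vadd (s j) (s' j)) (vadd l l').
Proof.
  intros H H' eps He. destruct (H (eps/2)) as [N HN]; [lra|].
  destruct (H' (eps/2)) as [N' HN']; [lra|]. exists (max N N'). intros j Hj.
  replace (vsub (vadd (s j) (s' j)) (vadd l l'))
    with (vadd (vsub (s j) l) (vsub (s' j) l')) by veq.
  eapply Rle_lt_trans; [apply norm_add|].
  specialize (HN j). specialize (HN' j). pose proof (HN ltac:(lia)). pose proof (HN' ltac:(lia)). lra.
Qed.

Lemma seq_cv_scal (t : nat -> R) t0 (v : V) :
  Un_cv t t0 -> seq_cv (fun j => vscal (t j) v) (vscal t0 v).
Proof.
  intros H eps He. pose proof (norm_ge0 v).
  destruct (H (eps / (1 + norm v))) as [N HN]; [apply Rdiv_lt_0_compat; lra|].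
  exists N. intros j Hj. specialize (HN j Hj). unfold Rdist in HN.
  replace (vsub (vscal (t j) v) (vscal t0 v)) with (vscal (t j - t0) v) by veq.
  rewrite norm_scal. pose proof (Rabs_pos (t j - t0)).
  replace eps with (eps / (1 + norm v) * (1 + norm v)) by (field; lra). nra.
Qed.

Lemma seq_cv_const (v : V) : seq_cv (fun _ => v) v.
Proof. intros eps He. exists 0%nat. intros. rewrite vsub_self, norm_zero. lra. Qed.

Lemma seq_cv_le (s : nat -> V) l (c : V) r :
  seq_cv s l -> (forall j, norm (vsub (s j) c) <= r) -> norm (vsub l c) <= r.
Proof.
  intros H Hr. apply Rnot_lt_le. intros Hc.
  destruct (H (norm (vsub l c) - r)) as [N HN]; [lra|].
  specialize (HN N (le_n N)). rewrite norm_subC in HN.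
  pose proof (norm_tri (s N) l c). specialize (Hr N). lra.
Qed.

(** The spanning list assembles limits of coefficients into a limit vector, which transfers
    completeness from the line to V. *)
Lemma components_cv (s : nat -> V) :
  (forall c, exists l, Un_cv (fun j => inner (s j) c) l) -> exists l, seq_cv s l.
Proof.
  intros H. destruct (fin_basis (V := V)) as [b Hb].
  assert (Hl : forall b : list V, exists l, seq_cv (fun j => lincomb (s j) b) l).
  { clear b Hb. induction b as [|e b [l Hl]].
    - exists vzero. exact (seq_cv_const vzero).
    - destruct (H e) as [c Hc]. exists (vadd (vscal c e) l).
      apply (seq_cv_add (fun j => vscal (inner (s j) e) e)); [now apply seq_cv_scal|exact Hl]. }
  destruct (Hl b) as [l Hc]. exists l. intros eps He. destruct (Hc eps He) as [N HN].
  exists N. intros j Hj. rewrite (Hb (s j)). now apply HN.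
Qed.

Lemma cauchy_cv (s : nat -> V) :
  (forall eps, eps > 0 -> exists N, forall i j, (i >= N)%nat -> (j >= N)%nat ->
     norm (vsub (s i) (s j)) < eps) -> exists l, seq_cv s l.
Proof.
  intros H. apply components_cv. intros c. pose proof (norm_ge0 c).
  destruct (R_complete (fun j => inner (s j) c)) as [l Hl]; [|now exists l].
  intros eps He. destruct (H (eps / (1 + norm c))) as [N HN]; [apply Rdiv_lt_0_compat; lra|].
  exists N. intros i j Hi Hj. specialize (HN i j Hi Hj). unfold Rdist.
  replace (inner (s i) c - inner (s j) c) with (inner (vsub (s i) (s j)) c) by (inn; ring).
  eapply Rle_lt_trans; [apply cauchy_schwarz_abs|]. pose proof (norm_ge0 (vsub (s i) (s j))).
  replace eps with (eps / (1 + norm c) * (1 + norm c)) by (field; lra). nra.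
Qed.
End Sequences.

Lemma inv_S_pos j : 0 < / (INR j + 1).
Proof. apply Rinv_0_lt_compat. pose proof (pos_INR j). lra. Qed.

Lemma inv_S_cv : Un_cv (fun j => / (INR j + 1)) 0.
Proof.
  intros eps He. destruct (archimed_cor1 eps He) as [N [HN HN0]]. exists N. intros j Hj.
  unfold Rdist. rewrite Rminus_0_r, Rabs_pos_eq by (apply Rlt_le, inv_S_pos).
  eapply Rle_lt_trans; [|exact HN]. apply Rinv_le_contravar; [now apply lt_0_INR|].
  apply le_INR in Hj. lra.
Qed.

(* A subsequence is given by indices phi j >= j; it need not be increasing. *)
Lemma real_BW (u : nat -> R) M : (forall j, Rabs (u j) <= M) ->
  exists phi l, (forall j : nat, (phi j >= j)%nat) /\ Un_cv (fun j => u (phi j)) l.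
Proof.
  intros HM.
  destruct (Bolzano_Weierstrass u (fun x => - M <= x <= M)) as [l Hl].
  - apply compact_P3.
  - intros j. specialize (HM j). apply Rabs_le_inv in HM. lra.
  - assert (Hex : forall j : nat, exists p, (p >= j)%nat /\ Rabs (u p - l) < / (INR j + 1)).
    { intros j. destruct (Hl (fun x => Rabs (x - l) < / (INR j + 1)) j) as [p [Hp Hu]].
      - exists (mkposreal _ (inv_S_pos j)). intros x Hx. exact Hx.
      - exists p. split; [lia|exact Hu]. }
    exists (fun j => proj1_sig (constructive_indefinite_description _ (Hex j))), l.
    split.
    + intros j. destruct (constructive_indefinite_description _ (Hex j)) as [p [Hp Hu]]. exact Hp.
    + intros eps He. destruct (inv_S_cv eps He) as [N HN]. exists N. intros j Hj.
      destruct (constructive_indefinite_description _ (Hex j)) as [p [Hp Hu]]. simpl.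
      specialize (HN j Hj). unfold Rdist in *.
      rewrite Rminus_0_r, Rabs_pos_eq in HN by (apply Rlt_le, inv_S_pos). lra.
Qed.

(** * Compactness, minimization and separation *)

Section Compactness.
Context {V : Type} {EV : Euc V} {HV : EucSpace V}.

(** The sequence is refined once per element of the spanning list, using compactness of the line for
    each coefficient. *)
Lemma bounded_subseq (s : nat -> V) M : (forall j, norm (s j) <= M) ->
  exists phi l, (forall j : nat, (phi j >= j)%nat) /\ seq_cv (fun j => s (phi j)) l.
Proof.
  intros HM. destruct (fin_basis (V := V)) as [b Hb].
  assert (H : forall b : list V, exists phi l, (forall j : nat, (phi j >= j)%nat) /\
             seq_cv (fun j => lincomb (s (phi j)) b) l).
  { clear b Hb. induction b as [|e b (phi & l & Hp & Hl)].
    - exists (fun j => j), vzero. split; [lia|]. exact (seq_cv_const vzero).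
    - destruct (real_BW (fun j => inner (s (phi j)) e) (M * norm e)) as (psi & c & Hq & Hc).
      + intros j. eapply Rle_trans; [apply cauchy_schwarz_abs|].
        apply Rmult_le_compat_r; [apply norm_ge0|apply HM].
      + exists (fun j => phi (psi j)), (vadd (vscal c e) l). split.
        * intros j. specialize (Hp (psi j)). specialize (Hq j). lia.
        * apply (seq_cv_add (fun j => vscal (inner (s (phi (psi j))) e) e)
                            (fun j => lincomb (s (phi (psi j))) b)).
          -- now apply seq_cv_scal.
          -- now apply (seq_cv_sub (fun j => lincomb (s (phi j)) b)). }
  destruct (H b) as (phi & l & Hp & Hl). exists phi, l. split; [exact Hp|].
  intros eps He. destruct (Hl eps He) as [N HN].
  exists N. intros j Hj. rewrite (Hb (s (phi j))). now apply HN.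
Qed.

Lemma minimum_attained (A : V -> Prop) (F : V -> R) M m :
  is_closed A -> (exists a, A a) -> (forall a, A a -> norm a <= M) -> (forall a, A a -> m <= F a) ->
  (forall s l, seq_cv s l -> Un_cv (fun j => F (s j)) (F l)) ->
  exists a, A a /\ forall b, A b -> F a <= F b.
Proof.
  intros Hcl [a0 Ha0] HM Hm HF.
  (* Completeness provides suprema, so it is applied to the values of -F; the infimum of F is -i. *)
  destruct (completeness (fun r => exists a, A a /\ r = - F a)) as [i [Hub Hlub]].
  { exists (- m). intros r (a & Ha & ->). specialize (Hm a Ha). lra. }
  { now exists (- F a0), a0. }
  assert (Hex : forall j : nat, exists a, A a /\ F a < - i + / (INR j + 1)).
  { intros j. apply NNPP. intros Hn. pose proof (inv_S_pos j).
    assert (i <= i - / (INR j + 1)); [|lra]. apply Hlub. intros r (a & Ha & ->).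
    apply Rnot_lt_le. intros Hlt. apply Hn. exists a. split; [exact Ha|]. lra. }
  pose (s := fun j => proj1_sig (constructive_indefinite_description _ (Hex j))).
  assert (Hs : forall j, A (s j) /\ F (s j) < - i + / (INR j + 1)).
  { intros j. unfold s. now destruct (constructive_indefinite_description _ (Hex j)). }
  destruct (bounded_subseq s M) as (phi & l & Hp & Hl); [intros j; apply HM, Hs|].
  exists l. assert (HlA : A l) by (apply (Hcl (fun j => s (phi j))); [intros; apply Hs|exact Hl]).
  split; [exact HlA|]. intros b Hb. apply Rle_trans with (- i).
  - apply Rnot_lt_le. intros Hc.
    destruct (HF _ _ Hl ((F l + i) / 2)) as [N1 H1]; [lra|].
    destruct (inv_S_cv ((F l + i) / 2)) as [N2 H2]; [lra|].
    specialize (H1 (max N1 N2) ltac:(lia)).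
    specialize (H2 (phi (max N1 N2)) ltac:(specialize (Hp (max N1 N2)); lia)).
    unfold Rdist in *. apply Rabs_def2 in H1. apply Rabs_def2 in H2.
    destruct (Hs (phi (max N1 N2))). lra.
  - pose proof (Hub (- F b) ltac:(now exists b)). lra.
Qed.

Lemma norm_sq_cv (s : nat -> V) l (c : V) : seq_cv s l ->
  Un_cv (fun j => inner (vsub (s j) c) (vsub (s j) c)) (inner (vsub l c) (vsub l c)).
Proof.
  intros H eps He. pose proof (norm_ge0 (vsub l c)) as Hn.
  set (d := Rmin 1 (eps / (2 + 2 * norm (vsub l c)))).
  assert (Hd0 : 0 < eps / (2 + 2 * norm (vsub l c))) by (apply Rdiv_lt_0_compat; lra).
  assert (Hd : 0 < d) by (unfold d; apply Rmin_glb_lt; lra).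
  destruct (H d Hd) as [N HN]. exists N. intros j Hj. specialize (HN j Hj).
  pose proof (Rmin_l 1 (eps / (2 + 2 * norm (vsub l c)))) as Hd1.
  pose proof (Rmin_r 1 (eps / (2 + 2 * norm (vsub l c)))) as Hd2. fold d in Hd1, Hd2.
  unfold Rdist. replace (inner (vsub (s j) c) (vsub (s j) c) - inner (vsub l c) (vsub l c))
   with (inner (vsub (s j) l) (vsub (s j) l) + 2 * inner (vsub (s j) l) (vsub l c)).
  - rewrite <- norm_sq. pose proof (cauchy_schwarz_abs (vsub (s j) l) (vsub l c)) as Hc.
    pose proof (norm_ge0 (vsub (s j) l)).
    assert (eps = (eps / (2 + 2 * norm (vsub l c))) * (2 + 2 * norm (vsub l c))) by (field; lra).
    set (e' := eps / (2 + 2 * norm (vsub l c))) in *.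
    apply Rabs_le_inv in Hc. apply Rabs_def1; nra.
  - inn. rewrite (inner_sym l (s j)), (inner_sym c (s j)), (inner_sym c l). ring.
Qed.

(** Truncating A at the distance from y to one of its points makes it bounded, so the squared
    distance attains its minimum. *)
Lemma closest_point (A : V -> Prop) (y : V) : is_closed A -> (exists a, A a) ->
  exists a, A a /\ forall b, A b -> norm (vsub a y) <= norm (vsub b y).
Proof.
  intros Hcl [a0 Ha0].
  destruct (minimum_attained (fun a => A a /\ norm (vsub a y) <= norm (vsub a0 y))
    (fun a => inner (vsub a y) (vsub a y)) (norm y + norm (vsub a0 y)) 0) as (a & [Ha Ha1] & Hmin).
  - intros s l Hs Hl. split; [apply (Hcl s); [apply Hs|exact Hl]|].
    apply (seq_cv_le s); [exact Hl|apply Hs].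
  - exists a0. split; [exact Ha0|lra].
  - intros a [_ Ha]. pose proof (norm_sub_lower a y). lra.
  - intros a _. apply inner_pos.
  - intros s l Hl. now apply norm_sq_cv.
  - exists a. split; [exact Ha|]. intros b Hb.
    destruct (Rle_lt_dec (norm (vsub b y)) (norm (vsub a0 y))) as [H|H]; [|lra].
    apply norm_le_sq; [apply norm_ge0|]. rewrite norm_sq. now apply Hmin.
Qed.

Definition closure (A : V -> Prop) (x : V) : Prop :=
  forall eps, eps > 0 -> exists a, A a /\ norm (vsub x a) < eps.

Lemma closure_closed (A : V -> Prop) : is_closed (closure A).
Proof.
  intros s l Hs Hl eps He. destruct (Hl (eps/2)) as [N HN]; [lra|].
  destruct (Hs N (eps/2)) as [a [Ha Hn]]; [lra|]. exists a. split; [exact Ha|].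
  specialize (HN N (le_n N)). rewrite norm_subC in HN. pose proof (norm_tri (s N) l a). lra.
Qed.

(** The residual of the projection of s onto the closure of A is the separating vector. A need not
    be closed; this matters because the cone separated in [linear_duality] may fail to be. *)
Lemma cone_separation (A : V -> Prop) (s : V) :
  A vzero -> (forall t a, 0 <= t -> A a -> A (vscal t a)) ->
  (forall a b, A a -> A b -> A (vadd a b)) -> ~ closure A s ->
  exists y, (forall a, A a -> inner y a <= 0) /\ inner y s > 0.
Proof.
  intros H0 Hs Ha Hn.
  destruct (closest_point (closure A) s) as (w & Hw & Hmin).
  - apply closure_closed.
  - exists vzero. intros eps He. exists vzero. rewrite vsub_self, norm_zero. now split.
  - set (y := vsub s w).
    assert (Hcadd : forall b, A b -> closure A (vadd w b)).
    { intros b Hb eps He. destruct (Hw eps He) as [a [Haa Hna]]. exists (vadd a b).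
      split; [now apply Ha|]. now replace (vsub (vadd w b) (vadd a b)) with (vsub w a) by veq. }
    assert (Hcs : forall t, 0 <= t <= 1 -> closure A (vscal t w)).
    { intros t Ht eps He. destruct (Hw eps He) as [a [Haa Hna]]. exists (vscal t a).
      split; [apply Hs; tauto|].
      replace (vsub (vscal t w) (vscal t a)) with (vscal t (vsub w a)) by veq.
      rewrite norm_scal, Rabs_pos_eq by lra. pose proof (norm_ge0 (vsub w a)). nra. }
    assert (Hkey : forall c, closure A c -> inner y y <= inner (vsub s c) (vsub s c)).
    { intros c Hc. specialize (Hmin c Hc). rewrite !(norm_subC _ s) in Hmin. fold y in Hmin.
      rewrite <- !norm_sq. pose proof (norm_ge0 y). nra. }
    (* A direction in which the projection w may move inside the closure cannot make an acute angle
       with the residual. This is used for d in A, and for d = -w, which gives <y, w> >= 0. *)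
    assert (Hle : forall d, (exists c0, 0 < c0 /\ forall t, 0 < t <= c0 ->
       closure A (vadd w (vscal t d))) -> inner y d <= 0).
    { intros d (c0 & Hc0 & Hd). apply Rnot_lt_le. intros Hpos. pose proof (inner_pos d) as Hdd.
      set (t := Rmin c0 (inner y d / (1 + inner d d))).
      assert (Hq : 0 < inner y d / (1 + inner d d)) by (apply Rdiv_lt_0_compat; lra).
      assert (Ht : 0 < t <= c0) by (split; [now apply Rmin_glb_lt|apply Rmin_l]).
      pose proof (Rmin_r c0 (inner y d / (1 + inner d d))) as Ht2. fold t in Ht2.
      pose proof (Hkey _ (Hd t Ht)) as Hk.
      replace (vsub s (vadd w (vscal t d))) with (vsub y (vscal t d)) in Hk by (unfold y; veq).
      revert Hk. unfold vsub. rewrite !inner_addl, !inner_addr. inn.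
      rewrite (inner_sym d y). intros Hk.
      assert (t * inner d d <= inner y d).
      { apply Rle_trans with (inner y d / (1 + inner d d) * inner d d); [nra|].
        assert (inner y d / (1 + inner d d) * (1 + inner d d) = inner y d) by (field; lra). nra. }
      nra. }
    exists y. split.
    + intros a Haa. apply Hle. exists 1. split; [lra|]. intros t Ht. apply Hcadd, Hs; [lra|exact Haa].
    + assert (Hyw : inner y (vscal (-1) w) <= 0).
      { apply Hle. exists 1. split; [lra|]. intros t Ht.
        replace (vadd w (vscal t (vscal (-1) w))) with (vscal (1 - t) w) by veq. apply Hcs. lra. }
      rewrite inner_scalr in Hyw.
      assert (Hys : inner y s = inner y y + inner y w) by (unfold y at 3; inn; ring).
      assert (0 < inner y y).
      { destruct (Rle_lt_dec (inner y y) 0) as [Hz|]; [exfalso|assumption].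
        apply Hn. pose proof (inner_pos y).
        assert (Hy : y = vzero) by (apply inner_def; lra).
        replace s with w; [exact Hw|].
        replace w with (vsub s y) by (unfold y; veq). rewrite Hy. veq. }
      lra.
Qed.
End Compactness.

(** * Differential calculus *)

Section LinearMaps.
Context {V W : Type} {EV : Euc V} {EW : Euc W} {HV : EucSpace V} {HW : EucSpace W}.

Definition is_bilinear (B : V -> V -> W) : Prop :=
  (forall u, is_linear (B u)) /\
  forall a b u1 u2 w,
    B (vadd (vscal a u1) (vscal b u2)) w = vadd (vscal a (B u1 w)) (vscal b (B u2 w)).

Lemma lin_add (L : V -> W) x y : is_linear L -> L (vadd x y) = vadd (L x) (L y).
Proof.
  intros H. specialize (H 1 1 x y).
  replace (vadd (vscal 1 x) (vscal 1 y)) with (vadd x y) in H by veq. rewrite H. veq.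
Qed.
Lemma lin_scal (L : V -> W) t x : is_linear L -> L (vscal t x) = vscal t (L x).
Proof.
  intros H. specialize (H t 0 x x).
  replace (vadd (vscal t x) (vscal 0 x)) with (vscal t x) in H by veq. rewrite H. veq.
Qed.
Lemma lin_sub (L : V -> W) x y : is_linear L -> L (vsub x y) = vsub (L x) (L y).
Proof. intros H. unfold vsub. now rewrite lin_add, lin_scal. Qed.
Lemma lin_zero (L : V -> W) : is_linear L -> L vzero = vzero.
Proof.
  intros H. replace vzero with (vscal 0 (vzero : V)) at 1 by veq.
  rewrite lin_scal by assumption. veq.
Qed.

Lemma bilin_r (B : V -> V -> W) u : is_bilinear B -> is_linear (B u).
Proof. intros [H _]. apply H. Qed.
Lemma bilin_l (B : V -> V -> W) w : is_bilinear B -> is_linear (fun u => B u w).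
Proof. intros [_ H] a b x y. apply H. Qed.

Lemma lin_bound (L : V -> W) : is_linear L ->
  exists c, 0 <= c /\ forall x, norm (L x) <= c * norm x.
Proof.
  intros HL. destruct (fin_basis (V := V)) as [b Hb].
  assert (H : forall b : list V, exists c, 0 <= c /\
            forall x, norm (L (lincomb x b)) <= c * norm x).
  { clear b Hb. induction b as [|e b (c & Hc & H)].
    - exists 0. split; [lra|]. intros x. rewrite lincomb_nil, lin_zero, norm_zero by assumption. lra.
    - pose proof (norm_ge0 e). pose proof (norm_ge0 (L e)).
      exists (norm e * norm (L e) + c). split; [nra|]. intros x.
      rewrite lincomb_cons, lin_add, lin_scal by assumption.
      eapply Rle_trans; [apply norm_add|]. rewrite norm_scal.
      pose proof (cauchy_schwarz_abs x e). specialize (H x). nra. }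
  destruct (H b) as (c & Hc & Hx). exists c. split; [exact Hc|]. intros x.
  rewrite (Hb x) at 1. apply Hx.
Qed.

Lemma bilin_bound (B : V -> V -> W) : is_bilinear B ->
  exists c, 0 <= c /\ forall x y, norm (B x y) <= c * norm x * norm y.
Proof.
  intros HB. destruct (fin_basis (V := V)) as [b Hb].
  assert (H : forall b : list V, exists c, 0 <= c /\
            forall x y, norm (B (lincomb x b) y) <= c * norm x * norm y).
  { clear b Hb. induction b as [|e b (c & Hc & H)].
    - exists 0. split; [lra|]. intros x y.
      rewrite lincomb_nil, (lin_zero (fun u => B u y)), norm_zero by now apply bilin_l. lra.
    - destruct (lin_bound (B e)) as (c' & Hc' & H'); [now apply bilin_r|].
      pose proof (norm_ge0 e).
      exists (norm e * c' + c). split; [nra|]. intros x y.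
      rewrite lincomb_cons, (lin_add (fun u => B u y)), (lin_scal (fun u => B u y))
        by now apply bilin_l.
      eapply Rle_trans; [apply norm_add|]. rewrite norm_scal.
      pose proof (cauchy_schwarz_abs x e). specialize (H x y). specialize (H' y).
      assert (Rabs (inner x e) * norm (B e y) <= norm x * norm e * (c' * norm y)).
      { apply Rmult_le_compat; try assumption; [apply Rabs_pos|apply norm_ge0]. }
      lra. }
  destruct (H b) as (c & Hc & Hx). exists c. split; [exact Hc|]. intros x y.
  rewrite (Hb x) at 1. apply Hx.
Qed.

(** Preimages of the spanning vectors of W are chosen and extended linearly. *)
Lemma right_inverse (L : V -> W) : is_linear L -> surjective L ->
  exists M : W -> V, is_linear M /\ forall w, L (M w) = w.
Proof.
  intros HL Hs. destruct (fin_basis (V := W)) as [b Hb].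
  assert (H : forall b : list W, exists M : W -> V, is_linear M /\ forall w, L (M w) = lincomb w b).
  { clear b Hb. induction b as [|e b (M & HM & H)].
    - exists (fun _ => vzero). split; [intros a b x y; veq|]. intros w. now apply lin_zero.
    - destruct (Hs e) as [v Hv]. exists (fun w => vadd (vscal (inner w e) v) (M w)). split.
      + intros a c x y. rewrite HM. inn. veq.
      + intros w. rewrite lin_add, lin_scal, lincomb_cons, Hv, H by assumption. reflexivity. }
  destruct (H b) as (M & HM & Hw). exists M. split; [exact HM|]. intros w.
  rewrite (Hb w) at 2. apply Hw.
Qed.
End LinearMaps.

(** * Mean value inequality, strict differentiability and local surjectivity *)

Section Calculus.
Context {V W : Type} {EV : Euc V} {EW : Euc W} {HV : EucSpace V} {HW : EucSpace W}.

(** The derivative is tested against each fixed vector, so that the scalar rules and the scalar mean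
    value theorem apply directly. *)
Definition dcurve (c : R -> W) (d : W) (s : R) : Prop :=
  forall y, derivable_pt_lim (fun s => inner (c s) y) s (inner d y).

Lemma dcurve_sub c1 c2 d1 d2 s :
  dcurve c1 d1 s -> dcurve c2 d2 s -> dcurve (fun s => vsub (c1 s) (c2 s)) (vsub d1 d2) s.
Proof.
  intros H1 H2 y.
  replace (inner (vsub d1 d2) y) with (inner d1 y - inner d2 y) by (inn; ring).
  apply (derivable_pt_lim_ext (fun s => inner (c1 s) y - inner (c2 s) y)).
  - intros. inn. ring.
  - apply (derivable_pt_lim_minus (fun s => inner (c1 s) y) (fun s => inner (c2 s) y)); auto.
Qed.

Lemma dcurve_scal p p' (v : W) s :
  derivable_pt_lim p s p' -> dcurve (fun s => vscal (p s) v) (vscal p' v) s.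
Proof.
  intros H y. rewrite inner_scall, Rmult_comm.
  apply (derivable_pt_lim_ext (fun s => inner v y * p s)).
  - intros. inn. ring.
  - now apply (derivable_pt_lim_scal p).
Qed.

Lemma dcurve_frechet (f : V -> W) L x d s :
  frechet f L (vadd x (vscal s d)) -> dcurve (fun s => f (vadd x (vscal s d))) (L d) s.
Proof.
  intros [HL H] y eps He. pose proof (norm_ge0 d) as Hd. pose proof (norm_ge0 y) as Hy.
  set (K := (1 + norm d) * (1 + norm y)).
  assert (HK : 0 < K) by (unfold K; nra).
  destruct (H (eps / (2 * K))) as (del & Hdel & Hf); [apply Rdiv_lt_0_compat; lra|].
  assert (Hp : 0 < del / (1 + norm d)) by (apply Rdiv_lt_0_compat; lra).
  exists (mkposreal _ Hp). intros t Ht0 Ht. cbn in Ht.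
  assert (Hn : norm (vscal t d) < del).
  { rewrite norm_scal. pose proof (Rabs_pos t).
    replace del with (del / (1 + norm d) * (1 + norm d)) by (field; lra). nra. }
  specialize (Hf _ Hn).
  set (r := vsub (vsub (f (vadd (vadd x (vscal s d)) (vscal t d))) (f (vadd x (vscal s d))))
             (L (vscal t d))) in Hf.
  replace (vadd x (vscal (s + t) d)) with (vadd (vadd x (vscal s d)) (vscal t d)) by veq.
  replace ((inner (f (vadd (vadd x (vscal s d)) (vscal t d))) y - inner (f (vadd x (vscal s d))) y) / t
    - inner (L d) y) with (inner r y / t).
  2:{ unfold r. rewrite (lin_scal L) by assumption. inn. now field. }
  unfold Rdiv at 1. rewrite Rabs_mult, Rabs_inv. pose proof (Rabs_pos_lt t Ht0) as Hta.
  pose proof (cauchy_schwarz_abs r y) as Hc. rewrite norm_scal in Hf.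
  apply Rle_lt_trans with ((eps / (2 * K) * (Rabs t * norm d) * norm y) * / Rabs t).
  - apply Rmult_le_compat_r; [apply Rlt_le, Rinv_0_lt_compat; lra|].
    eapply Rle_trans; [exact Hc|]. now apply Rmult_le_compat_r.
  - replace (eps / (2 * K) * (Rabs t * norm d) * norm y * / Rabs t)
      with (eps * (norm d * norm y / (2 * K))) by (field; lra).
    assert (norm d * norm y / (2 * K) < 1); [|nra].
    apply (Rmult_lt_reg_r (2 * K)); [lra|]. unfold Rdiv. rewrite Rmult_assoc, Rinv_l by lra.
    unfold K. nra.
Qed.

(** Pairing the curve with its own total increment y, the scalar theorem gives |y|^2 = <c'(s), y>,
    and Cauchy-Schwarz removes one factor |y|. *)
Lemma mean_value (c c' : R -> W) m :
  (forall s, 0 <= s <= 1 -> dcurve c (c' s) s) ->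
  (forall s, 0 <= s <= 1 -> norm (c' s) <= m) -> norm (vsub (c 1) (c 0)) <= m.
Proof.
  intros Hd Hm. set (y := vsub (c 1) (c 0)).
  destruct (MVT_cor2 (fun s => inner (c s) y) (fun s => inner (c' s) y) 0 1) as (s & Hs & Hs1).
  - lra.
  - intros s Hs. now apply Hd.
  - assert (Hy : norm y * norm y = inner (c' s) y) by (rewrite norm_sq; unfold y at 1; revert Hs; inn; lra).
    pose proof (cauchy_schwarz (c' s) y). specialize (Hm s ltac:(lra)). pose proof (norm_ge0 y).
    destruct (Rle_lt_dec (norm y) 0) as [|Hpos]; [pose proof (norm_ge0 (c' s)); lra|].
    assert (norm y * norm y <= m * norm y) by (pose proof (norm_ge0 y); nra).
    nra.
Qed.

(** Both points vary, unlike in [frechet]; this is what controls successive Newton iterates and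
    yields local Lipschitz bounds. *)
Definition strict_diff (f : V -> W) (L : V -> W) (x : V) : Prop :=
  is_linear L /\ forall eps, eps > 0 -> exists del, del > 0 /\
    forall y z, norm (vsub y x) < del -> norm (vsub z x) < del ->
      norm (vsub (vsub (f z) (f y)) (L (vsub z y))) <= eps * norm (vsub z y).

Lemma ball_convex (x y z : V) r s :
  norm (vsub y x) < r -> norm (vsub z x) < r -> 0 <= s <= 1 ->
  norm (vsub (vadd y (vscal s (vsub z y))) x) < r.
Proof.
  intros Hy Hz Hs.
  replace (vsub (vadd y (vscal s (vsub z y))) x)
    with (vadd (vscal (1 - s) (vsub y x)) (vscal s (vsub z x))) by veq.
  eapply Rle_lt_trans; [apply norm_add|]. rewrite !norm_scal, !Rabs_pos_eq by lra.
  destruct (Req_dec s 0) as [->|]; [lra|]. nra.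
Qed.

(** The mean value inequality is applied, along the segment from y to z, to f minus its linear part
    at x, whose derivative is small by continuity of Df at x. *)
Lemma strict_diff_C1 (f : V -> W) (Df : V -> V -> W) x r : r > 0 ->
  (forall y, ball x r y -> frechet f (Df y) y) -> op_cont1 Df x -> strict_diff f (Df x) x.
Proof.
  intros Hr Hf Hc.
  assert (HL : forall y, ball x r y -> is_linear (Df y)) by (intros y Hy; apply (Hf y Hy)).
  assert (Hx : ball x r x) by (unfold ball; rewrite vsub_self, norm_zero; lra).
  split; [now apply HL|]. intros eps He. destruct (Hc eps He) as (del & Hdel & Hd).
  exists (Rmin r del). split; [apply Rmin_glb_lt; lra|]. intros y z Hy Hz.
  pose proof (Rmin_l r del). pose proof (Rmin_r r del).
  set (d := vsub z y).
  pose proof (mean_value (fun s => vsub (f (vadd y (vscal s d))) (vscal s (Df x d)))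
     (fun s => vsub (Df (vadd y (vscal s d)) d) (vscal 1 (Df x d))) (eps * norm d)) as Hm.
  cbv beta in Hm.
  replace (vsub (vsub (f z) (f y)) (Df x d)) with
    (vsub (vsub (f (vadd y (vscal 1 d))) (vscal 1 (Df x d))) (vsub (f (vadd y (vscal 0 d))) (vscal 0 (Df x d)))).
  - apply Hm; intros s Hs;
      assert (Hb : norm (vsub (vadd y (vscal s d)) x) < Rmin r del) by now apply ball_convex.
    + apply dcurve_sub.
      * apply dcurve_frechet, Hf. unfold ball. lra.
      * apply (dcurve_scal (fun s => s)), derivable_pt_lim_id.
    + replace (vscal 1 (Df x d)) with (Df x d) by veq. apply Hd. lra.
  - replace (vadd y (vscal 1 d)) with z by (unfold d; veq).
    replace (vadd y (vscal 0 d)) with y by (unfold d; veq). veq.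
Qed.

(** Local surjectivity with a linear estimate, in the manner of Lyusternik and Graves: Newton
    iteration with a fixed right inverse M of L. As |M| <= c and the strict differentiability
    constant is 1 / (2 c), the residual halves at each step and the steps sum to at most 2 c |f a -
    w|. *)
Lemma strict_diff_inv (f : V -> W) L x :
  strict_diff f L x -> surjective L ->
  exists c r, 0 < c /\ 0 < r /\ forall a w, norm (vsub a x) < r -> norm (vsub (f a) w) < r ->
     exists b, f b = w /\ norm (vsub b a) <= c * norm (vsub (f a) w).
Proof.
  intros [HL Hst] Hsurj. destruct (right_inverse L HL Hsurj) as (M & HM & HLM).
  destruct (lin_bound M HM) as (c0 & Hc0 & Hc). set (c := c0 + 1).
  assert (HcM : forall w, norm (M w) <= c * norm w).
  { intros w. specialize (Hc w). pose proof (norm_ge0 w). unfold c. nra. }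
  assert (Hcpos : 0 < c) by (unfold c; lra).
  destruct (Hst (/ (2 * c))) as (r & Hr & Hf); [apply Rinv_0_lt_compat; lra|].
  (* Iterates stay within 2 c d of a; since d and |a - x| are below r / (4 c + 2), they remain
     within r / 2 of x. *)
  assert (Hr' : 0 < r / (4 * c + 2)) by (apply Rdiv_lt_0_compat; lra).
  exists (2 * c), (r / (4 * c + 2)). split; [lra|split; [exact Hr'|]].
  intros a w Ha Hw. set (d := norm (vsub (f a) w)) in *.
  assert (Hd0 : 0 <= d) by apply norm_ge0.
  assert (Hrr : r = (r / (4 * c + 2)) * (4 * c + 2)) by (field; lra).
  set (r' := r / (4 * c + 2)) in *.
  assert (Hin : forall y, norm (vsub y a) <= 2 * c * d -> norm (vsub y x) < r).
  { intros y Hy. pose proof (norm_tri a y x). nra. }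
  pose (step := fun y => vsub y (M (vsub (f y) w))).
  pose (s := fun j => Nat.iter j step a).
  assert (Hs : forall j, norm (vsub (f (s j)) w) <= (/2)^j * d /\
                         norm (vsub (s j) a) <= 2 * c * d * (1 - (/2)^j)).
  { assert (Hp : forall j, 0 < (/2)^j) by (intros j; apply pow_lt; lra).
    induction j as [|j [IH1 IH2]].
    - cbn. rewrite vsub_self, norm_zero. fold d. lra.
    - change (s (S j)) with (step (s j)). cbn [pow]. specialize (Hp j).
      assert (Hstep : norm (vsub (step (s j)) (s j)) <= c * ((/2)^j * d)).
      { unfold step. replace (vsub (vsub (s j) (M (vsub (f (s j)) w))) (s j))
          with (vscal (-1) (M (vsub (f (s j)) w))) by veq.
        rewrite norm_opp. eapply Rle_trans; [apply HcM|]. apply Rmult_le_compat_l; lra. }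
      assert (H2 : norm (vsub (step (s j)) a) <= 2 * c * d * (1 - /2 * (/2)^j)).
      { pose proof (norm_tri (s j) (step (s j)) a). lra. }
      split; [|exact H2].
      assert (Hcd : 0 <= c * d) by nra.
      assert (H3 : norm (vsub (s j) a) <= 2 * c * d) by nra.
      assert (H4 : norm (vsub (step (s j)) a) <= 2 * c * d) by nra.
      pose proof (Hf (s j) (step (s j)) (Hin _ H3) (Hin _ H4)) as Hff.
      replace (vsub (f (step (s j))) w) with
        (vsub (vsub (f (step (s j))) (f (s j))) (L (vsub (step (s j)) (s j)))).
      + eapply Rle_trans; [exact Hff|].
        apply Rle_trans with (/ (2 * c) * (c * ((/2)^j * d))).
        * apply Rmult_le_compat_l; [apply Rlt_le, Rinv_0_lt_compat; lra|exact Hstep].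
        * right. field. lra.
      + replace (vsub (step (s j)) (s j)) with (vscal (-1) (M (vsub (f (s j)) w)))
          by (unfold step; veq).
        rewrite (lin_scal L), HLM by assumption. veq. }
  assert (Hinc : forall j m, norm (vsub (s (j + m)%nat) (s j)) <= 2 * c * d * ((/2)^j - (/2)^(j + m))).
  { intros j. induction m as [|m IH].
    - rewrite Nat.add_0_r, vsub_self, norm_zero. lra.
    - replace (j + S m)%nat with (S (j + m)) by lia.
      change (s (S (j + m))) with (step (s (j + m)%nat)). cbn [pow].
      destruct (Hs (j + m)%nat) as [H1 _].
      assert (Hstep : norm (vsub (step (s (j + m)%nat)) (s (j + m)%nat)) <= c * ((/2)^(j+m) * d)).
      { unfold step. replace (vsub (vsub (s (j+m)%nat) (M (vsub (f (s (j+m)%nat)) w))) (s (j+m)%nat))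
          with (vscal (-1) (M (vsub (f (s (j+m)%nat)) w))) by veq.
        rewrite norm_opp. eapply Rle_trans; [apply HcM|]. apply Rmult_le_compat_l; lra. }
      pose proof (norm_tri (s (j + m)%nat) (step (s (j + m)%nat)) (s j)). lra. }
  assert (Hpow : forall eps, eps > 0 -> exists N, forall j, (j >= N)%nat -> (/2)^j * (1 + 2 * c * d + d) < eps).
  { intros eps He. assert (0 < 1 + 2 * c * d + d) by nra.
    destruct (pow_lt_1_zero (/2) ltac:(rewrite Rabs_pos_eq; lra) (eps / (1 + 2 * c * d + d)))
      as [N HN]; [apply Rdiv_lt_0_compat; lra|].
    exists N. intros j Hj. specialize (HN j Hj). rewrite Rabs_pos_eq in HN by (apply pow_le; lra).
    replace eps with (eps / (1 + 2 * c * d + d) * (1 + 2 * c * d + d)) by (field; lra). nra. }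
  assert (Hpp : forall j, 0 < (/2)^j) by (intros j; apply pow_lt; lra).
  destruct (cauchy_cv s) as [b Hb].
  { intros eps He. destruct (Hpow (eps / 2)) as [N HN]; [lra|]. exists N. intros i j Hi Hj.
    assert (Hk : forall i, (i >= N)%nat -> norm (vsub (s i) (s N)) < eps / 2).
    { intros i' Hi'. replace i' with (N + (i' - N))%nat by lia.
      eapply Rle_lt_trans; [apply Hinc|]. specialize (HN N (le_n N)).
      pose proof (Hpp N). pose proof (Hpp (N + (i' - N))%nat).
      assert (0 <= 2 * c * d) by nra.
      assert (0 <= 2 * c * d * (/2)^(N + (i' - N))) by (apply Rmult_le_pos; lra).
      assert (0 <= (/2)^N * d) by (apply Rmult_le_pos; lra). nra. }
    pose proof (norm_tri (s N) (s i) (s j)). pose proof (Hk i Hi). pose proof (Hk j Hj).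
    rewrite (norm_subC (s N)) in *. lra. }
  assert (Hba : norm (vsub b a) <= 2 * c * d).
  { apply (seq_cv_le s); [exact Hb|]. intros j. destruct (Hs j) as [_ H]. pose proof (Hpp j).
    assert (0 <= 2 * c * d) by nra. nra. }
  exists b. split; [|exact Hba].
  destruct (lin_bound L HL) as (cL & HcL & HLb).
  (* The strict estimate makes f continuous at b, so the vanishing residual passes to the limit. *)
  assert (Hz : vsub (f b) w = vzero).
  { apply norm_small_eq0. intros eps He.
    set (K := / (2 * c) + cL + 1).
    assert (HK : 0 < K) by (unfold K; pose proof (Rinv_0_lt_compat (2 * c) ltac:(lra)); lra).
    destruct (Hb (eps / 2 / K)) as [N1 HN1]; [repeat apply Rdiv_lt_0_compat; lra|].
    destruct (Hpow (eps / 2)) as [N2 HN2]; [lra|]. set (j := max N1 N2).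
    specialize (HN1 j ltac:(lia)). specialize (HN2 j ltac:(lia)). destruct (Hs j) as [H1 H2].
    pose proof (Hpp j) as Hj. assert (H0 : 0 <= 2 * c * d) by nra.
    assert (Hsj : norm (vsub (s j) x) < r) by (apply Hin; nra).
    pose proof (Hf b (s j) (Hin b Hba) Hsj) as Hff.
    assert (Hfd : norm (vsub (f (s j)) (f b)) <= K * norm (vsub (s j) b)).
    { pose proof (norm_sub_lower (vsub (f (s j)) (f b)) (L (vsub (s j) b))).
      pose proof (HLb (vsub (s j) b)). pose proof (norm_ge0 (vsub (s j) b)). unfold K. lra. }
    pose proof (norm_tri (f (s j)) (f b) w) as Ht. rewrite (norm_subC (f b) (f (s j))) in Ht.
    assert (K * norm (vsub (s j) b) <= eps / 2).
    { replace (eps / 2) with (K * (eps / 2 / K)) by (field; lra).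
      apply Rmult_le_compat_l; lra. }
    assert ((/2)^j * d <= (/2)^j * (1 + 2 * c * d + d)) by (apply Rmult_le_compat_l; lra).
    lra. }
  replace w with (vsub (f b) (vsub (f b) w)) by veq. rewrite Hz. veq.
Qed.
End Calculus.

(** * Second-order expansions *)

Section SecondOrder.
Context {V W : Type} {EV : Euc V} {EW : Euc W} {HV : EucSpace V} {HW : EucSpace W}.

(** A pointwise expansion, chosen because it composes: h o g then needs no second derivative away
    from the reference point. *)
Definition taylor2 (f : V -> W) (L : V -> W) (B : V -> V -> W) (x : V) : Prop :=
  is_linear L /\ is_bilinear B /\
  forall eps, eps > 0 -> exists del, del > 0 /\ forall d, norm d < del ->
    norm (vsub (vsub (f (vadd x d)) (f x)) (vadd (L d) (vscal (1/2) (B d d))))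
      <= eps * (norm d * norm d).

Lemma frechet2_bilinear (F : V -> V -> W) B x : frechet2 F B x -> is_bilinear B.
Proof. intros (H1 & H2 & _). now split. Qed.

Lemma frechet2_op_cont (F : V -> V -> W) B x : frechet2 F B x -> op_cont1 F x.
Proof.
  intros HF. pose proof (frechet2_bilinear _ _ _ HF) as HB.
  destruct (bilin_bound B HB) as (b & Hb & HBb). destruct HF as (_ & _ & HF).
  intros eps He. destruct (HF 1) as (del & Hdel & Hd); [lra|].
  assert (Hq : 0 < eps / (1 + b)) by (apply Rdiv_lt_0_compat; lra).
  exists (Rmin del (eps / (1 + b))). split; [apply Rmin_glb_lt; lra|]. intros y Hy u.
  pose proof (Rmin_l del (eps / (1 + b))). pose proof (Rmin_r del (eps / (1 + b))).
  set (d := vsub y x) in *. specialize (Hd d ltac:(lra) u). specialize (HBb d u).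
  replace (vadd x d) with y in Hd by (unfold d; veq).
  pose proof (norm_sub_lower (vsub (F y u) (F x u)) (B d u)). pose proof (norm_ge0 u).
  pose proof (norm_ge0 d).
  assert (norm d * (1 + b) <= eps).
  { replace eps with (eps / (1 + b) * (1 + b)) by (field; lra). apply Rmult_le_compat_r; lra. }
  assert (norm d * (1 + b) * norm u <= eps * norm u) by (apply Rmult_le_compat_r; lra). lra.
Qed.

(** The mean value inequality is applied to the remainder along s -> x + s d; its derivative Df(x +
    s d) d - Df(x) d - s B d d is small by differentiability of Df at x. *)
Lemma taylor2_C2 (f : V -> W) (Df : V -> V -> W) (B : V -> V -> W) x r : r > 0 ->
  (forall y, ball x r y -> frechet f (Df y) y) -> frechet2 Df B x -> taylor2 f (Df x) B x.
Proof.
  intros Hr Hf HB. pose proof (frechet2_bilinear _ _ _ HB) as HBb.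
  assert (Hx : ball x r x) by (unfold ball; rewrite vsub_self, norm_zero; lra).
  split; [apply (Hf x Hx)|split; [exact HBb|]]. destruct HB as (_ & _ & HB).
  intros eps He. destruct (HB eps He) as (del & Hdel & Hd).
  exists (Rmin r del). split; [apply Rmin_glb_lt; lra|]. intros d Hnd.
  pose proof (Rmin_l r del). pose proof (Rmin_r r del).
  assert (Hsd : forall s, 0 <= s <= 1 -> norm (vscal s d) <= norm d).
  { intros s Hs. rewrite norm_scal, Rabs_pos_eq by lra. pose proof (norm_ge0 d). nra. }
  pose proof (mean_value
     (fun s => vsub (vsub (f (vadd x (vscal s d))) (vscal s (Df x d))) (vscal (1/2 * (s * s)) (B d d)))
     (fun s => vsub (vsub (Df (vadd x (vscal s d)) d) (vscal 1 (Df x d))) (vscal s (B d d)))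
     (eps * (norm d * norm d))) as Hm.
  cbv beta in Hm.
  replace (vsub (vsub (f (vadd x d)) (f x)) (vadd (Df x d) (vscal (1/2) (B d d)))) with
   (vsub (vsub (vsub (f (vadd x (vscal 1 d))) (vscal 1 (Df x d))) (vscal (1/2 * (1 * 1)) (B d d)))
         (vsub (vsub (f (vadd x (vscal 0 d))) (vscal 0 (Df x d))) (vscal (1/2 * (0 * 0)) (B d d)))).
  - apply Hm; intros s Hs; specialize (Hsd s Hs).
    + apply dcurve_sub; [apply dcurve_sub|].
      * apply dcurve_frechet, Hf. unfold ball.
        replace (vsub (vadd x (vscal s d)) x) with (vscal s d) by veq. lra.
      * apply (dcurve_scal (fun s => s)), derivable_pt_lim_id.
      * apply (dcurve_scal (fun s => 1/2 * (s * s))).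
        replace s with (1/2 * (1 * s + s * 1)) at 2 by field.
        apply (derivable_pt_lim_scal (fun s => s * s)).
        apply (derivable_pt_lim_mult (fun s => s) (fun s => s)); apply derivable_pt_lim_id.
    + assert (Hsdel : norm (vscal s d) < del) by lra.
      specialize (Hd _ Hsdel d).
      rewrite (lin_scal (fun u => B u d)) in Hd by now apply bilin_l.
      replace (vscal 1 (Df x d)) with (Df x d) by veq.
      eapply Rle_trans; [exact Hd|]. pose proof (norm_ge0 d).
      assert (norm (vscal s d) * norm d <= norm d * norm d) by (apply Rmult_le_compat_r; lra).
      nra.
  - replace (vadd x (vscal 1 d)) with (vadd x d) by veq.
    replace (vadd x (vscal 0 d)) with x by veq. veq.
Qed.

(* Compare both mixed second derivatives with the second difference of f over the
   parallelogram spanned by small multiples of a and b. *)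
Lemma second_derivative_sym (f : V -> W) (Df : V -> V -> W) (B : V -> V -> W) x r : r > 0 ->
  (forall y, ball x r y -> frechet f (Df y) y) -> frechet2 Df B x -> forall a b, B a b = B b a.
Proof.
  intros Hr Hf HB. pose proof (frechet2_bilinear _ _ _ HB) as HBb. destruct HB as (_ & _ & HB).
  assert (Hest : forall eps, eps > 0 -> exists del, del > 0 /\ forall a b, norm a + norm b < del ->
    norm (vsub (vsub (vsub (f (vadd (vadd x b) a)) (f (vadd x a))) (vsub (f (vadd x b)) (f x))) (B b a))
     <= 2 * eps * (norm a + norm b) * (norm a + norm b)).
  { intros eps He. destruct (HB eps He) as (del & Hdel & Hd).
    exists (Rmin r del). split; [apply Rmin_glb_lt; lra|]. intros a b Hab.
    pose proof (Rmin_l r del). pose proof (Rmin_r r del).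
    pose proof (norm_ge0 a) as Hna. pose proof (norm_ge0 b) as Hnb.
    assert (Hsd : forall s, 0 <= s <= 1 -> norm (vscal s a) <= norm a).
    { intros s Hs. rewrite norm_scal, Rabs_pos_eq by lra. nra. }
    pose proof (mean_value
     (fun s => vsub (vsub (f (vadd (vadd x b) (vscal s a))) (f (vadd x (vscal s a)))) (vscal s (B b a)))
     (fun s => vsub (vsub (Df (vadd (vadd x b) (vscal s a)) a) (Df (vadd x (vscal s a)) a)) (vscal 1 (B b a)))
     (2 * eps * (norm a + norm b) * (norm a + norm b))) as Hm.
    cbv beta in Hm.
    match goal with |- norm ?u <= _ =>
      match type of Hm with _ -> _ -> norm ?v <= _ => replace u with v end end.
    - apply Hm; intros s Hs; specialize (Hsd s Hs).
      + apply dcurve_sub; [apply dcurve_sub|].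
        * apply dcurve_frechet, Hf. unfold ball.
          replace (vsub (vadd (vadd x b) (vscal s a)) x) with (vadd b (vscal s a)) by veq.
          pose proof (norm_add b (vscal s a)). lra.
        * apply dcurve_frechet, Hf. unfold ball.
          replace (vsub (vadd x (vscal s a)) x) with (vscal s a) by veq. lra.
        * apply (dcurve_scal (fun s => s)), derivable_pt_lim_id.
      + pose proof (norm_add b (vscal s a)).
        assert (Hn1 : norm (vscal s a) < del) by lra.
        assert (Hn2 : norm (vadd b (vscal s a)) < del) by lra.
        pose proof (Hd _ Hn1 a) as E1. pose proof (Hd _ Hn2 a) as E2.
        rewrite (lin_add (fun u => B u a)) in E2 by now apply bilin_l.
        replace (vadd x (vadd b (vscal s a))) with (vadd (vadd x b) (vscal s a)) in E2 by veq.
        match type of E2 with norm ?u <= _ => match type of E1 with norm ?v <= _ =>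
          match goal with |- norm ?w <= _ => replace w with (vsub u v) by veq end end end.
        eapply Rle_trans; [apply norm_sub|].
        assert (Hk : forall q, 0 <= q <= norm a + norm b ->
          eps * q * norm a <= eps * (norm a + norm b) * (norm a + norm b)).
        { intros q Hq. apply Rmult_le_compat; nra. }
        pose proof (norm_ge0 (vscal s a)). pose proof (norm_ge0 (vadd b (vscal s a))).
        assert (Hq1 : 0 <= norm (vscal s a) <= norm a + norm b) by lra.
        assert (Hq2 : 0 <= norm (vadd b (vscal s a)) <= norm a + norm b) by lra.
        pose proof (Hk _ Hq1). pose proof (Hk _ Hq2).
        lra.
    - replace (vadd (vadd x b) (vscal 1 a)) with (vadd (vadd x b) a) by veq.
      replace (vadd (vadd x b) (vscal 0 a)) with (vadd x b) by veq.
      replace (vadd x (vscal 1 a)) with (vadd x a) by veq.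
      replace (vadd x (vscal 0 a)) with x by veq. veq. }
  intros a b. set (N := norm a + norm b).
  assert (HN : 0 <= N) by (pose proof (norm_ge0 a); pose proof (norm_ge0 b); unfold N; lra).
  cut (vsub (B a b) (B b a) = vzero).
  { intros Hz. replace (B a b) with (vadd (B b a) (vsub (B a b) (B b a))) by veq. rewrite Hz. veq. }
  apply norm_small_eq0. intros eps He.
  (* After scaling a and b by t, the two estimates together give t^2 |B a b - B b a| <= 4 e N^2
     t^2. *)
  set (e := eps / (4 * (1 + N * N))).
  assert (He' : e > 0) by (apply Rdiv_lt_0_compat; nra).
  destruct (Hest e He') as (del & Hdel & Hd).
  set (t := del / (2 * (1 + N))).
  assert (Ht : 0 < t) by (apply Rdiv_lt_0_compat; lra).
  assert (HtN : t * N < del).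
  { apply Rle_lt_trans with (del / 2); [|lra].
    replace (del / 2) with (t * (1 + N)) by (unfold t; field; lra). nra. }
  assert (Hn : forall c : V, norm (vscal t c) = t * norm c).
  { intros c. rewrite norm_scal, Rabs_pos_eq; lra. }
  assert (Hab : norm (vscal t a) + norm (vscal t b) < del) by (rewrite !Hn; unfold N in *; lra).
  assert (Hba : norm (vscal t b) + norm (vscal t a) < del) by lra.
  pose proof (Hd _ _ Hab) as H1. pose proof (Hd _ _ Hba) as H2.
  rewrite !(fun u => lin_scal (B u) t) in H1, H2 by now apply bilin_r.
  rewrite (lin_scal (fun u => B u a)) in H1 by now apply bilin_l.
  rewrite (lin_scal (fun u => B u b)) in H2 by now apply bilin_l.
  replace (vadd (vadd x (vscal t b)) (vscal t a)) with (vadd (vadd x (vscal t a)) (vscal t b)) in H1 by veq.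
  match type of H1 with norm ?u <= _ => match type of H2 with norm ?v <= _ =>
    pose proof (norm_sub u v) as H3; replace (vsub u v) with (vscal (t * t) (vsub (B a b) (B b a))) in H3 by veq
  end end.
  rewrite norm_scal, Rabs_pos_eq in H3 by nra. rewrite !Hn in H1, H2.
  assert (H4 : t * t * norm (vsub (B a b) (B b a)) <= t * t * (4 * e * (N * N))) by (unfold N; lra).
  apply Rmult_le_reg_l in H4; [|nra]. eapply Rle_trans; [exact H4|].
  apply Rle_trans with (4 * e * (1 + N * N)); [nra|]. unfold e. right. field. nra.
Qed.
End SecondOrder.

Lemma taylor2_increment {V W : Type} {EV : Euc V} {EW : Euc W} {HV : EucSpace V} {HW : EucSpace W}
  (f : V -> W) L B x : taylor2 f L B x ->
  exists c r, 0 <= c /\ 0 < r /\ forall d, norm d < r ->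
    norm (vsub (f (vadd x d)) (f x)) <= c * norm d /\
    norm (vsub (vsub (f (vadd x d)) (f x)) (L d)) <= c * (norm d * norm d).
Proof.
  intros (HL & HB & Ht). destruct (lin_bound L HL) as (l & Hl & HLb).
  destruct (bilin_bound B HB) as (b & Hb & HBb). destruct (Ht 1) as (r & Hr & Hd); [lra|].
  exists (l + b + 1), (Rmin r 1). split; [lra|split; [apply Rmin_glb_lt; lra|]].
  intros d Hnd. pose proof (Rmin_l r 1). pose proof (Rmin_r r 1).
  specialize (Hd d ltac:(lra)). specialize (HLb d). specialize (HBb d d). pose proof (norm_ge0 d).
  set (D := vsub (f (vadd x d)) (f x)) in *.
  assert (H2 : norm (vsub D (L d)) <= (b + 1) * (norm d * norm d)).
  { pose proof (norm_sub_lower (vsub D (L d)) (vscal (1/2) (B d d))) as H2.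
    replace (vsub (vsub D (L d)) (vscal (1/2) (B d d))) with (vsub D (vadd (L d) (vscal (1/2) (B d d))))
      in H2 by veq.
    rewrite norm_scal, Rabs_pos_eq in H2 by lra. nra. }
  assert (H3 : norm d * norm d <= norm d) by nra.
  assert (H4 : 0 <= norm d * norm d) by nra.
  assert (H5 : 0 <= l * (norm d * norm d)) by (apply Rmult_le_pos; lra).
  split; [|lra]. pose proof (norm_sub_lower D (L d)).
  assert ((b + 1) * (norm d * norm d) <= (b + 1) * norm d) by (apply Rmult_le_compat_l; lra). lra.
Qed.

(** With eta = g(x + d) - g x, the remainder is that of h at eta, plus Lh of the remainder of g,
    plus half the error of replacing eta by Lg d in Bh. The last is cubic in d because eta - Lg d is
    quadratic. *)
Lemma taylor2_comp {U V W : Type} {EU : Euc U} {EV : Euc V} {EW : Euc W}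
  {HU : EucSpace U} {HV : EucSpace V} {HW : EucSpace W}
  (g : U -> V) (h : V -> W) Lg Bg Lh Bh x :
  taylor2 g Lg Bg x -> taylor2 h Lh Bh (g x) ->
  taylor2 (fun z => h (g z)) (fun z => Lh (Lg z))
    (fun z w => vadd (Lh (Bg z w)) (Bh (Lg z) (Lg w))) x.
Proof.
  intros Tg Th. destruct (taylor2_increment _ _ _ _ Tg) as (c & r & Hc & Hr & Hinc).
  destruct Tg as (HLg & HBg & Tg). destruct Th as (HLh & HBh & Th).
  destruct (lin_bound Lg HLg) as (lg & Hlg & HLgb).
  destruct (lin_bound Lh HLh) as (lh & Hlh & HLhb).
  destruct (bilin_bound Bh HBh) as (bh & Hbh & HBhb).
  split; [|split; [split|]].
  - intros a b y z. now rewrite HLg, HLh.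
  - intros u a b y z. rewrite (bilin_r Bg u HBg a b), HLh, HLg, (bilin_r Bh _ HBh a b). veq.
  - intros a b u1 u2 w. rewrite (bilin_l Bg w HBg a b), HLh, HLg, (bilin_l Bh (Lg w) HBh a b). veq.
  - intros eps He.
    (* [e1] and [e2] are the accuracies for g and h, while [e3] bounds |d| so that the cubic term is
       absorbed; each contribution gets eps / 3. *)
    set (e1 := eps / (3 * (1 + lh))).
    assert (He1 : e1 > 0) by (apply Rdiv_lt_0_compat; lra).
    set (e2 := eps / (3 * (1 + c * c))).
    assert (He2 : e2 > 0) by (apply Rdiv_lt_0_compat; nra).
    set (e3 := eps / (3 * (1 + bh * c * (c + lg)))).
    assert (Hb3 : 0 <= bh * c * (c + lg)) by (apply Rmult_le_pos; nra).
    assert (He3 : e3 > 0) by (apply Rdiv_lt_0_compat; lra).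
    destruct (Tg e1 He1) as (d1 & Hd1 & T1). destruct (Th e2 He2) as (d2 & Hd2 & T2).
    assert (Hd2' : 0 < d2 / (1 + c)) by (apply Rdiv_lt_0_compat; lra).
    exists (Rmin (Rmin r d1) (Rmin (d2 / (1 + c)) e3)).
    split; [repeat apply Rmin_glb_lt; lra|]. intros d Hd.
    pose proof (Rmin_l (Rmin r d1) (Rmin (d2 / (1 + c)) e3)).
    pose proof (Rmin_r (Rmin r d1) (Rmin (d2 / (1 + c)) e3)).
    pose proof (Rmin_l r d1). pose proof (Rmin_r r d1).
    pose proof (Rmin_l (d2 / (1 + c)) e3). pose proof (Rmin_r (d2 / (1 + c)) e3).
    pose proof (norm_ge0 d) as Hd0.
    destruct (Hinc d ltac:(lra)) as [I1 I2]. specialize (T1 d ltac:(lra)).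
    set (eta := vsub (g (vadd x d)) (g x)) in *.
    assert (Hge : g (vadd x d) = vadd (g x) eta) by (unfold eta; veq). rewrite Hge.
    assert (Hcd : norm d * (1 + c) < d2).
    { replace d2 with (d2 / (1 + c) * (1 + c)) by (field; lra). apply Rmult_lt_compat_r; lra. }
    specialize (T2 eta ltac:(nra)).
    set (rg := vsub eta (vadd (Lg d) (vscal (1/2) (Bg d d)))) in *.
    set (rh := vsub (vsub (h (vadd (g x) eta)) (h (g x))) (vadd (Lh eta) (vscal (1/2) (Bh eta eta)))) in *.
    set (dl := vsub eta (Lg d)) in *.
    assert (E1 : Lh eta = vadd (vadd (Lh (Lg d)) (vscal (1/2) (Lh (Bg d d)))) (Lh rg)).
    { rewrite <- (lin_scal Lh), <- !(lin_add Lh) by assumption. f_equal. unfold rg. veq. }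
    assert (E2 : Bh eta eta = vadd (Bh (Lg d) (Lg d)) (vadd (Bh dl eta) (Bh (Lg d) dl))).
    { replace (Bh dl eta) with (vsub (Bh eta eta) (Bh (Lg d) eta))
        by (symmetry; apply (lin_sub (fun u => Bh u eta)); now apply bilin_l).
      unfold dl. rewrite (lin_sub (Bh (Lg d))) by now apply bilin_r. veq. }
    replace (vsub (vsub (h (vadd (g x) eta)) (h (g x)))
      (vadd (Lh (Lg d)) (vscal (1/2) (vadd (Lh (Bg d d)) (Bh (Lg d) (Lg d))))))
    with (vadd rh (vadd (Lh rg) (vscal (1/2) (vadd (Bh dl eta) (Bh (Lg d) dl))))).
    2:{ unfold rh. rewrite E1, E2. veq. }
    assert (F1 : norm rh <= eps / 3 * (norm d * norm d)).
    { eapply Rle_trans; [exact T2|]. pose proof (norm_ge0 eta).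
      apply Rle_trans with (e2 * (c * c) * (norm d * norm d)).
      - rewrite Rmult_assoc. apply Rmult_le_compat_l; [lra|].
        replace (c * c * (norm d * norm d)) with ((c * norm d) * (c * norm d)) by ring.
        apply Rmult_le_compat; lra.
      - apply Rmult_le_compat_r; [nra|].
        replace (eps / 3) with (e2 * (1 + c * c)) by (unfold e2; field; nra). nra. }
    assert (F2 : norm (Lh rg) <= eps / 3 * (norm d * norm d)).
    { eapply Rle_trans; [apply HLhb|].
      replace (eps / 3) with (e1 * (1 + lh)) by (unfold e1; field; lra).
      pose proof (norm_ge0 rg). assert (0 <= norm d * norm d) by nra. nra. }
    assert (F3 : norm (vadd (Bh dl eta) (Bh (Lg d) dl)) <= eps / 3 * (norm d * norm d)).
    { eapply Rle_trans; [apply norm_add|].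
      pose proof (HBhb dl eta) as B1. pose proof (HBhb (Lg d) dl) as B2. specialize (HLgb d).
      pose proof (norm_ge0 dl). pose proof (norm_ge0 eta). pose proof (norm_ge0 (Lg d)).
      assert (Hs : norm dl * (norm eta + norm (Lg d)) <= c * (norm d * norm d) * ((c + lg) * norm d))
        by (apply Rmult_le_compat; lra).
      apply Rle_trans with (bh * (norm dl * (norm eta + norm (Lg d)))); [lra|].
      apply Rle_trans with (bh * (c * (norm d * norm d) * ((c + lg) * norm d)));
        [apply Rmult_le_compat_l; lra|].
      replace (bh * (c * (norm d * norm d) * ((c + lg) * norm d)))
        with (bh * c * (c + lg) * norm d * (norm d * norm d)) by ring.
      apply Rmult_le_compat_r; [nra|].
      replace (eps / 3) with (e3 * (1 + bh * c * (c + lg))) by (unfold e3; field; lra). nra. }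
    eapply Rle_trans; [apply norm_add|].
    pose proof (norm_add (Lh rg) (vscal (1/2) (vadd (Bh dl eta) (Bh (Lg d) dl)))) as F4.
    rewrite norm_scal, Rabs_pos_eq in F4 by lra.
    pose proof (norm_ge0 (vadd (Bh dl eta) (Bh (Lg d) dl))). nra.
Qed.

(** * Estimates for small t *)

(** Validity for all sufficiently small t > 0, as a predicate closed under conjunction, so that
    thresholds need not be tracked. *)
Definition small_t (Q : R -> Prop) : Prop := exists t0, 0 < t0 /\ forall t, 0 < t < t0 -> Q t.

Lemma small_t_and Q1 Q2 : small_t Q1 -> small_t Q2 -> small_t (fun t => Q1 t /\ Q2 t).
Proof.
  intros (t1 & H1 & E1) (t2 & H2 & E2). exists (Rmin t1 t2). split; [now apply Rmin_glb_lt|].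
  intros t Ht. pose proof (Rmin_l t1 t2). pose proof (Rmin_r t1 t2).
  split; [apply E1|apply E2]; lra.
Qed.

Lemma small_t_imp (Q1 Q2 : R -> Prop) : (forall t, 0 < t -> Q1 t -> Q2 t) -> small_t Q1 -> small_t Q2.
Proof. intros H (t0 & H0 & E). exists t0. split; [exact H0|]. intros t Ht. apply H; [lra|auto]. Qed.

Lemma small_t_lt c r : 0 < r -> small_t (fun t => c * t < r).
Proof.
  intros Hr. pose proof (Rabs_pos c). exists (r / (1 + Rabs c)).
  split; [apply Rdiv_lt_0_compat; lra|]. intros t Ht.
  assert (t * (1 + Rabs c) < r).
  { replace r with (r / (1 + Rabs c) * (1 + Rabs c)) by (field; lra).
    apply Rmult_lt_compat_r; lra. }
  pose proof (RRle_abs c). nra.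
Qed.

Lemma norm_R (x : R) : norm x = Rabs x.
Proof. apply sqrt_Rsqr_abs. Qed.

(** If (s, 0) lies in the closure of the cone [A], an approximating element is the certificate.
    Otherwise a separating pair (nu, rho) has rho >= 0, nu zero on the range of L, nu + rho mu in
    the polar of K and <nu, s> > 0; then mu + nu / (1 + rho) is an admissible multiplier with a
    larger value at s. *)
Lemma linear_duality {Z E : Type} {EZ : Euc Z} {EE : Euc E} {HZ : EucSpace Z} {HE : EucSpace E}
  (L : Z -> E) (K : E -> Prop) (mu s : E) :
  is_linear L -> closed_convex_cone K -> (forall k, K k -> inner mu k <= 0) ->
  (forall mu', (forall k, K k -> inner mu' k <= 0) ->
     (forall v, inner mu' (L v) = inner mu (L v)) -> inner mu' s <= inner mu s) ->
  forall eps, eps > 0 -> exists v k, K k /\ norm (vsub (vadd s (L v)) k) <= eps /\ - eps <= inner mu k.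
Proof.
  intros HL (_ & HK0 & HKs & HKa) Hmu Hmax eps He.
  (* The slack b opens the second component downward, which forces rho >= 0 after separation. *)
  set (A := fun a : E * R => exists v k b, K k /\ 0 <= b /\ a = (vsub k (L v), inner mu k - b)).
  destruct (classic (closure A (s, 0))) as [Hc|Hc].
  - destruct (Hc eps He) as (a & (v & k & b & Hk & Hb & ->) & Hn). exists v, k.
    split; [exact Hk|].
    pose proof (norm_fst (vsub s (vsub k (L v))) (vsub 0 (inner mu k - b))) as N1.
    pose proof (norm_snd (vsub s (vsub k (L v))) (vsub 0 (inner mu k - b))) as N2.
    change (vsub s (vsub k (L v)), vsub 0 (inner mu k - b))
      with (vsub (s, 0) (vsub k (L v), inner mu k - b)) in N1, N2.
    split.
    + replace (vsub (vadd s (L v)) k) with (vsub s (vsub k (L v))) by veq. lra.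
    + assert (H : Rabs (vsub 0 (inner mu k - b)) < eps) by (rewrite <- norm_R; lra).
      apply Rabs_def2 in H. unfold vsub in H. cbn in H. lra.
  - exfalso. destruct (cone_separation A (s, 0)) as ((nu, rho) & HA & Hs).
    + exists vzero, vzero, 0. split; [exact HK0|split; [lra|]].
      cbn. f_equal; [rewrite (lin_zero L HL); veq|rewrite inner_zeror; ring].
    + intros t a Ht (v & k & b & Hk & Hb & ->). exists (vscal t v), (vscal t k), (t * b).
      split; [now apply HKs|split; [now apply Rmult_le_pos|]].
      cbn. f_equal; [rewrite (lin_scal L) by exact HL; veq|inn; ring].
    + intros a a' (v & k & b & Hk & Hb & ->) (v' & k' & b' & Hk' & Hb' & ->).
      exists (vadd v v'), (vadd k k'), (b + b').
      split; [now apply HKa|split; [lra|]].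
      cbn. f_equal; [rewrite (lin_add L) by exact HL; veq|inn; ring].
    + exact Hc.
    + assert (HA' : forall v k b, K k -> 0 <= b -> inner nu k - inner nu (L v) + rho * (inner mu k - b) <= 0).
      { intros v k b Hk Hb. specialize (HA _ (ex_intro _ v (ex_intro _ k (ex_intro _ b
          (conj Hk (conj Hb eq_refl)))))). cbn in HA. revert HA. inn. lra. }
      cbn in Hs.
      assert (Hrho : 0 <= rho).
      { pose proof (HA' vzero vzero 1 HK0 ltac:(lra)) as H.
        rewrite (lin_zero L HL), !inner_zeror in H. lra. }
      assert (HnL : forall v, inner nu (L v) = 0).
      { intros v. pose proof (HA' v vzero 0 HK0 ltac:(lra)) as H1.
        pose proof (HA' (vscal (-1) v) vzero 0 HK0 ltac:(lra)) as H2.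
        rewrite (lin_scal L) in H2 by exact HL. revert H1 H2. inn. lra. }
      assert (Hinv : 0 < / (1 + rho)) by (apply Rinv_0_lt_compat; lra).
      (* The competitor equals (mu + (nu + rho mu)) / (1 + rho), hence is polar to K; dividing by 1
         + rho avoids a separate case rho = 0. *)
      assert (Hle : inner (vadd mu (vscal (/ (1 + rho)) nu)) s <= inner mu s).
      { apply Hmax.
        - intros k Hk. pose proof (HA' vzero k 0 Hk ltac:(lra)) as H.
          rewrite (lin_zero L HL), inner_zeror in H. specialize (Hmu k Hk). inn.
          replace (inner mu k) with (/ (1 + rho) * ((1 + rho) * inner mu k)) by (field; lra).
          rewrite <- Rmult_plus_distr_l.
          rewrite <- (Rmult_0_r (/ (1 + rho))). apply Rmult_le_compat_l; lra.
        - intros v. inn. rewrite HnL. ring. }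
      revert Hle. inn. intros Hle. assert (0 < / (1 + rho) * inner nu s) by (apply Rmult_lt_0_compat; lra).
      lra.
Qed.

(** By compactness: if the bound failed for arbitrarily small t, the quotients (x - a) / t would
    have a limit d tangent to A, orthogonal to f0 because <f0, x - a> is of order t^2, and with <w,
    d> <= -eta. *)
Lemma tangent_lower {V : Type} {EV : Euc V} {HV : EucSpace V} (A : V -> Prop) (a f0 w : V) :
  (forall d, tangent_cone A a d -> inner f0 d = 0 -> 0 <= inner w d) ->
  forall r eta, 0 < eta -> small_t (fun t => forall x, A x -> norm (vsub x a) <= r * t ->
    Rabs (inner f0 (vsub x a)) <= r * (t * t) -> - eta * t <= inner w (vsub x a)).
Proof.
  intros Hw r eta Heta. apply NNPP. intros Hn.
  assert (Hex : forall j : nat, exists tx : R * V, 0 < fst tx < / (INR j + 1) /\ A (snd tx) /\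
    norm (vsub (snd tx) a) <= r * fst tx /\ Rabs (inner f0 (vsub (snd tx) a)) <= r * (fst tx * fst tx) /\
    inner w (vsub (snd tx) a) < - eta * fst tx).
  { intros j. apply NNPP. intros Hj. apply Hn. exists (/ (INR j + 1)). split; [apply inv_S_pos|].
    intros t Ht x HA Hx Hf. apply Rnot_lt_le. intros Hlt. apply Hj. exists (t, x).
    exact (conj Ht (conj HA (conj Hx (conj Hf Hlt)))). }
  pose (tx := fun j => proj1_sig (constructive_indefinite_description _ (Hex j))).
  assert (Htx : forall j, 0 < fst (tx j) < / (INR j + 1) /\ A (snd (tx j)) /\
    norm (vsub (snd (tx j)) a) <= r * fst (tx j) /\
    Rabs (inner f0 (vsub (snd (tx j)) a)) <= r * (fst (tx j) * fst (tx j)) /\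
    inner w (vsub (snd (tx j)) a) < - eta * fst (tx j)).
  { intros j. unfold tx. now destruct (constructive_indefinite_description _ (Hex j)). }
  clearbody tx. clear Hex Hn.
  pose (xi := fun j => vscal (/ fst (tx j)) (vsub (snd (tx j)) a)).
  assert (Htcv : Un_cv (fun j => fst (tx j)) 0).
  { intros e He. destruct (inv_S_cv e He) as [N HN]. exists N. intros j Hj. specialize (HN j Hj).
    destruct (Htx j) as [Ht _]. unfold Rdist in *. rewrite Rminus_0_r in *.
    rewrite Rabs_pos_eq in * by lra. lra. }
  assert (Hpos : forall j, 0 < / fst (tx j)) by (intros j; apply Rinv_0_lt_compat; apply Htx).
  destruct (bounded_subseq xi r) as (phi & l & Hphi & Hl).
  { intros j. unfold xi. rewrite norm_scal, Rabs_pos_eq by (apply Rlt_le, Hpos).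
    destruct (Htx j) as (Ht & _ & Hx & _).
    replace r with (/ fst (tx j) * (r * fst (tx j))) by (field; lra).
    apply Rmult_le_compat_l; [apply Rlt_le, Hpos|exact Hx]. }
  assert (Hwl : inner w l <= - eta).
  { apply Rnot_lt_le. intros Hc.
    destruct (seq_cv_inner _ _ w Hl (inner w l + eta)) as [N HN]; [lra|].
    specialize (HN N (le_n N)). unfold Rdist in HN. apply Rabs_def2 in HN.
    rewrite (inner_sym l) in HN. unfold xi in HN. rewrite inner_scall, inner_sym in HN.
    destruct (Htx (phi N)) as (Ht & _ & _ & _ & Hlt). specialize (Hpos (phi N)).
    assert (/ fst (tx (phi N)) * inner w (vsub (snd (tx (phi N))) a) < - eta); [|lra].
    replace (- eta) with (/ fst (tx (phi N)) * (- eta * fst (tx (phi N)))) by (field; lra).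
    now apply Rmult_lt_compat_l. }
  assert (0 <= inner w l); [|lra]. apply Hw.
  - exists (fun j => fst (tx (phi j))), (fun j => xi (phi j)).
    split; [intros; apply Htx|split; [now apply (Un_cv_sub (fun j => fst (tx j)))|split; [exact Hl|]]].
    intros j. unfold xi. destruct (Htx (phi j)) as (Ht & HA & _).
    replace (vadd a _) with (snd (tx (phi j))); [exact HA|]. veq. lra.
  - apply (UL_sequence (fun j => inner (xi (phi j)) f0)).
    + rewrite inner_sym. now apply seq_cv_inner.
    + intros e He. destruct (Un_cv_sub _ _ phi Hphi Htcv (e / (1 + Rabs r))) as [N HN].
      { apply Rdiv_lt_0_compat; [lra|]. pose proof (Rabs_pos r). lra. }
      exists N. intros j Hj. specialize (HN j Hj). unfold Rdist in *. rewrite Rminus_0_r in *.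
      destruct (Htx (phi j)) as (Ht & _ & _ & Hf & _). specialize (Hpos (phi j)).
      unfold xi. rewrite inner_scall, inner_sym, Rabs_mult, (Rabs_pos_eq (/ _)) by lra.
      rewrite Rabs_pos_eq in HN by lra. pose proof (RRle_abs r). pose proof (Rabs_pos r).
      set (t := fst (tx (phi j))) in *.
      apply Rle_lt_trans with (/ t * (r * (t * t))); [apply Rmult_le_compat_l; lra|].
      replace (/ t * (r * (t * t))) with (r * t) by (field; lra).
      replace e with (e / (1 + Rabs r) * (1 + Rabs r)) by (field; lra).
      set (q := e / (1 + Rabs r)) in *. nra.
Qed.

(** For a step e + v with e of order t and v of order t^2, only e matters in the quadratic term up
    to o(t^2), uniformly in both. *)
Lemma taylor2_scaled {V W : Type} {EV : Euc V} {EW : Euc W} {HV : EucSpace V} {HW : EucSpace W}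
  (f : V -> W) L B x : taylor2 f L B x -> forall N eps, 0 <= N -> 0 < eps ->
  small_t (fun t => forall e v, norm e <= N * t -> norm v <= N * (t * t) ->
    norm (vsub (vsub (f (vadd x (vadd e v))) (f x)) (vadd (L (vadd e v)) (vscal (1/2) (B e e))))
     <= eps * (t * t)).
Proof.
  intros (HL & HB & HT) N eps HN He. destruct (bilin_bound B HB) as (b & Hb & HBb).
  (* Since |e + v| <= 2 N t, the Taylor error takes eps / 2; the terms of B involving v, halved by
     the factor 1/2, take the rest. *)
  set (e1 := eps / (2 * (1 + 4 * (N * N)))).
  assert (HNN : 0 <= N * N) by nra.
  assert (He1 : e1 > 0) by (apply Rdiv_lt_0_compat; lra).
  destruct (HT e1 He1) as (del & Hdel & Hd).
  generalize (small_t_and _ _ (small_t_lt 1 1 ltac:(lra)) (small_t_and _ _ (small_t_lt (2 * N) del Hdel)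
     (small_t_lt (3 * b * (N * N)) eps He))).
  apply small_t_imp. intros t Ht (T1 & T2 & T3) e v Hne Hnv.
  assert (Htt : t * t <= t) by nra. assert (Htt0 : 0 < t * t) by nra.
  assert (HNt : N * (t * t) <= N * t) by (apply Rmult_le_compat_l; lra).
  pose proof (norm_add e v) as Hev.
  assert (Hev' : norm (vadd e v) <= 2 * N * t) by lra.
  assert (Hlt : norm (vadd e v) < del) by lra.
  pose proof (Hd _ Hlt) as Hr.
  assert (HBB : norm (vsub (B (vadd e v) (vadd e v)) (B e e)) <= 3 * b * (N * N) * t * (t * t)).
  { replace (vsub (B (vadd e v) (vadd e v)) (B e e)) with (vadd (B v (vadd e v)) (B e v)).
    - eapply Rle_trans; [apply norm_add|].
      pose proof (HBb v (vadd e v)) as B1. pose proof (HBb e v) as B2.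
      pose proof (norm_ge0 v). pose proof (norm_ge0 e). pose proof (norm_ge0 (vadd e v)).
      assert (norm v * (norm (vadd e v) + norm e) <= N * (t * t) * (3 * N * t))
        by (apply Rmult_le_compat; lra).
      assert (b * (norm v * (norm (vadd e v) + norm e)) <= b * (N * (t * t) * (3 * N * t)))
        by (apply Rmult_le_compat_l; lra). lra.
    - rewrite (lin_add (fun y => B y (vadd e v))) by now apply bilin_l.
      rewrite !(lin_add (B _)) by now apply bilin_r. veq. }
  assert (Hq : 3 * b * (N * N) * t * (t * t) <= eps * (t * t)) by (apply Rmult_le_compat_r; lra).
  assert (Hp : e1 * (norm (vadd e v) * norm (vadd e v)) <= eps / 2 * (t * t)).
  { apply Rle_trans with (e1 * (2 * N * t * (2 * N * t))).
    - apply Rmult_le_compat_l; [lra|]. pose proof (norm_ge0 (vadd e v)). apply Rmult_le_compat; lra.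
    - replace (e1 * (2 * N * t * (2 * N * t))) with (e1 * (4 * (N * N)) * (t * t)) by ring.
      apply Rmult_le_compat_r; [lra|].
      replace (eps / 2) with (e1 * (1 + 4 * (N * N))) by (unfold e1; field; lra). nra. }
  match type of Hr with norm ?r <= _ =>
    match goal with |- norm ?u <= _ => replace u with
      (vadd r (vscal (1/2) (vsub (B (vadd e v) (vadd e v)) (B e e)))) by veq end end.
  eapply Rle_trans; [apply norm_add|]. rewrite norm_scal, Rabs_pos_eq by lra. lra.
Qed.

(** If D exceeded the bound, then t <= D, and replacing t^2 by t D would give D^2 <= (al + be) t D,
    a contradiction. *)
Lemma quadratic_bound D t al be : 0 <= D -> 0 < t -> 0 <= al -> 0 <= be ->
  D * D <= al * (t * t) + be * (t * D) -> D <= (1 + al + be) * t.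
Proof.
  intros HD Ht Hal Hbe H. apply Rnot_lt_le. intros Hc.
  assert (Htd : t <= D) by nra.
  assert (al * (t * t) <= al * (t * D)) by (apply Rmult_le_compat_l; nra).
  assert ((1 + al + be) * t * D < D * D) by (apply Rmult_lt_compat_r; nra). nra.
Qed.

(** * Critical points of perturbed constraint systems *)

Section PerturbedSolutions.
Context {P X E : Type} {EP : Euc P} {EX : Euc X} {EE : Euc E}
  {HP : EucSpace P} {HX : EucSpace X} {HE : EucSpace E}.
(** An abstract form of the reduced problem: [G] stands for h o g with derivatives [L] and [B], [f0]
    for f(zb), and [a0] for grad_x f u. [Hrob] is Robinson stability rewritten for [G] and [K], and
    [Hmax] is the maximality of the multiplier in direction (0, u). *)
Context (Gam : P -> X -> Prop) (K : E -> Prop) (G : P * X -> E) (L : P * X -> E)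
  (B : P * X -> P * X -> E) (pb : P) (xb : X) (mu : E) (f0 a0 u : X) (r0 kap : R).
Context (HT : taylor2 G L B (pb, xb)) (HG0 : G (pb, xb) = vzero) (HK : closed_convex_cone K)
  (Hr0 : 0 < r0)
  (Hloc : forall p x, norm (vsub p pb) < r0 -> norm (vsub x xb) < r0 -> Gam p x -> K (G (p, x)))
  (Hcl : forall p, norm (vsub p pb) < r0 -> is_closed (fun x => Gam p x /\ norm (vsub x xb) <= r0 / 2))
  (Hkap : 0 <= kap)
  (Hrob : forall p x k eta, norm (vsub p pb) < r0 -> norm (vsub x xb) < r0 -> K k ->
     norm (vsub (G (p, x)) k) < r0 -> 0 < eta ->
     exists x', Gam p x' /\ norm (vsub x x') <= kap * norm (vsub (G (p, x)) k) + eta)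
  (Hmu : forall k, K k -> inner mu k <= 0)
  (Hmax : forall mu', (forall k, K k -> inner mu' k <= 0) ->
     (forall v, inner mu' (L v) = inner mu (L v)) ->
     inner mu' (B (vzero, u) (vzero, u)) <= inner mu (B (vzero, u) (vzero, u)))
  (Hstat : forall d, inner f0 d + inner mu (L (vzero, d)) = 0)
  (Hu : K (L (vzero, u))) (Hfu : inner f0 u = 0)
  (Hsym : forall d, inner mu (B (vzero, d) (vzero, u)) = inner mu (B (vzero, u) (vzero, d))).

Let HL : is_linear L := proj1 HT.
Let HB : is_bilinear B := proj1 (proj2 HT).

Lemma norm_inl (q : P) : norm (q, (vzero : X)) <= norm q.
Proof. eapply Rle_trans; [apply norm_pair|]. rewrite norm_zero. lra. Qed.
Lemma norm_inr (d : X) : norm ((vzero : P), d) <= norm d.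
Proof. eapply Rle_trans; [apply norm_pair|]. rewrite norm_zero. lra. Qed.

Lemma pair_split (q : P) (d : X) : (q, d) = vadd (vzero, d) (q, vzero).
Proof. cbn. f_equal; veq. Qed.

Lemma shift_pair (p q : P) (x d : X) : (vadd p q, vadd x d) = vadd (p, x) (vadd (vzero, d) (q, vzero)).
Proof. cbn. f_equal; veq. Qed.

(** Along this quadratic curve G equals t L(0, u) + (t^2 / 2) (B(u, u) + L(q, y)) + o(t^2), which is
    within eps t^2 of the element t L(0, u) + (t^2 / 2) k of K; [Hrob] then supplies a feasible
    point. *)
Lemma feasible_curve (q : P) (y : X) (k : E) eps : 0 < eps -> K k ->
  norm (vsub (vadd (B (vzero, u) (vzero, u)) (L (q, y))) k) <= eps ->
  small_t (fun t => exists x, Gam (vadd pb (vscal (1/2 * (t * t)) q)) x /\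
    norm (vsub x (vadd xb (vadd (vscal t u) (vscal (1/2 * (t * t)) y)))) <= (kap + 1) * eps * (t * t)).
Proof.
  intros He Hk Hs.
  set (N := norm u + norm q + norm y).
  pose proof (norm_ge0 u) as Hnu. pose proof (norm_ge0 q) as Hnq. pose proof (norm_ge0 y) as Hny.
  assert (HN : 0 <= N) by (unfold N; lra).
  generalize (small_t_and _ _ (taylor2_scaled _ _ _ _ HT N (eps / 2) HN ltac:(lra))
    (small_t_and _ _ (small_t_lt 1 1 ltac:(lra)) (small_t_and _ _ (small_t_lt N r0 Hr0) (small_t_lt eps r0 Hr0)))).
  apply small_t_imp. intros t Ht (T1 & T2 & T3 & T4).
  assert (Htt : t * t <= t) by nra. assert (Htt0 : 0 < t * t) by nra.
  set (h := 1/2 * (t * t)) in *. assert (Hh : 0 < h) by (unfold h; lra).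
  set (p := vadd pb (vscal h q)). set (x := vadd xb (vadd (vscal t u) (vscal h y))).
  set (k' := vadd (vscal t (L (vzero, u))) (vscal h k)).
  assert (Hk' : K k').
  { destruct HK as (_ & _ & Ks & Ka). apply Ka; apply Ks; try assumption; lra. }
  assert (Hpx : (p, x) = vadd (pb, xb) (vadd (vscal t (vzero, u)) (vscal h (q, y)))).
  { unfold p, x. cbn. f_equal; veq. }
  assert (HG : norm (vsub (G (p, x)) k') <= eps * (t * t)).
  { rewrite Hpx. specialize (T1 (vscal t (vzero, u)) (vscal h (q, y))).
    rewrite HG0 in T1.
    assert (A1 : norm (vscal t (vzero : P, u)) <= N * t).
    { rewrite norm_scal, Rabs_pos_eq by lra. pose proof (norm_inr u).
      rewrite Rmult_comm. apply Rmult_le_compat_r; unfold N; lra. }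
    assert (A2 : norm (vscal h (q, y)) <= N * (t * t)).
    { rewrite norm_scal, Rabs_pos_eq by lra. pose proof (norm_pair q y).
      apply Rle_trans with (h * N); [apply Rmult_le_compat_l; unfold N; lra|]. unfold h.
      assert (0 <= N * (t * t)) by (apply Rmult_le_pos; lra). lra. }
    specialize (T1 A1 A2).
    rewrite (lin_add L), !(lin_scal L) in T1 by exact HL.
    rewrite (lin_scal (B (vscal t (vzero, u)))) in T1 by now apply bilin_r.
    rewrite (lin_scal (fun z => B z (vzero, u))) in T1 by now apply bilin_l.
    match type of T1 with norm ?e <= _ => replace (vsub (G _) k') with
      (vadd e (vscal h (vsub (vadd (B (vzero, u) (vzero, u)) (L (q, y))) k))) end.
    - eapply Rle_trans; [apply norm_add|]. rewrite norm_scal, Rabs_pos_eq by lra.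
      assert (h * norm (vsub (vadd (B (vzero, u) (vzero, u)) (L (q, y))) k) <= h * eps)
        by (apply Rmult_le_compat_l; lra). unfold h in *. lra.
    - unfold k', h. veq. }
  assert (Het : eps * (t * t) <= eps * t) by (apply Rmult_le_compat_l; lra).
  assert (HNt : forall c, 0 <= c <= N -> c * (t * t) <= N * t).
  { intros c Hc. apply Rmult_le_compat; lra. }
  destruct (Hrob p x k' (eps * (t * t))) as (x' & Hx' & Hd).
  - unfold p. replace (vsub (vadd pb (vscal h q)) pb) with (vscal h q) by veq.
    rewrite norm_scal, Rabs_pos_eq by lra. specialize (HNt (norm q)). unfold h, N in *.
    assert (0 <= norm q * (t * t)) by (apply Rmult_le_pos; lra). lra.
  - unfold x. replace (vsub (vadd xb (vadd (vscal t u) (vscal h y))) xb)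
      with (vadd (vscal t u) (vscal h y)) by veq.
    eapply Rle_lt_trans; [apply norm_add|]. rewrite !norm_scal, !Rabs_pos_eq by lra.
    assert (norm y * (t * t) <= norm y * t) by (apply Rmult_le_compat_l; lra).
    assert (0 <= norm q * t) by (apply Rmult_le_pos; lra).
    assert (0 <= norm y * (t * t)) by (apply Rmult_le_pos; lra).
    unfold h, N in *. lra.
  - exact Hk'.
  - lra.
  - apply Rmult_lt_0_compat; lra.
  - exists x'. split; [exact Hx'|]. rewrite norm_subC.
    assert (kap * norm (vsub (G (p, x)) k') <= kap * (eps * (t * t)))
      by (apply Rmult_le_compat_l; lra). lra.
Qed.

(** Polarity gives <mu, G(p, x)> <= 0, and stationarity turns <mu, L(0, x - xb)> into -<f0, x - xb>.
    No rate for x - xb is assumed, so this bound can be used to prove that x - xb is of order t. *)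
Lemma crude_lower_bound : exists c r, 0 <= c /\ 0 < r /\ forall p x,
  norm (vsub p pb) < r -> norm (vsub x xb) < r -> Gam p x ->
  - (c * (norm (vsub p pb) + norm (vsub x xb) * norm (vsub x xb))) <= inner f0 (vsub x xb).
Proof.
  destruct (taylor2_increment _ _ _ _ HT) as (c & r & Hc & Hr & Hinc).
  destruct (lin_bound L HL) as (l & Hl & HLb).
  pose proof (norm_ge0 mu) as Hm.
  exists (norm mu * (l + c)), (Rmin (Rmin r0 1) (r / 2)).
  split; [nra|split; [repeat apply Rmin_glb_lt; lra|]]. intros p x Hp Hx HG.
  pose proof (Rmin_l (Rmin r0 1) (r / 2)). pose proof (Rmin_r (Rmin r0 1) (r / 2)).
  pose proof (Rmin_l r0 1). pose proof (Rmin_r r0 1).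
  set (q := vsub p pb) in *. set (d := vsub x xb) in *.
  pose proof (norm_ge0 q) as Hq0. pose proof (norm_ge0 d) as Hd0.
  assert (Hqd : norm (q, d) < r) by (pose proof (norm_pair q d); lra).
  destruct (Hinc (q, d) Hqd) as [_ I]. rewrite HG0 in I.
  replace (vadd (pb, xb) (q, d)) with (p, x) in I by (unfold q, d; cbn; f_equal; veq).
  assert (HKG : inner mu (G (p, x)) <= 0) by (apply Hmu, Hloc; fold q d; try assumption; lra).
  rewrite (norm_sq (q, d)) in I. cbn in I. rewrite <- !norm_sq in I.
  set (e := vsub (vsub (G (p, x)) vzero) (L (q, d))) in *.
  assert (Hsum : inner mu (G (p, x)) = inner mu (L (vzero, d)) + inner mu (L (q, vzero)) + inner mu e).
  { unfold e. rewrite (pair_split q d), (lin_add L) by exact HL. inn. ring. }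
  pose proof (Hstat d) as Hst.
  pose proof (Rabs_le_inv _ _ (cauchy_schwarz_abs mu (L (q, vzero)))) as C1.
  pose proof (Rabs_le_inv _ _ (cauchy_schwarz_abs mu e)) as C2.
  assert (M1 : norm mu * norm (L (q, vzero)) <= norm mu * (l * norm q)).
  { apply Rmult_le_compat_l; [lra|]. pose proof (HLb (q, vzero)). pose proof (norm_inl q).
    assert (l * norm (q, (vzero : X)) <= l * norm q) by (apply Rmult_le_compat_l; lra). lra. }
  assert (M2 : norm mu * norm e <= norm mu * (c * (norm q + norm d * norm d))).
  { apply Rmult_le_compat_l; [lra|]. eapply Rle_trans; [exact I|].
    apply Rmult_le_compat_l; nra. }
  assert (M3 : 0 <= norm mu * l * (norm d * norm d)) by (apply Rmult_le_pos; nra).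
  lra.
Qed.

(** The Lagrangian inequality of [crude_lower_bound] with its exact second-order term, available
    once |x - xb| <= N t. *)
Lemma fine_lower_bound (q : P) (N eps : R) : 0 <= N -> norm q <= N -> 0 < eps ->
  small_t (fun t => forall x, Gam (vadd pb (vscal (1/2 * (t * t)) q)) x -> norm (vsub x xb) <= N * t ->
    1/2 * (t * t) * inner mu (L (q, vzero))
    + 1/2 * inner mu (B (vzero, vsub x xb) (vzero, vsub x xb)) - eps * (t * t)
      <= inner f0 (vsub x xb)).
Proof.
  intros HN HqN He. pose proof (norm_ge0 mu) as Hm.
  assert (He1 : 0 < eps / (1 + norm mu)) by (apply Rdiv_lt_0_compat; lra).
  generalize (small_t_and _ _ (taylor2_scaled _ _ _ _ HT N _ HN He1)
    (small_t_and _ _ (small_t_lt 1 1 ltac:(lra)) (small_t_lt N r0 Hr0))).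
  apply small_t_imp. intros t Ht (T1 & T2 & T3) x HG Hx.
  assert (Htt : t * t <= t) by nra. assert (Htt0 : 0 < t * t) by nra.
  set (h := 1/2 * (t * t)) in *. assert (Hh : 0 < h) by (unfold h; lra).
  set (d := vsub x xb) in *.
  assert (HNt : N * (t * t) <= N * t) by (apply Rmult_le_compat_l; lra).
  assert (HNt0 : 0 <= N * (t * t)) by (apply Rmult_le_pos; lra).
  pose proof (norm_ge0 q) as Hq0.
  assert (A0 : norm (vscal h q) <= N * (t * t)).
  { rewrite norm_scal, Rabs_pos_eq by lra.
    assert (h * norm q <= h * N) by (apply Rmult_le_compat_l; lra). unfold h in *. lra. }
  specialize (T1 (vzero, d) (vscal h q, vzero)
    ltac:(eapply Rle_trans; [apply norm_inr|exact Hx]) ltac:(eapply Rle_trans; [apply norm_inl|exact A0])).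
  rewrite <- shift_pair in T1. replace (vadd xb d) with x in T1 by (unfold d; veq).
  rewrite HG0 in T1. set (p := vadd pb (vscal h q)) in *.
  assert (HKG : inner mu (G (p, x)) <= 0).
  { apply Hmu, Hloc; fold d; try assumption; [|lra].
    replace (vsub p pb) with (vscal h q) by (unfold p; veq). lra. }
  rewrite (lin_add L) in T1 by exact HL.
  replace (vscal h q, vzero) with (vscal h (q, (vzero : X))) in T1 by (cbn; f_equal; veq).
  rewrite (lin_scal L) in T1 by exact HL.
  match type of T1 with norm ?v <= _ => set (e := v) in T1 end.
  assert (Hsum : inner mu (G (p, x)) = inner mu (L (vzero, d)) + h * inner mu (L (q, vzero))
     + 1/2 * inner mu (B (vzero, d) (vzero, d)) + inner mu e).
  { unfold e. inn. ring. }
  pose proof (Hstat d) as Hst.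
  pose proof (Rabs_le_inv _ _ (cauchy_schwarz_abs mu e)) as C2.
  assert (norm mu * norm e <= eps * (t * t)); [|lra].
  apply Rle_trans with (norm mu * (eps / (1 + norm mu) * (t * t))); [apply Rmult_le_compat_l; lra|].
  rewrite <- Rmult_assoc. apply Rmult_le_compat_r; [lra|].
  replace eps with (eps / (1 + norm mu) * (1 + norm mu)) at 2 by (field; lra). nra.
Qed.

(** A parameter shift of order t^2 moves G(p, x), an element of K, by O(t^2), and [Hrob] at pb
    corrects x at the same cost. This prepares [tangent_lower], which needs points of Gam pb. *)
Lemma near_unperturbed (q : P) (N : R) : 0 <= N -> norm q <= N ->
  exists c, 0 <= c /\ small_t (fun t => forall x, Gam (vadd pb (vscal (1/2 * (t * t)) q)) x ->
    norm (vsub x xb) <= N * t -> exists x', Gam pb x' /\ norm (vsub x x') <= c * (t * t)).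
Proof.
  intros HN HqN. destruct (lin_bound L HL) as (l & Hl & HLb).
  exists (kap * (l * N + 2) + 1). split; [assert (0 <= l * N) by nra; nra|].
  generalize (small_t_and _ _ (taylor2_scaled _ _ _ _ HT N 1 HN ltac:(lra))
    (small_t_and _ _ (small_t_lt 1 1 ltac:(lra)) (small_t_and _ _ (small_t_lt N r0 Hr0) (small_t_lt (l * N + 2) r0 Hr0)))).
  apply small_t_imp. intros t Ht (T1 & T2 & T3 & T4) x HG Hx.
  assert (Htt : t * t <= t) by nra. assert (Htt0 : 0 < t * t) by nra.
  set (h := 1/2 * (t * t)) in *. assert (Hh : 0 < h) by (unfold h; lra).
  set (d := vsub x xb) in *.
  assert (HNt : N * (t * t) <= N * t) by (apply Rmult_le_compat_l; lra).
  assert (HNt0 : 0 <= N * (t * t)) by (apply Rmult_le_pos; lra).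
  pose proof (norm_ge0 q) as Hq0.
  assert (A0 : norm (vscal h q) <= N * (t * t)).
  { rewrite norm_scal, Rabs_pos_eq by lra.
    assert (h * norm q <= h * N) by (apply Rmult_le_compat_l; lra). unfold h in *. lra. }
  assert (A1 : norm ((vzero : P), d) <= N * t) by (eapply Rle_trans; [apply norm_inr|exact Hx]).
  assert (A2 : norm (vscal h q, (vzero : X)) <= N * (t * t))
    by (eapply Rle_trans; [apply norm_inl|exact A0]).
  assert (A3 : norm ((vzero : P), (vzero : X)) <= N * (t * t))
    by (eapply Rle_trans; [apply norm_inl|]; rewrite norm_zero; exact HNt0).
  pose proof (T1 _ _ A1 A2) as E1. pose proof (T1 _ _ A1 A3) as E2.
  rewrite <- shift_pair in E1, E2. replace (vadd xb d) with x in E1, E2 by (unfold d; veq).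
  replace (vadd pb vzero) with pb in E2 by veq.
  set (p := vadd pb (vscal h q)) in *.
  rewrite !(lin_add L) in E1, E2 by exact HL.
  change ((vzero : P), (vzero : X)) with (vzero : P * X) in E2. rewrite (lin_zero L HL) in E2.
  assert (HKG : K (G (p, x))).
  { apply Hloc; fold d; try assumption; [|lra].
    replace (vsub p pb) with (vscal h q) by (unfold p; veq). lra. }
  assert (HD : norm (vsub (G (pb, x)) (G (p, x))) <= (l * N + 2) * (t * t)).
  { match type of E1 with norm ?a <= _ => match type of E2 with norm ?b <= _ =>
      replace (vsub (G (pb, x)) (G (p, x))) with (vsub (vsub b a) (L (vscal h q, vzero))) by veq;
      pose proof (norm_sub (vsub b a) (L (vscal h q, vzero))); pose proof (norm_sub b a) end end.
    pose proof (HLb (vscal h q, vzero)).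
    assert (l * norm (vscal h q, (vzero : X)) <= l * (N * (t * t))) by (apply Rmult_le_compat_l; lra).
    lra. }
  assert (HlN : 0 <= l * N) by nra.
  assert (Hs : (l * N + 2) * (t * t) <= (l * N + 2) * t) by (apply Rmult_le_compat_l; lra).
  destruct (Hrob pb x (G (p, x)) (t * t)) as (x' & Hx' & Hd); try assumption.
  - rewrite vsub_self, norm_zero. lra.
  - fold d. lra.
  - lra.
  - exists x'. split; [exact Hx'|].
    assert (kap * norm (vsub (G (pb, x)) (G (p, x))) <= kap * ((l * N + 2) * (t * t)))
      by (apply Rmult_le_compat_l; lra). lra.
Qed.

(** Restricting to a ball provides compactness; r <= r0 / 2 is required because closedness of Gam p
    is assumed only there. *)
Lemma penalty_minimizer (p : P) (c y z : X) (M r : R) :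
  norm (vsub p pb) < r0 -> 0 <= M -> r <= r0 / 2 -> Gam p z -> norm (vsub z xb) <= r ->
  exists x, Gam p x /\ norm (vsub x xb) <= r /\
    forall x', Gam p x' -> norm (vsub x' xb) <= r ->
      inner c (vsub x xb) + M / 2 * inner (vsub x y) (vsub x y)
        <= inner c (vsub x' xb) + M / 2 * inner (vsub x' y) (vsub x' y).
Proof.
  intros Hp HM Hr Hz Hzr.
  destruct (minimum_attained (fun x => Gam p x /\ norm (vsub x xb) <= r)
    (fun x => inner c (vsub x xb) + M / 2 * inner (vsub x y) (vsub x y))
    (norm xb + r) (- (norm c * r))) as (x & [Hx Hxr] & Hmin).
  - intros s l Hs Hl. split; [|apply (seq_cv_le s); [exact Hl|apply Hs]].
    apply (Hcl p Hp s); [|exact Hl]. intros j. destruct (Hs j). split; [assumption|lra].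
  - now exists z.
  - intros x [_ Hx]. pose proof (norm_sub_lower x xb). lra.
  - intros x [_ Hx]. pose proof (Rabs_le_inv _ _ (cauchy_schwarz_abs c (vsub x xb))).
    pose proof (norm_ge0 c). pose proof (inner_pos (vsub x y)).
    assert (norm c * norm (vsub x xb) <= norm c * r) by (apply Rmult_le_compat_l; lra).
    assert (0 <= M / 2 * inner (vsub x y) (vsub x y)) by (apply Rmult_le_pos; lra). lra.
  - intros s l Hs.
    apply (CV_plus (fun j => inner c (vsub (s j) xb)) (fun j => M / 2 * inner (vsub (s j) y) (vsub (s j) y))).
    + replace (inner c (vsub l xb)) with (inner l c - inner xb c) by (rewrite (inner_sym c); inn; ring).
      intros eps He. destruct (seq_cv_inner s l c Hs eps He) as [n Hn]. exists n. intros j Hj.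
      specialize (Hn j Hj). unfold Rdist in *.
      replace (inner c (vsub (s j) xb) - (inner l c - inner xb c)) with (inner (s j) c - inner l c);
        [exact Hn|rewrite (inner_sym c); inn; ring].
    + apply (CV_mult (fun _ => M / 2)); [|now apply norm_sq_cv].
      intros eps He. exists 0%nat. intros. unfold Rdist. rewrite Rminus_diag, Rabs_R0. lra.
  - exists x. split; [exact Hx|split; [exact Hxr|]]. intros x' Hx' Hxr'. now apply Hmin.
Qed.

(** As x is interior to the ball, it is a local minimizer over A. The increment of the objective is
    the gradient term plus exactly (M / 2) |e|^2, and the latter is below eps |e| for small e. *)
Lemma penalty_minimizer_normal (A : X -> Prop) (c y x : X) (M r : R) : 0 <= M -> 0 < r -> A x ->
  norm (vsub x xb) < r ->
  (forall x', A x' -> norm (vsub x' xb) <= r ->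
      inner c (vsub x xb) + M / 2 * inner (vsub x y) (vsub x y)
        <= inner c (vsub x' xb) + M / 2 * inner (vsub x' y) (vsub x' y)) ->
  normal_cone A x (vscal (-1) (vadd c (vscal M (vsub x y)))).
Proof.
  intros HM Hr Hx Hxr Hmin. split; [exact Hx|]. intros eps He.
  assert (Hq : 0 < eps / (1 + M)) by (apply Rdiv_lt_0_compat; lra).
  exists (Rmin (r - norm (vsub x xb)) (eps / (1 + M))). split; [apply Rmin_glb_lt; lra|].
  intros z Hz Hn.
  pose proof (Rmin_l (r - norm (vsub x xb)) (eps / (1 + M))).
  pose proof (Rmin_r (r - norm (vsub x xb)) (eps / (1 + M))).
  specialize (Hmin z Hz ltac:(pose proof (norm_tri x z xb); lra)).
  set (e := vsub z x) in *.
  assert (Hid : inner c (vsub z xb) + M / 2 * inner (vsub z y) (vsub z y)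
    - (inner c (vsub x xb) + M / 2 * inner (vsub x y) (vsub x y))
    = inner (vadd c (vscal M (vsub x y))) e + M / 2 * (norm e * norm e)).
  { rewrite norm_sq. replace z with (vadd x e) by (unfold e; veq). inn.
    rewrite (inner_sym y x), (inner_sym y e), (inner_sym e x). field. }
  rewrite inner_scall. pose proof (norm_ge0 e).
  assert (norm e * (1 + M) <= eps).
  { replace eps with (eps / (1 + M) * (1 + M)) by (field; lra). apply Rmult_le_compat_r; lra. }
  assert (norm e * (1 + M) * norm e <= eps * norm e) by (apply Rmult_le_compat_r; lra).
  assert (0 <= norm e * norm e) by nra. nra.
Qed.

(* The perturbed points minimize the linearized objective plus a quadratic penalty
   centered at xb + t u.  A feasible point matching the dual value up to eps t^2 bounds the
   minimum from above, the Lagrangian with multiplier mu bounds it from below, and the gap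
   controls |x - xb - t u|^2.  The weight M does not depend on sigma. *)
Lemma perturbed_critical_points (w : X) :
  (forall d, inner w d = inner a0 d + inner mu (B (vzero, u) (vzero, d))) ->
  (forall d, tangent_cone (Gam pb) xb d -> inner f0 d = 0 -> 0 <= inner w d) ->
  inner w u <= 0 ->
  exists M, 0 <= M /\ forall sigma, 0 < sigma -> exists N, 0 <= N /\
    small_t (fun t => exists p x, norm (vsub p pb) <= N * (t * t) /\
       norm (vsub (vsub x xb) (vscal t u)) <= sigma * t /\
       normal_cone (Gam p) x (vscal (-1)
         (vadd (vadd f0 (vscal t a0)) (vscal M (vsub (vsub x xb) (vscal t u)))))).
Proof.
  intros Hw Hwt Hwu.
  destruct crude_lower_bound as (c3 & r3 & Hc3 & Hr3 & Hcrude).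
  destruct (bilin_bound B HB) as (b & Hb & HBb).
  set (s0 := B (vzero, u) (vzero, u)) in *.
  pose proof (norm_ge0 mu) as Hmu0. pose proof (norm_ge0 u) as Hu0.
  pose proof (norm_ge0 f0) as Hf00. pose proof (norm_ge0 a0) as Ha00.
  pose proof (norm_ge0 w) as Hw0.
  assert (Hmb : 0 <= norm mu * b) by (apply Rmult_le_pos; lra).
  (* 2 c3 offsets the crude lower bound, |mu| b the curvature term <mu, B(v, v)>, and 4 leaves a
     positive multiple of |v|^2. *)
  set (M := 2 * c3 + norm mu * b + 4). assert (HM : 0 <= M) by (unfold M; lra).
  exists M. split; [exact HM|]. intros sigma Hsig.
  (* c1 eps t^2 bounds the distance of the competitor from the quadratic curve; c2 collects its
     losses in objective value: (|mu| + 1) / 2 from duality, |f0| c1 from that distance, and 1 from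
     the a0 and penalty terms. *)
  set (c1 := kap + 1).
  set (c2 := 1/2 * (norm mu + 1) + norm f0 * c1 + 1).
  assert (Hc1 : 0 <= c1) by (unfold c1; lra).
  assert (Hfc : 0 <= norm f0 * c1) by (apply Rmult_le_pos; lra).
  assert (Hc2 : 0 < c2) by (unfold c2; lra).
  (* The concluding estimate is 2 |v|^2 <= (c2 + 3) eps t^2, so this choice makes |v| <= sigma t. *)
  set (eps := sigma * sigma / (c2 + 3)).
  assert (He : 0 < eps) by (apply Rdiv_lt_0_compat; nra).
  destruct (linear_duality L K mu s0 HL HK Hmu Hmax eps He) as ((q & y) & k & Hk & Hks & Hmk).
  set (lq := inner mu (L (q, vzero))).
  set (U := 1/2 * inner mu s0 + 1/2 * lq + inner a0 u + c2 * eps).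
  pose proof (norm_ge0 q) as Hq0. pose proof (norm_ge0 y) as Hy0.
  assert (Hc3q : 0 <= c3 * norm q) by (apply Rmult_le_pos; lra).
  assert (HMu : 0 <= M * norm u) by (apply Rmult_le_pos; lra).
  (* U t^2 will bound the minimum from above; R1 is then the constant of [quadratic_bound] giving |x
     - xb| <= R1 t. *)
  set (R1 := 1 + (Rabs U + c3 * norm q) + (norm a0 + M * norm u)).
  pose proof (Rabs_pos U) as HU0.
  assert (HR1 : 0 <= R1) by (unfold R1; lra).
  set (N := R1 + norm q).
  destruct (near_unperturbed q N ltac:(unfold N; lra) ltac:(unfold N; lra)) as (c7 & Hc7 & Hnear).
  set (N1 := norm y + c1 * eps).
  assert (HN1 : 0 <= N1) by (unfold N1; assert (0 <= c1 * eps) by (apply Rmult_le_pos; lra); lra).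
  (* R3 dominates both |x' - xb| / t and |<f0, x' - xb>| / t^2 for the corrected point x' of Gam
     pb. *)
  set (R3 := R1 + c7 + (c3 * (norm q + R1 * R1) + Rabs U + norm a0 * R1) + norm f0 * c7).
  assert (Hfc7 : 0 <= norm f0 * c7) by (apply Rmult_le_pos; lra).
  assert (HaR : 0 <= norm a0 * R1) by (apply Rmult_le_pos; lra).
  assert (HcR : 0 <= c3 * (R1 * R1)) by (apply Rmult_le_pos; [lra|apply Rle_0_sqr]).
  exists (norm q). split; [exact Hq0|].
  set (rho := Rmin (r0 / 2) (r3 / 2)).
  assert (Hrho : 0 < rho) by (unfold rho; apply Rmin_glb_lt; lra).
  pose proof (Rmin_l (r0 / 2) (r3 / 2)) as Hrho1. pose proof (Rmin_r (r0 / 2) (r3 / 2)) as Hrho2.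
  fold rho in Hrho1, Hrho2.
  generalize (small_t_and _ _ (feasible_curve q y k eps He Hk Hks)
   (small_t_and _ _ (fine_lower_bound q N eps ltac:(unfold N; lra) ltac:(unfold N; lra) He)
   (small_t_and _ _ Hnear
   (small_t_and _ _ (tangent_lower (Gam pb) xb f0 w Hwt R3 eps He)
   (small_t_and _ _ (small_t_lt 1 1 ltac:(lra))
   (small_t_and _ _ (small_t_lt (norm q) (Rmin r0 r3) ltac:(apply Rmin_glb_lt; lra))
   (small_t_and _ _ (small_t_lt (norm u + N1) rho Hrho)
   (small_t_and _ _ (small_t_lt R1 rho Hrho)
   (small_t_and _ _ (small_t_lt (norm a0 * N1) (eps / 2) ltac:(lra))
   (small_t_and _ _ (small_t_lt (M * (N1 * N1)) (eps / 2) ltac:(lra))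
               (small_t_lt (norm w * c7) eps He))))))))))).
  apply small_t_imp. intros t Ht ((z & Hz & Hzn) & Fi & Nr & Tl & T1 & Tq & TN & TR & Ta & TM & Tw).
  clear Hnear.
  pose proof (Rmin_l r0 r3). pose proof (Rmin_r r0 r3).
  assert (Htt : t * t <= t) by nra. assert (Htt0 : 0 < t * t) by nra.
  set (h := 1/2 * (t * t)) in *. assert (Hh : 0 < h) by (unfold h; lra).
  set (p := vadd pb (vscal h q)) in *.
  assert (Hp : norm (vsub p pb) = h * norm q).
  { replace (vsub p pb) with (vscal h q) by (unfold p; veq). rewrite norm_scal, Rabs_pos_eq; lra. }
  assert (Hqt : h * norm q <= norm q * (t * t)).
  { assert (0 <= norm q * (t * t)) by (apply Rmult_le_pos; lra). unfold h. lra. }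
  assert (Hqt' : norm q * (t * t) <= norm q * t) by (apply Rmult_le_compat_l; lra).
  set (e := vsub z (vadd xb (vadd (vscal t u) (vscal h y)))) in *. fold c1 in Hzn.
  set (g := vadd (vscal h y) e).
  assert (Hzg : vsub z xb = vadd (vscal t u) g) by (unfold g, e; veq).
  assert (Hg : norm g <= N1 * (t * t)).
  { unfold g. eapply Rle_trans; [apply norm_add|]. rewrite norm_scal, Rabs_pos_eq by lra.
    assert (0 <= norm y * (t * t)) by (apply Rmult_le_pos; lra). unfold N1, h. lra. }
  assert (HNt : N1 * (t * t) <= N1 * t) by (apply Rmult_le_compat_l; lra).
  destruct (penalty_minimizer p (vadd f0 (vscal t a0)) (vadd xb (vscal t u)) z M rho)
    as (x & Hx & Hxr & Hmin).
  { lra. } { exact HM. } { exact Hrho1. } { exact Hz. }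
  { rewrite Hzg. eapply Rle_trans; [apply norm_add|]. rewrite norm_scal, Rabs_pos_eq by lra. lra. }
  exists p, x. set (d := vsub x xb) in *. set (v := vsub d (vscal t u)).
  assert (Hv : vsub x (vadd xb (vscal t u)) = v) by (unfold v, d; veq).
  assert (Hd : d = vadd (vscal t u) v) by (unfold v; veq).
  assert (Hup : inner f0 d + t * inner a0 d + M / 2 * (norm v * norm v) <= U * (t * t)).
  { pose proof (Hmin z Hz) as H1. rewrite Hv in H1. rewrite Hzg in H1.
    replace (vsub z (vadd xb (vscal t u))) with g in H1 by (unfold g, e; veq).
    rewrite <- !norm_sq in H1. rewrite !inner_addl, !inner_addr, !inner_scall, !inner_scalr, Hfu in H1.
    assert (H0' : norm (vadd (vscal t u) g) <= rho).
    { eapply Rle_trans; [apply norm_add|]. rewrite norm_scal, Rabs_pos_eq by lra. lra. }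
    specialize (H1 H0').
    assert (Hfg : inner f0 g = h * inner f0 y + inner f0 e) by (unfold g; inn; ring).
    (* The certificate bounds the primal value here: stationarity expresses <f0, y> through mu, s0 +
       L(q, y) is within eps of k, and <mu, k> >= -eps. *)
    assert (Hfy : inner f0 y <= lq + inner mu s0 + (norm mu + 1) * eps).
    { pose proof (Hstat y) as Hst. unfold lq.
      assert (E1 : inner mu (L (q, y)) = inner mu (L (vzero, y)) + inner mu (L (q, vzero)))
        by (rewrite (pair_split q y), (lin_add L) by exact HL; inn; ring).
      pose proof (Rabs_le_inv _ _ (cauchy_schwarz_abs mu (vsub (vadd s0 (L (q, y))) k))) as E2.
      assert (E3 : norm mu * norm (vsub (vadd s0 (L (q, y))) k) <= norm mu * eps)
        by (apply Rmult_le_compat_l; lra).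
      revert E2 E3. inn. lra. }
    assert (Hfe : inner f0 e <= norm f0 * (c1 * eps * (t * t))).
    { eapply Rle_trans; [apply cauchy_schwarz|]. apply Rmult_le_compat_l; lra. }
    assert (Hag : t * inner a0 g <= eps / 2 * (t * t)).
    { apply Rle_trans with (t * (norm a0 * (N1 * (t * t)))).
      - apply Rmult_le_compat_l; [lra|]. eapply Rle_trans; [apply cauchy_schwarz|].
        apply Rmult_le_compat_l; lra.
      - replace (t * (norm a0 * (N1 * (t * t)))) with (norm a0 * N1 * t * (t * t)) by ring.
        apply Rmult_le_compat_r; lra. }
    assert (Hgg : M / 2 * (norm g * norm g) <= eps / 2 * (t * t)).
    { pose proof (norm_ge0 g).
      assert (norm g * norm g <= N1 * t * (N1 * (t * t))) by (apply Rmult_le_compat; lra).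
      assert (M * (norm g * norm g) <= M * (N1 * t * (N1 * (t * t)))) by (apply Rmult_le_compat_l; lra).
      assert (M * (N1 * N1) * t * (t * t) <= eps / 2 * (t * t)) by (apply Rmult_le_compat_r; lra).
      assert (0 <= M * (norm g * norm g)) by (apply Rmult_le_pos; [lra|apply Rle_0_sqr]). lra. }
    assert (Hhf : h * inner f0 y <= h * (lq + inner mu s0 + (norm mu + 1) * eps))
      by (apply Rmult_le_compat_l; lra).
    unfold U, c2, h in *. lra. }
  set (D := norm d) in *. assert (HD0 : 0 <= D) by apply norm_ge0.
  assert (Hcr : - (c3 * (h * norm q + D * D)) <= inner f0 d).
  { rewrite <- Hp. apply Hcrude; fold d D; try assumption; lra. }
  (* Bounding |v|^2 below by D^2 - 2 t D |u| turns [Hup] and [Hcr] into a quadratic inequality for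
     D. *)
  assert (HDR : D <= R1 * t).
  { apply quadratic_bound; try lra.
    assert (Hvv : D * D - 2 * (t * (D * norm u)) <= norm v * norm v).
    { unfold v. rewrite norm_sq. inn. rewrite (inner_sym u d), <- (norm_sq d), <- (norm_sq u). fold D.
      pose proof (cauchy_schwarz d u) as C1. fold D in C1.
      assert (t * inner d u <= t * (D * norm u)) by (apply Rmult_le_compat_l; lra).
      assert (0 <= t * norm u * (t * norm u)) by apply Rle_0_sqr. lra. }
    assert (M / 2 * (D * D - 2 * (t * (D * norm u))) <= M / 2 * (norm v * norm v))
      by (apply Rmult_le_compat_l; lra).
    pose proof (Rabs_le_inv _ _ (cauchy_schwarz_abs a0 d)) as C2. fold D in C2.
    assert (t * (- (norm a0 * D)) <= t * inner a0 d) by (apply Rmult_le_compat_l; lra).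
    assert (c3 * (h * norm q) <= c3 * norm q * (t * t)) by (rewrite Rmult_assoc; apply Rmult_le_compat_l; lra).
    assert (U * (t * t) <= Rabs U * (t * t)) by (apply Rmult_le_compat_r; [lra|apply RRle_abs]).
    assert (0 <= (1 + norm mu * b / 2) * (D * D)) by (apply Rmult_le_pos; [lra|apply Rle_0_sqr]).
    unfold M in *. lra. }
  assert (HRt : R1 * t <= N * t) by (apply Rmult_le_compat_r; unfold N; lra).
  assert (HDD : D * D <= R1 * R1 * (t * t)).
  { replace (R1 * R1 * (t * t)) with (R1 * t * (R1 * t)) by ring. apply Rmult_le_compat; lra. }
  (* Subtracting the fine lower bound from [Hup] cancels the constants of U up to eps; the terms
     linear in v assemble into t <w, v>, and M absorbs the quadratic form in v. *)
  assert (Hgap : t * inner w v + 2 * (norm v * norm v) <= (c2 + 1) * eps * (t * t)).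
  { pose proof (Fi x Hx ltac:(fold d D; lra)) as HF. fold d lq in HF.
    assert (Ebb : inner mu (B (vzero, d) (vzero, d)) =
       t * t * inner mu s0 + 2 * t * inner mu (B (vzero, u) (vzero, v)) + inner mu (B (vzero, v) (vzero, v))).
    { replace ((vzero : P), d) with (vadd (vscal t ((vzero : P), u)) (vzero, v))
        by (rewrite Hd; cbn; f_equal; veq).
      rewrite (lin_add (fun z => B z _)) by now apply bilin_l.
      rewrite !(lin_add (B _)) by now apply bilin_r.
      rewrite !(lin_scal (B _)) by now apply bilin_r.
      rewrite !(lin_scal (fun z => B z _)) by now apply bilin_l.
      inn. rewrite (Hsym v). fold s0. ring. }
    assert (Hvb : - (norm mu * b * (norm v * norm v)) <= inner mu (B (vzero, v) (vzero, v))).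
    { pose proof (Rabs_le_inv _ _ (cauchy_schwarz_abs mu (B (vzero, v) (vzero, v)))) as C1.
      pose proof (HBb (vzero, v) (vzero, v)) as C2. pose proof (norm_inr v) as C3.
      pose proof (norm_ge0 ((vzero : P), v)) as C4.
      assert (norm ((vzero : P), v) * norm ((vzero : P), v) <= norm v * norm v)
        by (apply Rmult_le_compat; lra).
      assert (b * (norm ((vzero : P), v) * norm ((vzero : P), v)) <= b * (norm v * norm v))
        by (apply Rmult_le_compat_l; lra).
      assert (norm mu * norm (B (vzero, v) (vzero, v)) <= norm mu * (b * (norm v * norm v)))
        by (apply Rmult_le_compat_l; lra). lra. }
    assert (Had : inner a0 d = t * inner a0 u + inner a0 v) by (rewrite Hd; inn; ring).
    rewrite Ebb in HF. rewrite Had in Hup. rewrite (Hw v).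
    assert (0 <= c3 * (norm v * norm v)) by (apply Rmult_le_pos; [lra|apply Rle_0_sqr]).
    unfold U, h, M in *. lra. }
  split; [|split].
  - lra.
  (* The test <w, x' - xb> >= -eps t is made at a point x' of Gam pb. Returning to x costs another
     eps t, and subtracting t u costs nothing since <w, u> <= 0. *)
  - destruct (Nr x Hx ltac:(fold d D; lra)) as (x' & Hx' & Hxx).
    set (m := vsub x x') in *.
    assert (Hm : vsub x' xb = vsub d m) by (unfold d, m; veq).
    assert (Hc7t : c7 * (t * t) <= c7 * t) by (apply Rmult_le_compat_l; lra).
    assert (HR3 : R1 + c7 <= R3).
    { unfold R3. lra. }
    pose proof (Tl x' Hx') as HT'. rewrite Hm in HT'.
    assert (Hwx : - eps * t <= inner w (vsub d m)).
    { apply HT'.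
      - eapply Rle_trans; [apply norm_sub|]. fold D.
        assert ((R1 + c7) * t <= R3 * t) by (apply Rmult_le_compat_r; lra). lra.
      - assert (Hfm : Rabs (inner f0 m) <= norm f0 * c7 * (t * t)).
        { eapply Rle_trans; [apply cauchy_schwarz_abs|]. rewrite Rmult_assoc.
          apply Rmult_le_compat_l; lra. }
        apply Rabs_le_inv in Hfm.
        assert (Hfd1 : - (c3 * (norm q + R1 * R1) * (t * t)) <= inner f0 d).
        { assert (c3 * (h * norm q + D * D) <= c3 * ((norm q + R1 * R1) * (t * t)))
            by (apply Rmult_le_compat_l; lra). lra. }
        assert (Hfd2 : inner f0 d <= (Rabs U + norm a0 * R1) * (t * t)).
        { pose proof (Rabs_le_inv _ _ (cauchy_schwarz_abs a0 d)) as C2. fold D in C2.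
          assert (norm a0 * D <= norm a0 * (R1 * t)) by (apply Rmult_le_compat_l; lra).
          assert (t * (- (norm a0 * (R1 * t))) <= t * inner a0 d) by (apply Rmult_le_compat_l; lra).
          assert (U * (t * t) <= Rabs U * (t * t)) by (apply Rmult_le_compat_r; [lra|apply RRle_abs]).
          assert (0 <= M / 2 * (norm v * norm v)) by (apply Rmult_le_pos; [lra|apply Rle_0_sqr]). lra. }
        assert (Hpos : 0 <= (R1 + c7) * (t * t)) by (apply Rmult_le_pos; lra).
        assert (Hpos1 : 0 <= c3 * (norm q + R1 * R1) * (t * t))
          by (apply Rmult_le_pos; [lra|lra]).
        assert (Hpos2 : 0 <= (Rabs U + norm a0 * R1) * (t * t)) by (apply Rmult_le_pos; lra).
        apply Rabs_le. unfold R3. inn. lra. }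
    assert (Hwm : inner w m <= eps * t).
    { eapply Rle_trans; [apply cauchy_schwarz|].
      apply Rle_trans with (norm w * (c7 * (t * t))); [apply Rmult_le_compat_l; lra|].
      replace (norm w * (c7 * (t * t))) with (norm w * c7 * t * t) by ring.
      apply Rmult_le_compat_r; lra. }
    assert (Hwm' : - (eps * t) <= inner w m).
    { pose proof (Rabs_le_inv _ _ (cauchy_schwarz_abs w m)) as C1.
      assert (norm w * norm m <= norm w * (c7 * (t * t))) by (apply Rmult_le_compat_l; lra).
      assert (norm w * c7 * t * t <= eps * t) by (apply Rmult_le_compat_r; lra). lra. }
    assert (Hwv : - (2 * eps * t) <= inner w v).
    { unfold v. revert Hwx. inn. assert (t * inner w u <= t * 0) by (apply Rmult_le_compat_l; lra). lra. }
    assert (t * (- (2 * eps * t)) <= t * inner w v) by (apply Rmult_le_compat_l; lra).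
    apply norm_le_sq; [apply Rmult_le_pos; lra|]. rewrite <- norm_sq. fold v.
    replace (sigma * t * (sigma * t)) with ((c2 + 3) * eps * (t * t)) by (unfold eps; field; lra).
    pose proof (Rle_0_sqr (norm v)) as Hv2. unfold Rsqr in Hv2. lra.
  - fold v. rewrite <- Hv. apply (penalty_minimizer_normal _ _ _ _ M rho); try assumption.
    fold d D. lra.
Qed.
End PerturbedSolutions.

(** * Consequences of smoothness, closedness and normality *)

Lemma C2_on_facts {V W : Type} {EV : Euc V} {EW : Euc W} {HV : EucSpace V} {HW : EucSpace W}
  (f : V -> W) Df D2f x r : r > 0 -> C2_on (ball x r) f Df D2f ->
  taylor2 f (Df x) (D2f x) x /\ strict_diff f (Df x) x /\ forall a b, D2f x a b = D2f x b a.
Proof.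
  intros Hr H.
  assert (Hx : ball x r x) by (unfold ball; rewrite vsub_self, norm_zero; lra).
  destruct (H x Hx) as (_ & H2 & _).
  assert (Hf : forall y, ball x r y -> frechet f (Df y) y) by (intros y Hy; apply (H y Hy)).
  split; [now apply (taylor2_C2 f Df _ x r)|split].
  - apply (strict_diff_C1 f Df x r); try assumption. now apply (frechet2_op_cont _ (D2f x)).
  - now apply (second_derivative_sym f Df _ x r).
Qed.

Lemma strict_diff_lipschitz {V W : Type} {EV : Euc V} {EW : Euc W} {HV : EucSpace V} {HW : EucSpace W}
  (f : V -> W) L x : strict_diff f L x ->
  exists c r, 0 <= c /\ 0 < r /\ forall y z, norm (vsub y x) < r -> norm (vsub z x) < r ->
    norm (vsub (f z) (f y)) <= c * norm (vsub z y).
Proof.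
  intros [HL H]. destruct (lin_bound L HL) as (l & Hl & HLb).
  destruct (H 1) as (r & Hr & Hd); [lra|]. exists (l + 1), r. split; [lra|split; [exact Hr|]].
  intros y z Hy Hz. specialize (Hd y z Hy Hz). specialize (HLb (vsub z y)).
  pose proof (norm_sub_lower (vsub (f z) (f y)) (L (vsub z y))). lra.
Qed.

Lemma closed_closure {V : Type} {EV : Euc V} {HV : EucSpace V} (A : V -> Prop) x :
  is_closed A -> closure A x -> A x.
Proof.
  intros Hcl Hx.
  assert (Hex : forall j : nat, exists a, A a /\ norm (vsub x a) < / (INR j + 1))
    by (intros j; apply Hx, inv_S_pos).
  apply (Hcl (fun j => proj1_sig (constructive_indefinite_description _ (Hex j)))).
  - intros j. now destruct (constructive_indefinite_description _ (Hex j)).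
  - intros eps He. destruct (inv_S_cv eps He) as [N HN]. exists N. intros j Hj.
    destruct (constructive_indefinite_description _ (Hex j)) as (a & Ha & Hn). cbn.
    specialize (HN j Hj). unfold Rdist in HN.
    rewrite Rminus_0_r, Rabs_pos_eq in HN by (apply Rlt_le, inv_S_pos).
    rewrite norm_subC. lra.
Qed.

Lemma normal_tangent {V : Type} {EV : Euc V} {HV : EucSpace V} (A : V -> Prop) a v w :
  normal_cone A a v -> tangent_cone A a w -> inner v w <= 0.
Proof.
  intros [_ Hv] (t & ws & Ht & Htcv & Hws & HA). apply Rnot_lt_le. intros Hc.
  set (c := inner v w) in *. pose proof (norm_ge0 w) as Hw0.
  (* With |ws j| <= |w| + 1 this accuracy bounds <v, ws j> by c / 4, whereas convergence keeps it
     above c / 2. *)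
  destruct (Hv (c / (4 * (norm w + 1)))) as (del & Hdel & Hd); [apply Rdiv_lt_0_compat; lra|].
  assert (Hq : 0 < del / (norm w + 1)) by (apply Rdiv_lt_0_compat; lra).
  destruct (Htcv _ Hq) as [N1 HN1]. destruct (Hws 1) as [N2 HN2]; [lra|].
  destruct (seq_cv_inner ws w v Hws (c / 2)) as [N3 HN3]; [lra|].
  set (j := max N1 (max N2 N3)).
  specialize (HN1 j ltac:(lia)). specialize (HN2 j ltac:(lia)). specialize (HN3 j ltac:(lia)).
  specialize (Ht j). unfold Rdist in HN1, HN3.
  rewrite Rminus_0_r, Rabs_pos_eq in HN1 by lra. apply Rabs_def2 in HN3.
  rewrite (inner_sym w v), (inner_sym (ws j) v) in HN3. fold c in HN3.
  pose proof (norm_sub_lower (ws j) w) as Hn.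
  specialize (Hd _ (HA j)). replace (vsub (vadd a (vscal (t j) (ws j))) a) with (vscal (t j) (ws j)) in Hd by veq.
  rewrite norm_scal, Rabs_pos_eq, inner_scalr in Hd by lra.
  assert (Htw : t j * norm (ws j) < del).
  { apply Rle_lt_trans with (t j * (norm w + 1)); [apply Rmult_le_compat_l; lra|].
    replace del with (del / (norm w + 1) * (norm w + 1)) by (field; lra).
    apply Rmult_lt_compat_r; lra. }
  specialize (Hd Htw).
  assert (Hle : c / (4 * (norm w + 1)) * (t j * norm (ws j)) <= t j * (c / 4)).
  { replace (t j * (c / 4)) with (c / (4 * (norm w + 1)) * (t j * (norm w + 1))) by (field; lra).
    apply Rmult_le_compat_l; [apply Rlt_le, Rdiv_lt_0_compat; lra|].
    apply Rmult_le_compat_l; lra. }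
  assert (t j * (c / 2) < t j * inner v (ws j)) by (apply Rmult_lt_compat_l; lra).
  assert (0 < t j * c) by (apply Rmult_lt_0_compat; lra). lra.
Qed.

Lemma adjv_inner {n : nat} {W : Type} {EW : Euc W} {HW : EucSpace W} (A : vec n -> W) w x :
  is_linear A -> inner (adjv A w) x = inner w (A x).
Proof.
  intros HA. apply (riesz_inner n (fun x => inner w (A x))). intros a b y z. rewrite HA. inn. ring.
Qed.

Lemma partial_linear {P X W : Type} {EP : Euc P} {EX : Euc X} {EW : Euc W}
  {HP : EucSpace P} {HX : EucSpace X} {HW : EucSpace W} (L : P * X -> W) :
  is_linear L -> is_linear (fun x => L (vzero, x)).
Proof. intros H a b x y. rewrite <- H. f_equal. cbn. f_equal. veq. Qed.

(** * Multipliers under cone reduction *)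

Section Reduction.
Context {l k : nat} (C : vec l -> Prop) (yb : vec l) (K : vec k -> Prop)
  (h : vec l -> vec k) (Lh : vec l -> vec k) (Bh : vec l -> vec l -> vec k) (rh : R).
Context (HK : closed_convex_cone K) (Hh : taylor2 h Lh Bh yb) (Hsd : strict_diff h Lh yb)
  (Hh0 : h yb = vzero) (Hsurj : surjective Lh) (Hrh : 0 < rh)
  (HCK : forall y, ball yb rh y -> (C y <-> K (h y))).

(** If Lh w lies in K, then h(y) = t Lh w can be solved with y = yb + t w + O(t^2), so y is in C and
    normality gives <lam, w> <= 0. Thus lam is nonpositive on the preimage of K under Lh, and so
    factors through Lh. *)
Lemma reduction_multiplier lam : normal_cone C yb lam ->
  exists mu, (forall e, K e -> inner mu e <= 0) /\ forall y, inner mu (Lh y) = inner lam y.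
Proof.
  intros [_ Hlam].
  destruct (taylor2_increment _ _ _ _ Hh) as (c & r & Hc & Hr & Hinc).
  destruct (strict_diff_inv _ _ _ Hsd Hsurj) as (c' & r' & Hc' & Hr' & Hinv).
  destruct Hsd as [HL _].
  assert (Hle : forall w, K (Lh w) -> inner lam w <= 0).
  { intros w HKw. apply Rnot_lt_le. intros Hpos.
    pose proof (norm_ge0 w) as Hw0. pose proof (norm_ge0 lam) as Hl0.
    set (D := c' * (c * (norm w * norm w))).
    assert (HD0 : 0 <= c * (norm w * norm w)) by (apply Rmult_le_pos; [lra|apply Rle_0_sqr]).
    assert (HD : 0 <= D) by (unfold D; apply Rmult_le_pos; lra).
    (* D t^2 bounds the correction from yb + t w to y. Of t <lam, w>, one half is allotted to the
       normality error and one quarter to this correction, which leaves a contradiction. *)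
    set (eps := inner lam w / (2 * (norm w + D + 1))).
    assert (He : eps > 0) by (apply Rdiv_lt_0_compat; lra).
    assert (Hp4 : 0 < inner lam w / 4) by lra.
    destruct (Hlam eps He) as (del & Hdel & Hd).
    destruct (small_t_and _ _ (small_t_lt 1 1 ltac:(lra)) (small_t_and _ _ (small_t_lt (norm w) r Hr)
      (small_t_and _ _ (small_t_lt (norm w) r' Hr') (small_t_and _ _ (small_t_lt (c * (norm w * norm w)) r' Hr')
      (small_t_and _ _ (small_t_lt (norm w + D) del Hdel) (small_t_and _ _ (small_t_lt (norm w + D) rh Hrh)
        (small_t_lt (norm lam * D) _ Hp4))))))) as (t0 & Ht0 & HE).
    destruct (HE (t0 / 2) ltac:(lra)) as (T1 & T2 & T3 & T4 & T5 & T6 & T7).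
    set (t := t0 / 2) in *. assert (Ht : 0 < t) by (unfold t; lra). clearbody t. clear HE.
    assert (Htt : t * t <= t).
    { rewrite <- (Rmult_1_r t) at 3. apply Rmult_le_compat_l; lra. }
    assert (Htt0 : 0 < t * t) by (apply Rmult_lt_0_compat; lra).
    assert (Hnt : norm (vscal t w) = t * norm w) by (rewrite norm_scal, Rabs_pos_eq; lra).
    assert (Hlt : norm (vscal t w) < r) by lra.
    destruct (Hinc _ Hlt) as [_ I]. rewrite Hh0, Hnt in I.
    set (a := vadd yb (vscal t w)) in *.
    replace (vsub (h a) vzero) with (h a) in I by veq.
    assert (I' : norm (vsub (h a) (Lh (vscal t w))) <= c * (norm w * norm w) * (t * t)) by lra.
    destruct (Hinv a (Lh (vscal t w))) as (y & Hy & Hya).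
    - unfold a. replace (vsub (vadd yb (vscal t w)) yb) with (vscal t w) by veq. lra.
    - assert (c * (norm w * norm w) * (t * t) <= c * (norm w * norm w) * t) by (apply Rmult_le_compat_l; lra).
      lra.
    - assert (HyD : norm (vsub y a) <= D * (t * t)).
      { eapply Rle_trans; [exact Hya|]. unfold D. rewrite Rmult_assoc. apply Rmult_le_compat_l; lra. }
      assert (HDt : D * (t * t) <= D * t) by (apply Rmult_le_compat_l; lra).
      set (e := vsub y a) in *.
      assert (Hye : vsub y yb = vadd (vscal t w) e) by (unfold e, a; veq).
      assert (Hyn : norm (vsub y yb) <= (norm w + D) * t).
      { rewrite Hye. eapply Rle_trans; [apply norm_add|]. lra. }
      assert (HCy : C y).
      { apply HCK; [unfold ball; lra|]. rewrite Hy, (lin_scal Lh) by exact HL.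
        destruct HK as (_ & _ & Ks & _). apply Ks; [lra|exact HKw]. }
      pose proof (Hd y HCy ltac:(lra)) as Hi.
      assert (Heps : eps * norm (vsub y yb) <= inner lam w / 2 * t).
      { apply Rle_trans with (eps * ((norm w + D) * t)); [apply Rmult_le_compat_l; lra|].
        rewrite <- Rmult_assoc. apply Rmult_le_compat_r; [lra|].
        replace (inner lam w / 2) with (eps * (norm w + D + 1)) by (unfold eps; field; lra).
        apply Rmult_le_compat_l; lra. }
      rewrite Hye, inner_addr, inner_scalr in Hi. rewrite <- Hye in Hi.
      pose proof (Rabs_le_inv _ _ (cauchy_schwarz_abs lam e)) as C1.
      assert (norm lam * norm e <= norm lam * (D * (t * t))) by (apply Rmult_le_compat_l; lra).
      assert (norm lam * D * t * t <= inner lam w / 4 * t) by (apply Rmult_le_compat_r; lra).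
      assert (0 < t * inner lam w) by (apply Rmult_lt_0_compat; lra). lra. }
  destruct (right_inverse Lh HL Hsurj) as (M & HM & HLM).
  destruct HK as (_ & K0 & _).
  (* As 0 is in K, lam vanishes on the kernel of Lh; hence M^* lam has the required property for any
     linear right inverse M. *)
  exists (adjv M lam). split.
  - intros e He. rewrite adjv_inner by exact HM. apply Hle. now rewrite HLM.
  - intros y. rewrite adjv_inner by exact HM.
    assert (Hz : Lh (vsub y (M (Lh y))) = vzero)
      by (rewrite (lin_sub Lh) by exact HL; rewrite HLM; apply vsub_self).
    pose proof (Hle (vsub y (M (Lh y))) ltac:(now rewrite Hz)) as H1.
    pose proof (Hle (vscal (-1) (vsub y (M (Lh y))))) as H2.
    rewrite (lin_scal Lh), Hz in H2 by exact HL.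
    replace (vscal (-1) vzero) with (vzero : vec k) in H2 by veq.
    specialize (H2 K0). revert H1 H2. inn. lra.
Qed.

(** [inv_adj] is a choice operator, so its defining identity must be earned by exhibiting a
    solution; surjectivity of Lh then transfers polarity to the chosen one. *)
Lemma inv_adj_spec lam : normal_cone C yb lam ->
  (forall e, K e -> inner (inv_adj Lh lam) e <= 0) /\
  forall y, inner (inv_adj Lh lam) (Lh y) = inner lam y.
Proof.
  intros Hlam. destruct (reduction_multiplier lam Hlam) as (mu & Hmu & Hl).
  assert (Hs : forall y, inner (inv_adj Lh lam) (Lh y) = inner lam y).
  { unfold inv_adj.
    apply (epsilon_spec (inhabits vzero) (fun mu => forall y, inner mu (Lh y) = inner lam y)).
    now exists mu. }
  split; [|exact Hs]. intros e He. destruct (Hsurj e) as [y <-]. rewrite Hs, <- Hl. now apply Hmu.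
Qed.

(** Linearizing h, <mu, Lh (y - yb)> equals <mu, h y> <= 0 up to o(|y - yb|). This turns competitors
    in the polar of K into competitors for the argmax over normals. *)
Lemma multiplier_normal mu : C yb -> (forall e, K e -> inner mu e <= 0) ->
  normal_cone C yb (adjv Lh mu) /\ inv_adj Lh (adjv Lh mu) = mu.
Proof.
  intros HCy Hmu. destruct Hsd as [HL Hst].
  assert (HN : normal_cone C yb (adjv Lh mu)).
  { split; [exact HCy|]. intros eps He. pose proof (norm_ge0 mu) as Hm0.
    destruct (Hst (eps / (1 + norm mu))) as (del & Hdel & Hd); [apply Rdiv_lt_0_compat; lra|].
    exists (Rmin del rh). split; [apply Rmin_glb_lt; lra|]. intros y Hy Hn.
    pose proof (Rmin_l del rh). pose proof (Rmin_r del rh).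
    rewrite adjv_inner by exact HL.
    specialize (Hd yb y ltac:(rewrite vsub_self, norm_zero; lra) ltac:(lra)). rewrite Hh0 in Hd.
    set (e := vsub (vsub (h y) vzero) (Lh (vsub y yb))) in *.
    assert (Hi : inner mu (Lh (vsub y yb)) = inner mu (h y) - inner mu e) by (unfold e; inn; ring).
    assert (Hk : inner mu (h y) <= 0) by (apply Hmu, HCK; [unfold ball; lra|exact Hy]).
    pose proof (Rabs_le_inv _ _ (cauchy_schwarz_abs mu e)) as C1.
    pose proof (norm_ge0 (vsub y yb)) as Hn0.
    assert (norm mu * norm e <= eps * norm (vsub y yb)); [|lra].
    apply Rle_trans with (norm mu * (eps / (1 + norm mu) * norm (vsub y yb)));
      [apply Rmult_le_compat_l; lra|].
    rewrite <- Rmult_assoc. apply Rmult_le_compat_r; [exact Hn0|].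
    assert (0 < eps / (1 + norm mu)) by (apply Rdiv_lt_0_compat; lra).
    replace eps with ((1 + norm mu) * (eps / (1 + norm mu))) at 2 by (field; lra).
    apply Rmult_le_compat_r; lra. }
  split; [exact HN|]. apply inner_ext. intros e. destruct (Hsurj e) as [y <-].
  destruct (inv_adj_spec _ HN) as [_ Hs]. now rewrite Hs, adjv_inner by exact HL.
Qed.

(** Solving h y' = e near y transfers distances from K to C, so that Robinson stability can be used
    in terms of K. The radius rh / (1 + c) keeps y' where K describes C. *)
Lemma reduced_distance : exists c r, 0 <= c /\ 0 < r /\ forall y e,
  norm (vsub y yb) < r -> K e -> norm (vsub (h y) e) < r ->
  exists y', C y' /\ norm (vsub y y') <= c * norm (vsub (h y) e).
Proof.
  destruct (strict_diff_inv _ _ _ Hsd Hsurj) as (c & r & Hc & Hr & Hinv).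
  exists c, (Rmin r (rh / (1 + c))).
  assert (Hq : 0 < rh / (1 + c)) by (apply Rdiv_lt_0_compat; lra).
  split; [lra|split; [now apply Rmin_glb_lt|]]. intros y e Hy He Hn.
  pose proof (Rmin_l r (rh / (1 + c))). pose proof (Rmin_r r (rh / (1 + c))).
  destruct (Hinv y e ltac:(lra) ltac:(lra)) as (y' & Hy' & Hd). exists y'.
  split; [|now rewrite norm_subC]. apply HCK; [|now rewrite Hy']. unfold ball.
  pose proof (norm_tri y y' yb).
  assert (c * norm (vsub (h y) e) <= c * (rh / (1 + c))) by (apply Rmult_le_compat_l; lra).
  assert (rh = c * (rh / (1 + c)) + rh / (1 + c)) by (field; lra). lra.
Qed.
End Reduction.

(** [strict_diff_inv] is applied to z -> ((p1, x), f z), whose derivative is onto as soon as the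
    p2-derivative of f is; prescribing the first component freezes p1 and x. *)
Lemma partial_inverse {P1 P2 X Y : Type} {E1 : Euc P1} {E2 : Euc P2} {EX : Euc X} {EY : Euc Y}
  {H1 : EucSpace P1} {H2 : EucSpace P2} {HX : EucSpace X} {HY : EucSpace Y}
  (f : (P1 * P2) * X -> Y) L zb : strict_diff f L zb ->
  surjective (fun v : P2 => L ((vzero, v), vzero)) ->
  exists c r, 0 < c /\ 0 < r /\ forall p1 p2 x a,
    norm (vsub ((p1, p2), x) zb) < r -> norm (vsub (f ((p1, p2), x)) a) < r ->
    exists p2', f ((p1, p2'), x) = a /\ norm (vsub p2' p2) <= c * norm (vsub (f ((p1, p2), x)) a).
Proof.
  intros [HL Hst] Hs.
  set (F := fun z : (P1 * P2) * X => ((fst (fst z), snd z), f z)).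
  set (LF := fun z : (P1 * P2) * X => ((fst (fst z), snd z), L z)).
  destruct (strict_diff_inv F LF zb) as (c & r & Hc & Hr & Hinv).
  - split.
    + intros a b z w. unfold LF. rewrite HL. reflexivity.
    + intros eps He. destruct (Hst eps He) as (del & Hdel & Hd). exists del. split; [exact Hdel|].
      intros y z Hy Hz. eapply Rle_trans; [|apply (Hd y z Hy Hz)].
      replace (vsub (vsub (F z) (F y)) (LF (vsub z y)))
        with ((@vzero P1 _, @vzero X _), vsub (vsub (f z) (f y)) (L (vsub z y)))
        by (cbn; repeat f_equal; veq).
      eapply Rle_trans; [apply norm_pair|]. change ((vzero : P1), (vzero : X)) with (vzero : P1 * X).
      rewrite norm_zero. lra.
  - intros [[q d] y]. destruct (Hs (vsub y (L ((q, vzero), d)))) as [v Hv].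
    exists ((q, v), d). unfold LF. cbn [fst snd]. f_equal.
    replace ((q, v), d) with (vadd ((q, vzero), d) ((vzero, v), vzero)) by (cbn; repeat f_equal; veq).
    rewrite (lin_add L) by exact HL. rewrite Hv. veq.
  - exists c, r. split; [exact Hc|split; [exact Hr|]]. intros p1 p2 x a Hz Ha.
    assert (Hn : norm (vsub (F ((p1, p2), x)) ((p1, x), a)) <= norm (vsub (f ((p1, p2), x)) a)).
    { replace (vsub (F ((p1, p2), x)) ((p1, x), a))
        with ((@vzero P1 _, @vzero X _), vsub (f ((p1, p2), x)) a)
        by (cbn; repeat f_equal; veq).
      eapply Rle_trans; [apply norm_pair|]. change ((vzero : P1), (vzero : X)) with (vzero : P1 * X).
      rewrite norm_zero. lra. }
    destruct (Hinv ((p1, p2), x) ((p1, x), a) Hz ltac:(lra)) as ([[p1' p2'] x'] & Hb & Hd).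
    unfold F in Hb. cbn [fst snd] in Hb. injection Hb as -> -> Hf. exists p2'. split; [exact Hf|].
    apply Rle_trans with (norm (vsub ((p1, p2'), x) ((p1, p2), x))).
    + eapply Rle_trans; [|apply norm_fst]. eapply Rle_trans; [|apply norm_snd]. apply Rle_refl.
    + eapply Rle_trans; [exact Hd|]. apply Rmult_le_compat_l; lra.
Qed.

(** Dividing G(pb, xb + s w), an element of K, by s gives quotients that converge to L(0, u), and K
    is a closed cone. *)
Lemma tangent_image {P X E : Type} {EP : Euc P} {EX : Euc X} {EE : Euc E}
  {HP : EucSpace P} {HX : EucSpace X} {HE : EucSpace E}
  (A : X -> Prop) (K : E -> Prop) (G : P * X -> E) L B pb xb r u :
  taylor2 G L B (pb, xb) -> G (pb, xb) = vzero -> closed_convex_cone K -> 0 < r ->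
  (forall x, norm (vsub x xb) < r -> A x -> K (G (pb, x))) ->
  tangent_cone A xb u -> K (L (vzero, u)).
Proof.
  intros HT HG0 (Kcl & _ & Ks & _) Hr HA (t & ws & Ht & Htcv & Hws & Hx).
  destruct (taylor2_increment _ _ _ _ HT) as (c & r' & Hc & Hr' & Hinc).
  destruct HT as (HL & _). destruct (lin_bound L HL) as (l & Hl & HLb).
  apply (closed_closure K); [exact Kcl|]. intros eps He.
  set (N := norm u + 1). assert (HN : 1 <= N) by (unfold N; pose proof (norm_ge0 u); lra).
  assert (HcN : 0 <= c * (N * N)) by (apply Rmult_le_pos; [lra|apply Rle_0_sqr]).
  set (dt := Rmin (Rmin r r' / N) (eps / (2 * (1 + c * (N * N))))).
  assert (Hdt : 0 < dt).
  { unfold dt. apply Rmin_glb_lt; apply Rdiv_lt_0_compat; try lra. now apply Rmin_glb_lt. }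
  destruct (Htcv dt Hdt) as [N1 HN1]. destruct (Hws 1) as [N2 HN2]; [lra|].
  destruct (Hws (eps / (2 * (1 + l)))) as [N3 HN3]; [apply Rdiv_lt_0_compat; lra|].
  set (j := max N1 (max N2 N3)).
  specialize (HN1 j ltac:(lia)). specialize (HN2 j ltac:(lia)). specialize (HN3 j ltac:(lia)).
  specialize (Ht j). specialize (Hx j). unfold Rdist in HN1.
  rewrite Rminus_0_r, Rabs_pos_eq in HN1 by lra.
  set (s := t j) in *. set (w := ws j) in *.
  assert (HwN : norm w <= N) by (pose proof (norm_sub_lower w u); unfold N; lra).
  pose proof (Rmin_l (Rmin r r' / N) (eps / (2 * (1 + c * (N * N))))) as D1.
  pose proof (Rmin_r (Rmin r r' / N) (eps / (2 * (1 + c * (N * N))))) as D2. fold dt in D1, D2.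
  pose proof (Rmin_l r r') as D3. pose proof (Rmin_r r r') as D4.
  assert (HsN : s * N < Rmin r r').
  { replace (Rmin r r') with (Rmin r r' / N * N) by (field; lra). apply Rmult_lt_compat_r; lra. }
  assert (Hnw : norm (vscal s w) <= s * N).
  { rewrite norm_scal, Rabs_pos_eq by lra. apply Rmult_le_compat_l; lra. }
  assert (Hnz : norm ((vzero : P), vscal s w) <= norm (vscal s w)) by apply norm_inr.
  assert (Hlt : norm ((vzero : P), vscal s w) < r') by lra.
  destruct (Hinc _ Hlt) as [_ I]. rewrite HG0 in I.
  replace (vadd (pb, xb) (vzero, vscal s w)) with (pb, vadd xb (vscal s w)) in I by (cbn; f_equal; veq).
  set (x := vadd xb (vscal s w)) in *.
  exists (vscal (/ s) (G (pb, x))). split.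
  - apply Ks; [apply Rlt_le, Rinv_0_lt_compat; lra|]. apply HA; [|exact Hx].
    unfold x. replace (vsub (vadd xb (vscal s w)) xb) with (vscal s w) by veq. lra.
  - set (e := vsub (vsub (G (pb, x)) vzero) (L (vzero, vscal s w))) in *.
    replace (vsub (L (vzero, u)) (vscal (/ s) (G (pb, x))))
      with (vsub (L (vzero, vsub u w)) (vscal (/ s) e)).
    + assert (I1 : norm (L (vzero, vsub u w)) <= eps / 2).
      { eapply Rle_trans; [apply HLb|]. pose proof (norm_inr (P := P) (vsub u w)) as Hi.
        rewrite (norm_subC u w) in Hi.
        assert (l * norm ((vzero : P), vsub u w) <= l * (eps / (2 * (1 + l))))
          by (apply Rmult_le_compat_l; lra).
        assert (0 < eps / (2 * (1 + l))) by (apply Rdiv_lt_0_compat; lra).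
        assert (eps / 2 = l * (eps / (2 * (1 + l))) + eps / (2 * (1 + l))) by (field; lra). lra. }
      assert (I2 : norm (vscal (/ s) e) < eps / 2).
      { assert (Hsi : 0 < / s) by (apply Rinv_0_lt_compat; lra).
        rewrite norm_scal, Rabs_pos_eq by lra.
        set (m := norm ((vzero : P), vscal s w)) in *. assert (0 <= m) by apply norm_ge0.
        assert (m * m <= s * N * (s * N)) by (apply Rmult_le_compat; lra).
        apply Rle_lt_trans with (/ s * (c * (s * N * (s * N)))).
        - apply Rmult_le_compat_l; [lra|]. eapply Rle_trans; [exact I|]. apply Rmult_le_compat_l; lra.
        - replace (/ s * (c * (s * N * (s * N)))) with (s * (c * (N * N))) by (field; lra).
          assert (s * (1 + c * (N * N)) < eps / 2); [|lra].
          replace (eps / 2) with (eps / (2 * (1 + c * (N * N))) * (1 + c * (N * N))) by (field; lra).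
          apply Rmult_lt_compat_r; lra. }
      pose proof (norm_sub (L (vzero, vsub u w)) (vscal (/ s) e)). lra.
    + unfold e.
      rewrite (lin_sub (fun d => L (vzero, d)) u w), (lin_scal (fun d => L (vzero, d)) s w)
        by now apply partial_linear.
      apply inner_ext. intros y. inn. field. lra.
Qed.

(** * Second-order terms expressed through the reduced multiplier *)

Section Multipliers.
Context {m1 m2 n l k : nat}.
Context (Df : (vec m1 * vec m2) * vec n -> (vec m1 * vec m2) * vec n -> vec n)
  (Dg : (vec m1 * vec m2) * vec n -> (vec m1 * vec m2) * vec n -> vec l)
  (D2g : (vec m1 * vec m2) * vec n -> (vec m1 * vec m2) * vec n -> (vec m1 * vec m2) * vec n -> vec l)
  (zb : (vec m1 * vec m2) * vec n) (Lh : vec l -> vec k) (Bh : vec l -> vec l -> vec k).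
Context (HL : is_linear (Dg zb)) (HB : is_bilinear (D2g zb)) (HBh : is_bilinear Bh).

Lemma hess_mu_h_inner mu y y' : inner (hess_mu_h Bh mu y) y' = inner mu (Bh y y').
Proof.
  apply (riesz_inner l (fun y' => inner mu (Bh y y'))). intros a b c d.
  rewrite (bilin_r Bh y HBh). inn. ring.
Qed.

(** The right-hand side pairs the reduced multiplier with the second derivative of h o g; it is
    linear in that multiplier, the form needed for [linear_duality]. *)
Lemma lam_obj_eq lam v : (forall y, inner (inv_adj Lh lam) (Lh y) = inner lam y) ->
  lam_obj (Dg zb) (D2g zb) Lh Bh lam v =
  inner (inv_adj Lh lam) (vadd (Lh (D2g zb v v)) (Bh (Dg zb v) (Dg zb v))).
Proof. intros Hs. unfold lam_obj. now rewrite hess_mu_h_inner, inner_addr, Hs. Qed.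

(** Identifies F u with the functional w of [perturbed_critical_points]. *)
Lemma Fop_inner lam u d : (forall y, inner (inv_adj Lh lam) (Lh y) = inner lam y) ->
  inner (Fop Df Dg D2g zb Lh Bh lam u) d = inner (Df zb (vzero, u)) d +
  inner (inv_adj Lh lam) (vadd (Lh (D2g zb (vzero, u) (vzero, d)))
                               (Bh (Dg zb (vzero, u)) (Dg zb (vzero, d)))).
Proof.
  intros Hs. unfold Fop, Hx. rewrite !inner_addl, inner_addr, Hs.
  rewrite adjv_inner, hess_mu_h_inner by now apply (partial_linear (Dg zb)).
  rewrite (riesz_inner n (fun w => inner lam (D2g zb (vzero, u) (vzero, w)))).
  - unfold Defs.Dx. ring.
  - intros a b x y.
    rewrite (partial_linear (D2g zb (vzero, u)) (bilin_r _ _ HB) a b x y). inn. ring.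
Qed.
End Multipliers.

(** * Isolated calmness *)

Lemma vsub_pair {V W : Type} {EV : Euc V} {EW : Euc W} (a a' : V) (b b' : W) :
  vsub (a, b) (a', b') = (vsub a a', vsub b b').
Proof. reflexivity. Qed.

Lemma pair_decompose {P X : Type} {EP : Euc P} {EX : Euc X} {HP : EucSpace P} {HX : EucSpace X}
  (q : P) (u v : X) t :
  (q, vadd (vscal t u) v) = vadd (vadd (q, vzero) (vscal t (vzero, u))) (vzero, v).
Proof. cbn. f_equal; veq. Qed.

(* Surjectivity in p2 lets us solve f(p,x) = a exactly for the gradient a of the penalized
   objective, at the price of moving p2 by O(sigma t), while |x - xb| is about t |u|. *)
Lemma calmness_obstruction {m1 m2 n : nat} (Gam : vec m1 * vec m2 -> vec n -> Prop)
  (f : (vec m1 * vec m2) * vec n -> vec n) Lf (pb : vec m1 * vec m2) (xb u : vec n) (M : R) :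
  strict_diff f Lf (pb, xb) ->
  surjective (fun v : vec m2 => Lf ((vzero, v), vzero)) ->
  (forall p1 p2 p2' x, Gam (p1, p2) x = Gam (p1, p2') x) ->
  u <> vzero -> 0 <= M ->
  (forall sigma, 0 < sigma -> exists N, 0 <= N /\
     small_t (fun t => exists p x, norm (vsub p pb) <= N * (t * t) /\
       norm (vsub (vsub x xb) (vscal t u)) <= sigma * t /\
       normal_cone (Gam p) x (vscal (-1)
         (vadd (vadd (f (pb, xb)) (vscal t (Lf (vzero, u))))
               (vscal M (vsub (vsub x xb) (vscal t u))))))) ->
  ~ isolatedly_calm (fun p x => normal_cone (Gam p) x (vscal (-1) (f (p, x)))) pb xb.
Proof.
  intros Hf Hs Hind Hu HM Happ (ell & Q & U & Hell & (rQ & HrQ & HQ) & (rU & HrU & HU) & Hcalm).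
  destruct (partial_inverse f Lf _ Hf Hs) as (c & r & Hc & Hr & Hinv).
  destruct Hf as [HL Hst]. destruct (lin_bound Lf HL) as (l & Hl & HLb).
  assert (Hu0 : 0 < norm u).
  { pose proof (norm_ge0 u). destruct (Req_dec (norm u) 0) as [H0|]; [|lra].
    elim Hu. now apply norm_eq0. }
  (* k1 sg t bounds |f z - a|: |u| + 2 from the linearization error, one l each from the p1-shift
     and from v, and M from the penalty gradient. *)
  set (k1 := norm u + 2 + 2 * l + M).
  assert (Hk1 : 0 < k1) by (unfold k1; lra).
  (* Calmness will give t |u| <= |v| + |d| <= sg k2 t, which the choice of sg makes at most t |u| /
     2. *)
  set (k2 := 1 + ell * (c * k1 + 1)).
  assert (Hck : 0 < c * k1) by (apply Rmult_lt_0_compat; lra).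
  assert (Hk2 : 1 < k2) by (unfold k2; assert (0 < ell * (c * k1 + 1)) by (apply Rmult_lt_0_compat; lra); lra).
  set (sg := Rmin 1 (norm u / (2 * k2))).
  assert (Hq : 0 < norm u / (2 * k2)) by (apply Rdiv_lt_0_compat; lra).
  assert (Hsg : 0 < sg) by (unfold sg; apply Rmin_glb_lt; lra).
  pose proof (Rmin_l 1 (norm u / (2 * k2))) as Hsg1. pose proof (Rmin_r 1 (norm u / (2 * k2))) as Hsg2.
  fold sg in Hsg1, Hsg2.
  destruct (Happ sg Hsg) as (N & HN & HE). destruct (Hst sg Hsg) as (del & Hdel & Hd).
  destruct (small_t_and _ _ HE (small_t_and _ _ (small_t_lt N sg Hsg) (small_t_and _ _ (small_t_lt (norm u + 2) del Hdel)
    (small_t_and _ _ (small_t_lt (norm u + 2) r Hr) (small_t_and _ _ (small_t_lt (sg * k1) r Hr)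
    (small_t_and _ _ (small_t_lt (norm u + 2) rU HrU) (small_t_lt (sg * (c * k1 + 1)) rQ HrQ)))))))
    as (t0 & Ht0 & Ht).
  destruct (Ht (t0 / 2) ltac:(lra)) as (((p1 & p2) & x & Hp & Hx & Hn) & T1 & T2 & T3 & T4 & T5 & T6).
  clear Ht HE. set (t := t0 / 2) in *. assert (Htp : 0 < t) by (unfold t; lra). clearbody t.
  set (d := vsub x xb) in *. set (v := vsub d (vscal t u)) in *.
  assert (Hd' : d = vadd (vscal t u) v) by (unfold v; veq).
  assert (Hnu : norm (vscal t u) = t * norm u) by (rewrite norm_scal, Rabs_pos_eq; lra).
  assert (HNt : N * (t * t) <= sg * t) by (rewrite <- Rmult_assoc; apply Rmult_le_compat_r; lra).
  assert (Hsgt : sg * t <= t) by (rewrite <- (Rmult_1_l t) at 2; apply Rmult_le_compat_r; lra).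
  destruct pb as [pb1 pb2].
  (* The given p2 is discarded and reset to pb2, since Gam ignores it; p2 then moves only as far as
     solving f = a requires. *)
  set (q := (vsub p1 pb1, (vzero : vec m2))).
  assert (Hq' : norm q <= sg * t).
  { pose proof (norm_inl (X := vec m2) (vsub p1 pb1)) as N1. fold q in N1.
    pose proof (norm_fst (vsub p1 pb1) (vsub p2 pb2)) as N2.
    change (vsub p1 pb1, vsub p2 pb2) with (vsub (p1, p2) (pb1, pb2)) in N2. lra. }
  assert (Hdn : norm d <= t * norm u + sg * t) by (rewrite Hd'; eapply Rle_trans; [apply norm_add|]; lra).
  set (z := ((p1, pb2), x)).
  assert (Hz : vsub z ((pb1, pb2), xb) = (q, d)) by (unfold z, q, d; rewrite !vsub_pair, vsub_self; reflexivity).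
  assert (Hqd : norm (q, d) <= (norm u + 2) * t) by (pose proof (norm_pair q d); lra).
  set (a := vadd (vadd (f ((pb1, pb2), xb)) (vscal t (Lf (vzero, u)))) (vscal M v)) in *.
  assert (Ha : norm (vsub (f z) a) <= sg * k1 * t).
  { assert (Hz0 : norm (vsub ((pb1, pb2), xb) ((pb1, pb2), xb)) < del)
      by (rewrite vsub_self, norm_zero; exact Hdel).
    assert (Hz1 : norm (vsub z ((pb1, pb2), xb)) < del) by (rewrite Hz; lra).
    pose proof (Hd _ _ Hz0 Hz1) as He. rewrite Hz in He.
    set (e := vsub (vsub (f z) (f ((pb1, pb2), xb))) (Lf (q, d))) in *.
    assert (HLqd : Lf (q, d) = vadd (vadd (Lf (q, vzero)) (vscal t (Lf (vzero, u)))) (Lf (vzero, v))).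
    { rewrite <- (lin_scal Lf), <- !(lin_add Lf) by exact HL. f_equal. rewrite Hd'.
      apply pair_decompose. }
    replace (vsub (f z) a) with (vadd e (vadd (Lf (q, vzero)) (vsub (Lf (vzero, v)) (vscal M v))))
      by (unfold e, a; rewrite HLqd; veq).
    pose proof (norm_add e (vadd (Lf (q, vzero)) (vsub (Lf (vzero, v)) (vscal M v)))).
    pose proof (norm_add (Lf (q, vzero)) (vsub (Lf (vzero, v)) (vscal M v))).
    pose proof (norm_sub (Lf (vzero, v)) (vscal M v)) as H3.
    rewrite norm_scal, Rabs_pos_eq in H3 by exact HM.
    pose proof (HLb (q, vzero)) as B1. pose proof (HLb (vzero, v)) as B2.
    pose proof (norm_inl (X := vec n) q) as N1. pose proof (norm_inr (P := vec m1 * vec m2) v) as N2.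
    assert (l * norm (q, (vzero : vec n)) <= l * (sg * t)) by (apply Rmult_le_compat_l; lra).
    assert (l * norm ((vzero : vec m1 * vec m2), v) <= l * (sg * t)) by (apply Rmult_le_compat_l; lra).
    assert (M * norm v <= M * (sg * t)) by (apply Rmult_le_compat_l; lra).
    assert (sg * norm (q, d) <= sg * ((norm u + 2) * t)) by (apply Rmult_le_compat_l; lra).
    unfold k1. lra. }
  destruct (Hinv p1 pb2 x a) as (p2' & Hfa & Hp2).
  { fold z. rewrite Hz. lra. }
  { fold z. lra. }
  fold z in Hp2.
  assert (Hpp : norm (vsub (p1, p2') (pb1, pb2)) <= sg * (c * k1 + 1) * t).
  { change (vsub (p1, p2') (pb1, pb2)) with (vsub p1 pb1, vsub p2' pb2).
    eapply Rle_trans; [apply norm_pair|].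
    pose proof (norm_fst (vsub p1 pb1) (vzero : vec m2)) as N1. fold q in N1.
    assert (c * norm (vsub (f z) a) <= c * (sg * k1 * t)) by (apply Rmult_le_compat_l; lra). lra. }
  assert (HGeq : Gam (p1, p2) = Gam (p1, p2')).
  { extensionality y. apply Hind. }
  pose proof (Hcalm (p1, p2') x) as Hfin. fold d in Hfin.
  assert (Hle : norm d <= ell * norm (vsub (p1, p2') (pb1, pb2))).
  { apply Hfin.
    - apply HQ. unfold ball. lra.
    - rewrite Hfa, <- HGeq. exact Hn.
    - apply HU. unfold ball. fold d. lra. }
  assert (ell * norm (vsub (p1, p2') (pb1, pb2)) <= ell * (sg * (c * k1 + 1) * t))
    by (apply Rmult_le_compat_l; lra).
  pose proof (norm_sub_lower (vscal t u) d) as Hlow. rewrite (norm_subC _ d) in Hlow. fold v in Hlow.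
  assert (Hsk : sg * k2 <= norm u / 2).
  { replace (norm u / 2) with (norm u / (2 * k2) * k2) by (field; lra). apply Rmult_le_compat_r; lra. }
  assert (sg * k2 * t <= norm u / 2 * t) by (apply Rmult_le_compat_r; lra).
  assert (0 < norm u * t) by (apply Rmult_lt_0_compat; lra).
  unfold k2 in *. lra.
Qed.

Theorem theorem6p3 (m1 m2 n l k : nat)
  (g : (vec m1 * vec m2) * vec n -> vec l)
  (Dg : (vec m1 * vec m2) * vec n -> (vec m1 * vec m2) * vec n -> vec l)
  (D2g : (vec m1 * vec m2) * vec n -> (vec m1 * vec m2) * vec n ->
         (vec m1 * vec m2) * vec n -> vec l)
  (f : (vec m1 * vec m2) * vec n -> vec n)
  (Df : (vec m1 * vec m2) * vec n -> (vec m1 * vec m2) * vec n -> vec n)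
  (C : vec l -> Prop) (K : vec k -> Prop)
  (h : vec l -> vec k) (Dh : vec l -> vec l -> vec k) (D2h : vec l -> vec l -> vec l -> vec k)
  (pb : vec m1 * vec m2) (xb : vec n)
  (* g is C^2 around zb, f is C^1 around zb *)
  (Hg : C2_around g Dg D2g (pb, xb))
  (Hf : C1_around f Df (pb, xb))
  (* C closed, C^2-cone reducible at g(zb) to the closed convex cone K via h *)
  (HCcl : is_closed C)
  (Hred : cone_reducible C (g (pb, xb)) K h Dh D2h)
  (* xb ∈ S(pb) *)
  (Hsol : Ssol g C f pb xb)
  (* Robinson stability and isolated calmness *)
  (Hrob : robinson_stable g C pb xb)
  (Hcalm : isolatedly_calm (Ssol g C f) pb xb)
  (* g does not depend on p2 *)
  (Hindep : forall (p1 : vec m1) (p2 : vec m2) (x : vec n),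
      g ((p1, p2), x) = g ((p1, snd pb), x))
  (* ∇_{p2} f(pb,xb) is surjective *)
  (Hsurj : surjective (fun v : vec m2 => Df (pb, xb) ((vzero, v), vzero))) :
  cond_C1 g C f Df Dg D2g Dh D2h pb xb /\
  (extra_cond g C f Dg D2g Dh D2h pb xb -> cond_C2 g C f Df Dg D2g Dh D2h pb xb).
Proof.
  destruct Hg as (rg & Hrg & Hg2). destruct Hf as (rf & Hrf & Hf1).
  destruct (C2_on_facts _ _ _ _ _ Hrg Hg2) as (Tg & Sg & Symg).
  assert (Sf : strict_diff f (Df (pb, xb)) (pb, xb)).
  { apply (strict_diff_C1 f Df (pb, xb) rf Hrf); [intros y Hy; apply (Hf1 y Hy)|].
    apply Hf1. unfold ball. now rewrite vsub_self, norm_zero. }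
  destruct Hred as (HK & V & HVo & HVy & Hh2 & Hh0 & HhS & HCV).
  destruct (HVo _ HVy) as (rh & Hrh & HVb).
  assert (Hh2' : C2_on (ball (g (pb, xb)) rh) h Dh D2h) by (intros y Hy; apply Hh2, HVb, Hy).
  destruct (C2_on_facts _ _ _ _ _ Hrh Hh2') as (Th & Sh & Symh).
  assert (HCK : forall y, ball (g (pb, xb)) rh y -> (C y <-> K (h y))) by (intros y Hy; apply HCV, HVb, Hy).
  set (zb := (pb, xb)) in *. set (yb := g zb) in *.
  pose proof (taylor2_comp _ _ _ _ _ _ _ Tg Th) as TG.
  set (G := fun z => h (g z)) in TG. set (L := fun z => Dh yb (Dg zb z)) in TG.
  set (B := fun z w => vadd (Dh yb (D2g zb z w)) (D2h yb (Dg zb z) (Dg zb w))) in TG.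
  assert (HCy : C yb) by apply Hsol.
  destruct Tg as (HLg & HBg & _). destruct Th as (HLh & HBh & HTh).
  pose proof (conj HLh (conj HBh HTh) : taylor2 h (Dh yb) (D2h yb) yb) as Th.
  assert (Hspec : forall lam, normal_cone C yb lam ->
    (forall e, K e -> inner (inv_adj (Dh yb) lam) e <= 0) /\
    forall y, inner (inv_adj (Dh yb) lam) (Dh yb y) = inner lam y)
    by exact (inv_adj_spec C yb K h (Dh yb) (D2h yb) rh HK Th Sh Hh0 HhS Hrh HCK).
  assert (Hkc : forall u, Kcrit g C f pb xb u <->
     tangent_cone (Gamma g C pb) xb u /\ inner (f zb) u = 0).
  { intros u. unfold Kcrit, critical_cone. fold zb. rewrite inner_scall. intuition lra. }
  assert (HC1 : cond_C1 g C f Df Dg D2g Dh D2h pb xb).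
  { intros u Hu Hku lam [HlamN Hlam0] lamh [[HlN HlD] Hlmax].
    fold zb yb in HlN, HlD, Hlmax, Hlam0 |- *. apply NNPP. intros Hno.
    apply Hkc in Hku. destruct Hku as [Hku Hfu].
    destruct (Hspec lamh HlN) as [Hmu Hmus].
    set (mu := inv_adj (Dh yb) lamh) in *.
    set (w := Fop Df Dg D2g zb (Dh yb) (D2h yb) lamh u) in *.
    assert (Hw : forall d, inner w d = inner (Df zb (vzero, u)) d + inner mu (B (vzero, u) (vzero, d))).
    { intros d. apply (Fop_inner Df Dg D2g zb (Dh yb) (D2h yb) HLg HBg HBh). exact Hmus. }
    destruct (strict_diff_lipschitz _ _ _ Sg) as (cg & rlg & Hcg & Hrlg & Hlip).
    destruct (reduced_distance C yb K h (Dh yb) rh Sh HhS Hrh HCK) as (cd & rd & Hcd & Hrd & Hdist).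
    destruct Hrob as (kap & Wn & Un & Hkap & (rW & HrW & HWn) & (rU & HrU & HUn) & Hrob).
    set (s := Rmin rh rd).
    assert (Hs : 0 < s / (2 * (1 + cg))).
    { apply Rdiv_lt_0_compat; [unfold s; apply Rmin_glb_lt|]; lra. }
    (* Within r0 the value g(p, x) stays within s of yb, where both the reduction and [Hdist] apply;
       the factors 2 come from bounding the norm of a pair by a sum. *)
    set (r0 := Rmin (Rmin (rlg / 2) (s / (2 * (1 + cg)))) (Rmin (Rmin rW rU) rd)).
    assert (Hr0 : 0 < r0) by (unfold r0; repeat apply Rmin_glb_lt; lra).
    assert (Hr01 : r0 <= rlg / 2 /\ r0 <= s / (2 * (1 + cg)) /\ r0 <= rW /\ r0 <= rU /\ r0 <= rd).
    { pose proof (Rmin_l (Rmin (rlg / 2) (s / (2 * (1 + cg)))) (Rmin (Rmin rW rU) rd)).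
      pose proof (Rmin_r (Rmin (rlg / 2) (s / (2 * (1 + cg)))) (Rmin (Rmin rW rU) rd)).
      pose proof (Rmin_l (rlg / 2) (s / (2 * (1 + cg)))). pose proof (Rmin_r (rlg / 2) (s / (2 * (1 + cg)))).
      pose proof (Rmin_l (Rmin rW rU) rd). pose proof (Rmin_r (Rmin rW rU) rd).
      pose proof (Rmin_l rW rU). pose proof (Rmin_r rW rU). unfold r0. repeat split; lra. }
    clearbody r0. destruct Hr01 as (R1 & R2 & R3 & R4 & R5).
    assert (Hzn : forall p x, norm (vsub p pb) < r0 -> norm (vsub x xb) < r0 ->
      norm (vsub (p, x) zb) < rlg).
    { intros p x Hp Hx. change (vsub (p, x) zb) with (vsub p pb, vsub x xb).
      pose proof (norm_pair (vsub p pb) (vsub x xb)). lra. }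
    assert (Hgn : forall p x, norm (vsub p pb) < r0 -> norm (vsub x xb) < r0 ->
      norm (vsub (g (p, x)) yb) < s).
    { intros p x Hp Hx.
      assert (Hz0 : norm (vsub zb zb) < rlg) by (rewrite vsub_self, norm_zero; exact Hrlg).
      pose proof (Hlip _ _ Hz0 (Hzn p x Hp Hx)) as Hg1. fold yb in Hg1.
      change (vsub (p, x) zb) with (vsub p pb, vsub x xb) in Hg1.
      pose proof (norm_pair (vsub p pb) (vsub x xb)).
      assert (cg * norm (vsub p pb, vsub x xb) <= cg * (2 * (s / (2 * (1 + cg)))))
        by (apply Rmult_le_compat_l; lra).
      assert (s = cg * (2 * (s / (2 * (1 + cg)))) + 2 * (s / (2 * (1 + cg)))) by (field; lra). lra. }
    assert (Hsh : s <= rh) by apply Rmin_l. assert (Hsd : s <= rd) by apply Rmin_r.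
    assert (Hloc : forall p x, norm (vsub p pb) < r0 -> norm (vsub x xb) < r0 ->
      Gamma g C p x -> K (G (p, x))).
    { intros p x Hp Hx HG. apply HCK; [|exact HG]. pose proof (Hgn p x Hp Hx). unfold ball. lra. }
    (* Continuity of g is known only near zb, so closedness of Gamma(p) is claimed only inside a
       ball. *)
    assert (Hclo : forall p, norm (vsub p pb) < r0 ->
      is_closed (fun x => Gamma g C p x /\ norm (vsub x xb) <= r0 / 2)).
    { intros p Hp sq x Hsq Hcv.
      assert (Hx : norm (vsub x xb) <= r0 / 2) by (apply (seq_cv_le sq); [exact Hcv|apply Hsq]).
      split; [|exact Hx]. apply (HCcl (fun j => g (p, sq j))); [apply Hsq|].
      intros eps He. destruct (Hcv (eps / (1 + cg))) as [N HN]; [apply Rdiv_lt_0_compat; lra|].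
      exists N. intros j Hj. specialize (HN j Hj). destruct (Hsq j) as [_ Hj2].
      assert (Hz1 : norm (vsub (p, x) zb) < rlg) by (apply Hzn; lra).
      assert (Hz2 : norm (vsub (p, sq j) zb) < rlg) by (apply Hzn; lra).
      pose proof (Hlip _ _ Hz1 Hz2) as Hg1.
      rewrite vsub_pair, vsub_self in Hg1.
      pose proof (norm_inr (P := vec m1 * vec m2) (vsub (sq j) x)) as Hi.
      assert (cg * norm (@vzero (vec m1 * vec m2) _, vsub (sq j) x) <= cg * (eps / (1 + cg)))
        by (apply Rmult_le_compat_l; lra).
      assert (0 < eps / (1 + cg)) by (apply Rdiv_lt_0_compat; lra).
      assert (eps = cg * (eps / (1 + cg)) + eps / (1 + cg)) by (field; lra). lra. }
    (* The point y' of C produced by [Hdist] is the one against which Robinson stability is tested,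
       whence the modulus kap cd. *)
    assert (Hrob' : forall p x e eta, norm (vsub p pb) < r0 -> norm (vsub x xb) < r0 -> K e ->
      norm (vsub (G (p, x)) e) < r0 -> 0 < eta ->
      exists x', Gamma g C p x' /\ norm (vsub x x') <= kap * cd * norm (vsub (G (p, x)) e) + eta).
    { intros p x e eta Hp Hx HKe Hn Heta. pose proof (Hgn p x Hp Hx) as Hy.
      destruct (Hdist (g (p, x)) e ltac:(lra) HKe ltac:(unfold G in Hn; lra)) as (y' & HCy' & Hyd).
      assert (HWp : Wn p) by (apply HWn; unfold ball; lra).
      assert (HUx : Un x) by (apply HUn; unfold ball; lra).
      destruct (Hrob p x HWp HUx y' HCy' eta Heta) as (x' & Hx' & Hxx). exists x'. split; [exact Hx'|].
      assert (kap * norm (vsub (g (p, x)) y') <= kap * (cd * norm (vsub (h (g (p, x))) e)))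
        by (apply Rmult_le_compat_l; lra). unfold G. lra. }
    assert (HLlam : forall v, inner mu (L v) = inner lam (Dg zb v)).
    { intros v. unfold L. now rewrite Hmus. }
    destruct (perturbed_critical_points (Gamma g C) K G L B pb xb mu (f zb) (Df zb (vzero, u)) u
       r0 (kap * cd)) with (w := w) as (M & HM & Happ); try assumption.
    - now apply Rmult_le_pos.
    (* Maximality of lamh among normals becomes maximality of mu in the polar of K, through the
       normal (grad h)^* mu'. *)
    - intros mu' Hmu' HL'.
      destruct (multiplier_normal C yb K h (Dh yb) (D2h yb) rh HK Th Sh Hh0 HhS Hrh HCK mu' HCy Hmu')
        as [HN' Hinv'].
      destruct (Hspec _ HN') as [_ Hs'].
      assert (HS' : LamSet C yb (Dg zb) (fun v => inner lam (Dg zb v)) (adjv (Dh yb) mu')).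
      { split; [exact HN'|]. intros v. rewrite adjv_inner by exact HLh.
        change (inner mu' (L v) = inner lam (Dg zb v)). now rewrite HL', HLlam. }
      specialize (Hlmax _ HS').
      rewrite !(lam_obj_eq Dg D2g zb (Dh yb) (D2h yb) HBh) in Hlmax by assumption.
      rewrite Hinv' in Hlmax. exact Hlmax.
    - intros d. rewrite HLlam.
      pose proof (f_equal (fun y => inner y d) Hlam0) as H0. cbv beta in H0.
      rewrite inner_zerol, inner_addl, adjv_inner in H0 by now apply (partial_linear (Dg zb)). exact H0.
    - apply (tangent_image (Gamma g C pb) K G L B pb xb r0); try assumption.
      intros x Hx. apply Hloc; [rewrite vsub_self, norm_zero; exact Hr0|exact Hx].
    - intros d. unfold B. now rewrite (Symg (vzero, d)), (Symh (Dg zb (vzero, d))).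
    - intros d Hd Hfd. apply Rnot_lt_le. intros Hlt. apply Hno. right. exists d.
      split; [apply Hkc; now split|exact Hlt].
    - apply Rnot_lt_le. intros Hlt. apply Hno. now left.
    - refine (calmness_obstruction (Gamma g C) f (Df zb) pb xb u M Sf Hsurj _ Hu HM Happ Hcalm).
      intros p1 p2 p2' x. unfold Gamma. now rewrite (Hindep p1 p2), (Hindep p1 p2'). }
  split; [exact HC1|]. intros Hex u Hu Hku lam Hlam. fold zb yb.
  apply (HC1 u Hu Hku lam Hlam). fold zb yb.
  destruct (Hex u Hku) as (v & w & [Hw1 Hw2] & Hvw). fold zb yb in Hw1, Hw2, Hvw.
  (* The extra condition writes the objective as <lam', Dg v> + <lam', w>. The constraint fixes the
     first term, and the second vanishes because w and -w are both tangent; so lam is itself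
     maximal, and (C1) applies with lamh = lam. *)
  assert (Hval : forall lam', LamSet C yb (Dg zb) (fun v => inner lam (Dg zb v)) lam' ->
    lam_obj (Dg zb) (D2g zb) (Dh yb) (D2h yb) lam' (vzero, u) = inner lam (Dg zb v)).
  { intros lam' [HN' HD']. destruct (Hspec _ HN') as [_ Hs'].
    rewrite (lam_obj_eq Dg D2g zb (Dh yb) (D2h yb) HBh) by exact Hs'.
    unfold Defs.Dx in Hvw. rewrite Hvw, inner_addr, !Hs', HD'.
    pose proof (normal_tangent _ _ _ _ HN' Hw1) as H1. pose proof (normal_tangent _ _ _ _ HN' Hw2) as H2.
    rewrite inner_scalr in H2. lra. }
  assert (HS : LamSet C yb (Dg zb) (fun v => inner lam (Dg zb v)) lam)
    by (split; [apply Hlam|reflexivity]).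
  split; [exact HS|]. intros lam' HS'. rewrite (Hval lam' HS'), (Hval lam HS). lra.
Qed.
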